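(* Let $R,L,J,m,D_p,D_q,V,\omega_g,\omega_n,v_{\rm set}>0$ and $T_m\in\mathbb{R}$, put $\tilde T_m=T_m+D_p(\omega_n-\omega_g)$ and assume $4R\omega_g\tilde T_m>-V^2$. Let $u_{min}<u_{max}$ in $\mathbb{R}$ and $\varepsilon>0$ be such that $U_\varepsilon=[u_{min}-\varepsilon,u_{max}+\varepsilon]\subset I_f^+$, and consider the closed-loop system (fifth order model with saturating integrator) of the context, with state $\mathbf{z}=\begin{bmatrix}\mathbf{x}\\ i_f\end{bmatrix}\in\mathbb{R}^5$. Assume that the parameters are such that the fourth order system $\mathbf{P}$ has a locally exponentially stable equilibrium point for every constant $i_f\in U_\varepsilon$. Then, for any $\tilde Q\in[G(u_{min}),G(u_{max})]$, denoting $i_{fr}^e=G^{-1}(\tilde Q)$, there exist $\varepsilon_0>0$ and $\kappa>0$ such that: if $\tilde K>\frac1\kappa$, then $\mathbf{z}_r^e=(\Xi(i_{fr}^e),i_{fr}^e)$ is a (locally) exponentially stable equilibrium point of the closed-loop system, with state space $X=\mathbb{R}^4\times[u_{min},u_{max}]$. Moreover, if the initial state $(\mathbf{x}(0),i_f(0))\in X$ of the closed-loop system satisfies $\|\mathbf{x}(0)-\Xi(i_f(0))\|\le\varepsilon_0$, then $$\mathbf{x}(t)\to\Xi(i_{fr}^e),\qquad i_f(t)\to i_{fr}^e,\qquad Q(t)\to\tilde Q\qquad(t\to\infty),$$ and this convergence is at an exponential rate.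
   Context: Fourth order system $\mathbf{P}$: with input $i_f$, state $\mathbf{x}=[i_d\ i_q\ \omega\ \delta]^\top\in\mathbb{R}^4$ (angles are here not identified modulo $2\pi$) and output $Q$: $$L\dot i_d=-Ri_d+\omega Li_q+V\sin\delta,\qquad L\dot i_q=-\omega Li_d-Ri_q-mi_f\omega+V\cos\delta,$$ $$J\dot\omega=mi_fi_q-D_p\omega+T_m+D_p\omega_n,\qquad \dot\delta=\omega-\omega_g,\qquad Q=V[i_q\sin\delta-i_d\cos\delta].$$ Also $P=-V[i_d\sin\delta+i_q\cos\delta]$. Closed-loop system: the equations of $\mathbf{P}$ together with $$\frac{{\rm d}i_f}{{\rm d}t}=\mathcal{S}\left(i_f,\frac{\tilde Q-Q}{\tilde K}\right),\qquad \mathcal{S}(i_f,w)=\begin{cases}\max\{w,0\}& i_f\le u_{min},\\ w& i_f\in(u_{min},u_{max}),\\ \min\{w,0\}& i_f\ge u_{max},\end{cases}$$ where $\tilde K>0$ is a constant and $\tilde Q=Q_{\rm set}+D_q\left(v_{\rm set}-\sqrt{2/3}\,V\right)$ is a real constant, with $Q_{\rm set}\in\mathbb{R}$ (so $\tilde Q$ can be any real number by choice of $Q_{\rm set}$). Equilibrium points of $\mathbf{P}$: let $p=R/L$, $\phi\in(0,\pi/2)$ with $\tan\phi=\omega_gL/R$, and for $i_f>0$ $$\Lambda(i_f)=-\frac{\tilde T_m}{mi_f}\frac{L\sqrt{p^2+\omega_g^2}}{V}+\frac{mi_f\omega_gp}{V\sqrt{p^2+\omega_g^2}},\qquad I_f=\{i_f>0:\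 |\Lambda(i_f)|\le1\}.$$ For $i_f\in I_f$ define the equilibrium point $\Xi(i_f)=\mathbf{x}_1^e=[i_{d1}^e\ i_q^e\ \omega_g\ \delta_1^e]^\top$ by $$\delta_1^e=\arccos\Lambda(i_f)-\phi,\qquad i_{d1}^e=-\frac{\tilde T_m\omega_g}{mi_fp}+\frac{V\sin\delta_1^e}{R},\qquad i_q^e=-\frac{\tilde T_m}{mi_f},$$ with $\arccos:[-1,1]\to[0,\pi]$. Let $P_1(i_f),Q_1(i_f)$ be the values of $P,Q$ at $\Xi(i_f)$ and $S_1(i_f)=(P_1(i_f),Q_1(i_f))$. Interval $I_f^+$: let $i_{f-}=\inf I_f$, $i_{f+}=\sup I_f$, $r=\frac{1}{2R}\sqrt{V^4+4V^2R\tilde T_m\omega_g}$. If $\omega_gL>R$, let $i_{f0}\in I_f$ be the unique value with $S_1(i_{f0})=(-V^2/2R,\,r)$ and $I_f^+=(i_{f-},i_{f0})$. If $\omega_gL\le R$, let $i_{f0}\in I_f$ be the unique value with $S_1(i_{f0})=(-V^2/2R,\,-r)$ and $I_f^+=(i_{f0},i_{f+})$. $G:U_\varepsilon\to\mathbb{R}$ is the steady-state input-output map of $\mathbf{P}$: $G(i_f)=Q_1(i_f)$. It is known that $G'>0$ on $U_\varepsilon$, so $G$ is invertible onto its range. *)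

(* Defs.v *)
From mathcomp Require Import all_boot all_order all_algebra.
From mathcomp Require Import all_classical all_reals all_analysis.

Set Implicit Arguments.
Unset Strict Implicit.
Unset Printing Implicit Defensive.

Import Order.TTheory GRing.Theory Num.Theory.
Import numFieldNormedType.Exports.

Local Open Scope classical_set_scope.
Local Open Scope ring_scope.

Section Dynamics.
Variables (R : realType) (n : nat).
Implicit Types (F : 'cV[R]_n.+1 -> 'cV[R]_n.+1) (X : set 'cV[R]_n.+1).
Implicit Types (z : R -> 'cV[R]_n.+1).

(* Forward Caratheodory solutions of z' = F z on [0, +oo[ with values in X, in
   integral form: this says that z is locally absolutely continuous on
   [0, +oo[ and that z' = F z almost everywhere.  A classical notion of
   solution would not do, because the saturating integrator below is
   discontinuous in the state.  Values of z at negative times are irrelevant. *)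
Definition is_solution F X z : Prop :=
  forall t : R, 0 <= t ->
    X (z t) /\
    forall i,
      lebesgue_measure.-integrable `[0, t] (EFin \o (fun s => F (z s) i 0)) /\
      z t i 0 = z 0 i 0 + \int[lebesgue_measure]_(s in `[0, t]) F (z s) i 0.

Definition is_equilibrium F X (ze : 'cV[R]_n.+1) : Prop := X ze /\ F ze = 0.

(* [`|_|] on column vectors is the sup norm; since all norms on R^n are
   equivalent and the constants are existentially quantified, the choice of
   the norm is immaterial. *)
Definition exp_stable_equilibrium F X (ze : 'cV[R]_n.+1) : Prop :=
  is_equilibrium F X ze /\
  exists c k lambda : R, [/\ 0 < c, 0 < k, 0 < lambda &
    forall z0 : 'cV[R]_n.+1, X z0 -> `|z0 - ze| <= c ->
      (exists z, is_solution F X z /\ z 0 = z0) /\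
      (forall z, is_solution F X z -> z 0 = z0 ->
         forall t, 0 <= t ->
           `|z t - ze| <= k * expR (- lambda * t) * `|z0 - ze|)].

End Dynamics.

Definition exp_converges (R : realType) (W : normedModType R) (lambda : R)
    (y : R -> W) (l : W) : Prop :=
  y t @[t --> +oo] --> l /\
  exists C : R, forall t, 0 <= t -> `|y t - l| <= C * expR (- lambda * t).

Record machine (R : realType) := Machine {
  Rs : R;   (* stator resistance R *)
  Ls : R;   (* stator inductance L *)
  J : R;
  mf : R;   (* mutual inductance m *)
  Dp : R;
  Dq : R;
  V : R;
  wg : R;   (* omega_g *)
  wn : R;   (* omega_n *)
  vset : R;
  Tm : R }.

Section Machine.
Variables (R : realType) (M : machine R).
Implicit Types (i : R) (x : 'cV[R]_4).

Definition positive_parameters : Prop :=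
  [/\ 0 < Rs M, 0 < Ls M, 0 < J M, 0 < mf M & 0 < Dp M] /\
  [/\ 0 < Dq M, 0 < V M, 0 < wg M, 0 < wn M & 0 < vset M].

Definition Tmt : R := Tm M + Dp M * (wn M - wg M).

(* x = (i_d, i_q, omega, delta) *)
Definition id_ x : R := x 0 0.
Definition iq_ x : R := x 1 0.
Definition omega_ x : R := x 2 0.
Definition delta_ x : R := x 3 0.

Definition mkstate (id iq omega delta : R) : 'cV[R]_4 :=
  \col_j [:: id; iq; omega; delta]`_j.

Definition vfieldP i x : 'cV[R]_4 :=
  let id := id_ x in let iq := iq_ x in
  let omega := omega_ x in let delta := delta_ x in
  mkstate
    ((- Rs M * id + omega * Ls M * iq + V M * sin delta) / Ls M)
    ((- omega * Ls M * id - Rs M * iq - mf M * i * omega + V M * cos delta)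
       / Ls M)
    ((mf M * i * iq - Dp M * omega + Tm M + Dp M * wn M) / J M)
    (omega - wg M).

Definition outQ x : R :=
  V M * (iq_ x * sin (delta_ x) - id_ x * cos (delta_ x)).

Definition outP x : R :=
  - V M * (id_ x * sin (delta_ x) + iq_ x * cos (delta_ x)).

Definition pr : R := Rs M / Ls M.

Definition phi : R := atan (wg M * Ls M / Rs M).

Definition Lambda i : R :=
  - (Tmt / (mf M * i)) * (Ls M * Num.sqrt (pr ^+ 2 + wg M ^+ 2) / V M)
  + mf M * i * wg M * pr / (V M * Num.sqrt (pr ^+ 2 + wg M ^+ 2)).

Definition If : set R := [set i | 0 < i /\ `|Lambda i| <= 1].

Definition delta1 i : R := acos (Lambda i) - phi.

Definition Xi i : 'cV[R]_4 :=
  mkstate (- (Tmt * wg M / (mf M * i * pr)) + V M * sin (delta1 i) / Rs M)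
          (- (Tmt / (mf M * i)))
          (wg M)
          (delta1 i).

Definition S1 i : R * R := (outP (Xi i), outQ (Xi i)).

Definition radS : R :=
  Num.sqrt (V M ^+ 4 + 4 * V M ^+ 2 * Rs M * Tmt * wg M) / (2 * Rs M).

Definition is_if0 (i0 : R) : Prop :=
  If i0 /\
  S1 i0 = (- (V M ^+ 2 / (2 * Rs M)),
           if Rs M < wg M * Ls M then radS else - radS).

(* I_f^+ for the value i0 of i_{f0} characterized by [is_if0]. *)
Definition Ifplus (i0 : R) : set R :=
  if Rs M < wg M * Ls M then `]inf If, i0[%classic else `]i0, sup If[%classic.

Definition G i : R := outQ (Xi i).

(* The inverse of G : U -> R on its range (G is injective on the sets U of
   interest); 0 outside the range. *)
Definition Ginv (U : set R) : R -> R := 'pinv_(fun=> 0) U G.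

Definition Qtilde (Qset : R) : R :=
  Qset + Dq M * (vset M - Num.sqrt (2 / 3) * V M).

(* The three cases are exclusive when umin < umax. *)
Definition saturate (umin umax i w : R) : R :=
  if i <= umin then Num.max w 0
  else if i < umax then w else Num.min w 0.

(* The fifth order state z is the stacked vector (x, i_f). *)
Definition mkz (x : 'cV[R]_4) (i : R) : 'cV[R]_(4 + 1) := col_mx x i%:M.
Definition x_ (z : 'cV[R]_(4 + 1)) : 'cV[R]_4 := usubmx z.
Definition if_ (z : 'cV[R]_(4 + 1)) : R := dsubmx z 0 0.

Definition vfieldCL (umin umax Qt Kt : R) (z : 'cV[R]_(4 + 1)) :
    'cV[R]_(4 + 1) :=
  mkz (vfieldP (if_ z) (x_ z))
      (saturate umin umax (if_ z) ((Qt - outQ (x_ z)) / Kt)).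

Definition stateCL (umin umax : R) : set 'cV[R]_(4 + 1) :=
  [set z | umin <= if_ z <= umax].

End Machine.

(* Main.v *)
Require Import Defs.
From mathcomp Require Import all_boot all_order all_algebra.
From mathcomp Require Import all_classical all_reals all_analysis measurable_realfun.
From mathcomp Require Import ring lra.

Set Implicit Arguments.
Unset Strict Implicit.
Unset Printing Implicit Defensive.

Import Order.TTheory GRing.Theory Num.Theory.
Import numFieldNormedType.Exports.

Local Open Scope classical_set_scope.
Local Open Scope ring_scope.

(** Exponential stability of [P] at an equilibrium forces the linearization to
    contract: an Euler polygon of the linear system follows a nonlinear solution
    of size [eta] up to [O(eta (eta + h))].  Hence for each input some [m]-th
    power of the Euler map [1 + h A] halves vectors; weighting the first [m]
    powers gives a norm with negative logarithmic norm, and these norms are glued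
    over the input interval into a Lipschitz family [N i].  A matrix with this
    property has no eigenvalue [t >= 0], which by the intermediate value theorem
    for the characteristic quartic gives [sin (delta + phi) > 0]: so the stable
    equilibrium is [Xi i] up to a multiple of [2 pi].  As [i] varies, (P, Q)
    moves along a circle, and the choice of [I_f^+] keeps it on an arc where [G]
    increases with slope at least [mu > 0].

    For a large constant [gam] and small gain [1 / Kt], the function
    [max (gam N_i (x - Xi i), |i - i_fr|)] decays exponentially along the closed
    loop, by a comparison argument on its right difference quotients.
    Existence of solutions comes from Picard iteration for the field truncated
    outside a ball that solutions do not leave; the saturating integrator is
    there solved explicitly by the two-sided Skorokhod reflection. *)

(** Two obstacles shape the argument. The hypothesis on P bounds nonlinear solutions near some
    equilibrium, one input at a time, while a Lyapunov function uniform in the input is needed.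
    Finitely many Euler steps turn it into an inequality between norms, which persists under small
    changes of the matrix and under convex combination of norms; of the spectrum, only a single real
    root is ever used. The second obstacle is that the saturated field is discontinuous in the
    state. Decay is therefore proved for every solution, without uniqueness, from one-sided
    inequalities: as i_fr lies in [umin, umax], an input above i_fr is off the lower limit, the only
    place where saturation raises the drive, and symmetrically below. The constants are chosen in
    this order: gam is large enough that the output error due to the fast state costs at most half
    of the slow rate; then 1 / Kt is small enough that the motion of the input costs at most a
    quarter of the fast rate. Neither choice depends on i_fr. *)

Section RealInduction.
Variable R : realType.
Implicit Types (P : R -> Prop) (a t s : R).

(** If P failed somewhere, consider the supremum of the times up to which P holds throughout: the
    left-limit hypothesis reaches it and the extension hypothesis passes it. *)
Lemma real_induction P a :
  P a ->
  (forall t, a <= t -> (forall s, a <= s <= t -> P s) ->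
     exists2 d, 0 < d & forall s, t < s < t + d -> P s) ->
  (forall t, a < t -> (forall s, a <= s < t -> P s) -> P t) ->
  forall t, a <= t -> P t.
Proof.
move=> Pa Pr Pl t0 at0; apply: contrapT => nPt0.
pose E := [set t | a <= t /\ forall s, a <= s <= t -> P s].
have Ea : E a.
  by split=> // s /andP[h1 h2]; have -> : s = a by apply/eqP; rewrite eq_le h1 h2.
have Eub : ubound E t0.
  move=> t [at_ Pt]; rewrite leNgt; apply/negP => t0t; apply: nPt0.
  by apply: Pt; rewrite at0 ltW.
have hsE : has_sup E by split; [exists a | exists t0].
have aS : a <= sup E by apply: ub_le_sup => //; exists t0.
have PS s : a <= s < sup E -> P s.
  move=> /andP[as_ sS].
  have [u [au Pu] su] := sup_gt (ex_intro _ a Ea) sS.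
  by apply: Pu; rewrite as_ ltW.
have PSS : P (sup E).
  have [<- //|nS] := eqVneq a (sup E).
  by apply: Pl => //; rewrite lt_neqAle nS.
have PleS s : a <= s <= sup E -> P s.
  move=> /andP[as_]; rewrite le_eqVlt => /predU1P[-> //|sS].
  by apply: PS; rewrite as_.
have [d d0 Pd] := Pr _ aS PleS.
have : E (sup E + d / 2).
  split; first by lra.
  move=> s /andP[as_ sd]; have [sS|Ss] := leP s (sup E).
    by apply: PleS; rewrite as_.
  by apply: Pd; rewrite Ss /=; lra.
move/(ub_le_sup (ex_intro _ t0 Eub)); lra.
Qed.

End RealInduction.

(** Continuity relative to the half-line: solutions are unconstrained at negative times, so ordinary
    continuity at 0 would ask too much. *)
Definition ccont (R : realType) (W : normedZmodType R) (y : R -> W) : Prop :=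
  forall t : R, 0 <= t -> forall e : R, 0 < e ->
    exists2 d : R, 0 < d &
      forall s : R, 0 <= s -> `|s - t| < d -> `|y s - y t| <= e.

(** * Operations on continuous paths over the half-line *)

Section HalfLineContinuity.
Variable R : realType.

(** The estimate is asked only while [u] is within 1 of [u t], so that [K] may depend on the size of
    [u t]; this covers products and fields that are Lipschitz on bounded sets. *)
Lemma ccont_local_dom (U V W : normedZmodType R)
    (u : R -> U) (v : R -> V) (y : R -> W) :
  ccont u -> ccont v ->
  (forall t : R, 0 <= t -> exists2 K : R, 0 <= K & forall s : R, 0 <= s ->
     `|u s - u t| <= 1 -> `|y s - y t| <= K * (`|u s - u t| + `|v s - v t|)) ->
  ccont y.
Proof.
move=> cu cv H t t0 e e0; have [K K0 HK] := H t t0.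
have [d0 d00 D0] := cu t t0 1 ltr01.
pose e' := e / (2 * (K + 1)).
have e'0 : 0 < e' by rewrite divr_gt0 // mulr_gt0 //; lra.
have [d1 d10 D1] := cu t t0 _ e'0; have [d2 d20 D2] := cv t t0 _ e'0.
exists (Num.min d0 (Num.min d1 d2)); first by rewrite !lt_min d00 d10.
move=> s s0; rewrite !lt_min => /and3P[/(D0 s s0) S0 /(D1 s s0) S1 /(D2 s s0) S2].
apply: le_trans (HK s s0 S0) _; apply: (@le_trans _ _ (K * (e' + e'))).
  by rewrite ler_wpM2l // lerD.
have -> : K * (e' + e') = e * (K / (K + 1)) by rewrite /e'; field; lra.
by rewrite ler_piMr ?(ltW e0) // ler_pdivrMr ?mul1r; lra.
Qed.

Lemma ccont_dom (U V W : normedZmodType R)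
    (u : R -> U) (v : R -> V) (y : R -> W) :
  ccont u -> ccont v ->
  (forall t : R, 0 <= t -> exists2 K : R, 0 <= K & forall s : R, 0 <= s ->
     `|y s - y t| <= K * (`|u s - u t| + `|v s - v t|)) ->
  ccont y.
Proof.
move=> cu cv H; apply: (ccont_local_dom cu cv) => t /H[K K0 HK].
by exists K => // s s0 _; apply: HK.
Qed.

Lemma ccont_sub (W : normedZmodType R) (y z : R -> W) :
  ccont y -> ccont z -> ccont (fun t => y t - z t).
Proof.
move=> cy cz; apply: (ccont_dom cy cz) => t t0; exists 1 => // s s0.
rewrite mul1r; have -> : y s - z s - (y t - z t) = (y s - y t) - (z s - z t).
  by rewrite !opprB addrACA [RHS]addrACA; congr (_ + _); rewrite addrC.
exact: ler_normB.
Qed.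

Lemma ccont_cst (W : normedZmodType R) (c : W) : ccont (fun _ : R => c).
Proof. by move=> t t0 e e0; exists 1 => // s _ _; rewrite subrr normr0 ltW. Qed.

Lemma ccont_mul (f g : R -> R) : ccont f -> ccont g -> ccont (fun t => f t * g t).
Proof.
move=> cf cg; apply: (ccont_local_dom cf cg) => t t0.
exists (`|f t| + 1 + `|g t|) => // s s0 fs.
have -> : f s * g s - f t * g t = f s * (g s - g t) + (f s - f t) * g t by ring.
apply: le_trans (ler_normD _ _) _; rewrite !normrM mulrDr addrC.
have := ler_normD (f s - f t) (f t); rewrite subrK => fs'.
by apply: lerD; [rewrite mulrC|]; rewrite ler_wpM2r //; have := normr_ge0 (f t);
  have := normr_ge0 (g t); lra.
Qed.

Lemma ccont_exp (f : R -> R) (m : nat) : ccont f -> ccont (fun t => f t ^+ m).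
Proof.
move=> cf; elim: m => [|m IH]; first exact: ccont_cst.
by under eq_fun do rewrite exprS; exact: ccont_mul.
Qed.

End HalfLineContinuity.

(** * Comparison principles for right difference quotients *)

Section Comparison.
Variable R : realType.
Implicit Types (w g : R -> R) (l t s e h : R).

Lemma ccont_le_left w g t :
  ccont w -> ccont g -> 0 < t ->
  (forall s, 0 <= s < t -> w s <= g s) -> w t <= g t.
Proof.
move=> cw cg t0 H; rewrite leNgt; apply/negP => gw.
have e0 : 0 < (w t - g t) / 4 by lra.
have [d1 d10 D1] := cw t (ltW t0) _ e0.
have [d2 d20 D2] := cg t (ltW t0) _ e0.
pose s := Num.max 0 (Num.max (t - d1 / 2) (t - d2 / 2)).
have s0 : 0 <= s by rewrite le_max lexx.
have st : s < t by rewrite !gt_max t0 /=; apply/andP; split; lra.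
have s1 : t - d1 / 2 <= s by rewrite !le_max lexx /= orbT.
have s2 : t - d2 / 2 <= s by rewrite !le_max lexx /= !orbT.
have st' : `|s - t| = t - s by rewrite distrC gtr0_norm ?subr_gt0.
have /ler_normlP[A1 _] := D1 s s0 ltac:(rewrite st'; lra).
have /ler_normlP[_ A2] := D2 s s0 ltac:(rewrite st'; lra).
have := H s; rewrite s0 st => /(_ isT); lra.
Qed.

(** The inequality must propagate to the right even from a contact [w t = g t]; in applications the
    barrier [g] is therefore chosen with some slack in its slope. *)
Lemma comparison w g :
  ccont w -> ccont g -> w 0 <= g 0 ->
  (forall t, 0 <= t -> w t <= g t ->
     exists2 d, 0 < d & forall h, 0 < h < d -> w (t + h) <= g (t + h)) ->
  forall t, 0 <= t -> w t <= g t.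
Proof.
move=> cw cg wg0 H; apply: real_induction => //.
- move=> t t0 IH; have [|d d0 D] := H t t0; first by apply: IH; rewrite t0 lexx.
  exists d => // s /andP[ts sd]; have := D (s - t).
  by rewrite subrKC; apply; apply/andP; split; lra.
- by move=> t t0 IH; apply: ccont_le_left.
Qed.

Lemma expR_ccont l (c : R) : ccont (fun t => c * expR (l * t)).
Proof.
move=> t t0 e e0.
have : {for t, continuous (fun t => c * expR (l * t))}.
  by apply: cvgM; [exact: cvg_cst|apply: (continuous_comp (g := expR)); [
    apply: cvgM; [exact: cvg_cst|exact: cvg_id]|exact: continuous_expR]].
move=> /cvgrPdist_le /(_ e e0) /nbhs_ballP[d /= d0 D].
by exists d => // s s0 sd; rewrite distrC; apply: D; rewrite /ball /= distrC.
Qed.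

(** A bootstrap: decay is assumed only in the region [w t <= 2 * Y], which the barrier never leaves.
    The assumed rate is twice the rate obtained, and the difference pays for the error [e * h]. *)
Lemma dini_expR_decay w l Y :
  0 < l -> 0 < Y -> ccont w -> w 0 <= Y ->
  (forall t, 0 <= t -> 0 <= w t) ->
  (forall t, 0 <= t -> w t <= 2 * Y -> forall e, 0 < e ->
     exists2 d, 0 < d & forall h, 0 < h < d ->
       w (t + h) <= (1 - 2 * l * h) * w t + e * h) ->
  forall t, 0 <= t -> w t <= expR (- l * t) * w 0.
Proof.
move=> l0 Y0 cw w0 wge H t t0.
(* Raising the barrier by [c] keeps it positive even when [w 0 = 0]; [c <= Y] keeps it below
   [2 * Y]. *)
suff B c : 0 < c -> c <= Y -> w t <= (w 0 + c) * expR (- l * t).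
  rewrite leNgt; apply/negP => Hlt.
  have E0 := expR_gt0 (- l * t).
  pose c := Num.min Y ((w t - expR (- l * t) * w 0) / 2 / expR (- l * t)).
  have c0 : 0 < c by rewrite lt_min Y0 /= !divr_gt0 ?subr_gt0.
  have := B c c0; rewrite ge_min lexx => /(_ isT).
  have : c <= (w t - expR (- l * t) * w 0) / 2 / expR (- l * t).
    by rewrite ge_min lexx orbT.
  rewrite ler_pdivlMr // [(w 0 + c) * _]mulrDl [w 0 * _]mulrC; lra.
move=> c0 cY; pose g s := (w 0 + c) * expR (- l * s).
have w00 := wge 0 (lexx 0).
have g0 s : 0 < g s by rewrite mulr_gt0 ?expR_gt0 //; lra.
apply: (@comparison w g) => //; first exact: expR_ccont.
  by rewrite /g mulr0 expR0 mulr1; lra.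
move=> s s0 wg.
have gY : g s <= 2 * Y.
  have : g s <= (w 0 + c) * 1.
    rewrite ler_pM2l; last lra.
    by rewrite -expR0 ler_expR mulNr oppr_le0 mulr_ge0 // ltW.
  lra.
(* An error of this size consumes exactly half of the rate [2 * l]. *)
have e0 : 0 < l * g s by rewrite mulr_gt0.
have [d d0 D] := H s s0 (le_trans wg gY) _ e0.
pose m := Num.min d (1 / (2 * l)).
exists m; first by rewrite lt_min d0 divr_gt0 // mulr_gt0.
move=> h /andP[h0]; rewrite lt_min => /andP[hd].
rewrite ltr_pdivlMr ?mulr_gt0 // => hl.
apply: (le_trans (D h _)); first by rewrite h0.
have : (1 - 2 * l * h) * w s <= (1 - 2 * l * h) * g s by apply: ler_wpM2l; lra.
have -> : g (s + h) = g s * expR (- l * h).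
  by rewrite /g mulrDr expRD mulrA.
have : g s * (1 - l * h) <= g s * expR (- l * h).
  rewrite ler_pM2l //; have := expR_ge1Dx (- l * h); lra.
lra.
Qed.

End Comparison.

(** * Integrals over [0, t] and their increments over short steps *)

Section IntegralOnHalfLine.
Variable R : realType.
Notation mu := (@lebesgue_measure R).
Implicit Types (g : R -> R) (t h c e : R).

Lemma int_split g t h : 0 <= t -> 0 <= h ->
  mu.-integrable `[0, t + h] (EFin \o g) ->
  \int[mu]_(s in `[0, t + h]) g s - \int[mu]_(s in `[0, t]) g s =
  \int[mu]_(s in `]t, t + h]) g s.
Proof.
move=> t0 h0 ig; have := @Rintegral_itvB R g (BLeft 0) (BRight (t + h)) t ig.
by rewrite !bnd_simp lerDl; apply.
Qed.

Lemma int_cst_itv t h c : 0 <= h -> \int[mu]_(s in `]t, t + h]) c = h * c.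
Proof.
move=> h0; rewrite Rintegral_cst //= lebesgue_measure_itv /= lte_fin.
case: ltP => [_ /=|]; last by move=> hh; (have -> : h = 0 by lra); rewrite /= mulr0 mul0r.
by rewrite addrAC subrr add0r mulrC.
Qed.

Lemma integrable_cst_itv t h c :
  mu.-integrable `]t, t + h] (EFin \o (fun=> c)).
Proof.
have H : mu.-integrable `[t, t + h] (EFin \o (fun=> c)).
  apply: continuous_compact_integrable; first exact: segment_compact.
  by move=> x; exact: cvg_cst.
by apply: integrableS H => //; apply: subset_itvr; rewrite bnd_simp.
Qed.

Lemma int_step_le g t h c : 0 <= t -> 0 <= h ->
  mu.-integrable `[0, t + h] (EFin \o g) ->
  (forall s, t < s <= t + h -> g s <= c) ->
  \int[mu]_(s in `[0, t + h]) g s - \int[mu]_(s in `[0, t]) g s <= h * c.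
Proof.
move=> t0 h0 ig gc; rewrite int_split // -(int_cst_itv t) //.
apply: le_Rintegral.
- by [].
- by apply: integrableS ig => //; apply: subset_itvr; rewrite bnd_simp.
- exact: integrable_cst_itv.
- by move=> s /=; rewrite in_itv /=; apply: gc.
Qed.

Lemma int_step_ge g t h c : 0 <= t -> 0 <= h ->
  mu.-integrable `[0, t + h] (EFin \o g) ->
  (forall s, t < s <= t + h -> c <= g s) ->
  h * c <= \int[mu]_(s in `[0, t + h]) g s - \int[mu]_(s in `[0, t]) g s.
Proof.
move=> t0 h0 ig gc; rewrite int_split // -(int_cst_itv t) //.
apply: le_Rintegral.
- by [].
- exact: integrable_cst_itv.
- by apply: integrableS ig => //; apply: subset_itvr; rewrite bnd_simp.
- by move=> s /=; rewrite in_itv /=; apply: gc.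
Qed.

Lemma int_step_near g t h c e : 0 <= t -> 0 <= h ->
  mu.-integrable `[0, t + h] (EFin \o g) ->
  (forall s, t < s <= t + h -> `|g s - c| <= e) ->
  `|\int[mu]_(s in `[0, t + h]) g s - \int[mu]_(s in `[0, t]) g s - h * c|
    <= h * e.
Proof.
move=> t0 h0 ig gc.
have /(@int_step_le g t h (c + e) t0 h0 ig) K1 :
  forall s, t < s <= t + h -> g s <= c + e.
  by move=> s /gc /ler_normlP[]; lra.
have /(@int_step_ge g t h (c - e) t0 h0 ig) K2 :
  forall s, t < s <= t + h -> c - e <= g s.
  by move=> s /gc /ler_normlP[]; lra.
by apply/ler_normlP; split; lra.
Qed.

Lemma within_ccont g t : 0 < t ->
  {within `[0, t], continuous g} -> forall s, 0 <= s < t -> forall e, 0 < e ->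
    exists2 d, 0 < d & forall u, 0 <= u -> `|u - s| < d -> `|g u - g s| <= e.
Proof.
move=> t0 cg s /andP[s0 st] e e0.
have As : `[0, t]%classic s by rewrite /= in_itv /= s0 ltW.
move/subspace_continuousP: cg => /(_ s As) /cvgrPdist_le /(_ e e0) /nbhs_ballP[d /= d0 D].
exists (Num.min d (t - s)); first by rewrite lt_min d0 subr_gt0.
move=> u u0; rewrite lt_min => /andP[ud ut].
rewrite distrC; apply: D; rewrite /ball /= ?(distrC s) // in_itv /= u0 /=.
by have /ltr_normlP[_] := ut; lra.
Qed.

Lemma ccont_within g t : ccont g -> {within `[0, t], continuous g}.
Proof.
move=> cg.
apply/subspace_continuousP => s /=; rewrite in_itv /= => /andP[s0 st].
apply/cvgrPdist_le => e e0; have [d d0 D] := cg s s0 e e0.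
apply/nbhs_ballP; exists d => // u /=; rewrite /ball /= => ud.
rewrite in_itv /= => /andP[u0 _].
by rewrite distrC; apply: D; rewrite // distrC.
Qed.

Lemma ccont_integrable g t : ccont g -> mu.-integrable `[0, t] (EFin \o g).
Proof.
by move=> cg; apply: continuous_compact_integrable;
  [exact: segment_compact|exact: ccont_within].
Qed.

Lemma int_ccont g : (forall t, 0 <= t -> mu.-integrable `[0, t] (EFin \o g)) ->
  ccont (fun t => \int[mu]_(s in `[0, t]) g s).
Proof.
move=> ig t t0; apply: (@within_ccont _ (t + 1)); try lra.
apply: parameterized_integral_continuous; last apply: ig; lra.
Qed.

(** For every [e > 0] the distance between the two increments stays below the line of slope [e], by
    comparison; then [e] tends to 0. Neither function has to be differentiable by itself. *)
Lemma right_derivative_unique (f g : R -> R) :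
  ccont f -> ccont g ->
  (forall t, 0 <= t -> forall e, 0 < e -> exists2 d, 0 < d & forall h,
     0 < h < d -> `|(f (t + h) - f t) - (g (t + h) - g t)| <= h * e) ->
  forall t, 0 <= t -> f t - f 0 = g t - g 0.
Proof.
move=> cf cg H t t0.
pose w s := `|(f s - f 0) - (g s - g 0)|.
have cw : ccont w.
  move=> s s0 e e0.
  have [d1 d10 D1] := cf s s0 (e / 2) ltac:(lra).
  have [d2 d20 D2] := cg s s0 (e / 2) ltac:(lra).
  exists (Num.min d1 d2); first by rewrite lt_min d10.
  move=> u u0; rewrite lt_min => /andP[u1 u2].
  rewrite /w; apply: le_trans (ler_dist_dist _ _) _.
  have -> : f u - f 0 - (g u - g 0) - (f s - f 0 - (g s - g 0)) =
    (f u - f s) - (g u - g s) by ring.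
  have := D1 u u0 u1; have := D2 u u0 u2.
  by have := ler_normB (f u - f s) (g u - g s); lra.
suff B e : 0 < e -> w t <= e * t.
  have [T0|T0] := eqVneq t 0; first by rewrite T0 !subrr.
  apply/eqP; rewrite -subr_eq0 -normr_eq0 -/(w t) eq_le normr_ge0 andbT.
  rewrite leNgt; apply/negP => wt.
  have tp : 0 < t by rewrite lt_neqAle eq_sym T0.
  have := B (w t / 2 / t) ltac:(by rewrite !divr_gt0).
  rewrite divfK //; lra.
move=> e0; apply: (comparison (w := w) (g := fun t => e * t)) => //.
- move=> s s0 e' e'0; exists (e' / e); first by rewrite divr_gt0.
  move=> u u0; rewrite ltr_pdivlMr // => ue.
  by rewrite -mulrBr normrM gtr0_norm // mulrC ltW.
- by rewrite /w !subrr normr0 mulr0.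
- move=> s s0 ws; have [d d0 D] := H s s0 e e0.
  exists d => // h hd; have := D h hd.
  rewrite /w.
  have -> : f (s + h) - f 0 - (g (s + h) - g 0) =
    (f (s + h) - f s - (g (s + h) - g s)) + (f s - f 0 - (g s - g 0)) by ring.
  have := ler_normD (f (s + h) - f s - (g (s + h) - g s)) (f s - f 0 - (g s - g 0)).
  by move: ws; rewrite /w; lra.
Qed.

End IntegralOnHalfLine.

(** * The sup norm on column vectors *)

Section VectorNorm.
Variables (R : realType) (n : nat).
Implicit Types (v w : 'cV[R]_n.+1) (A B : 'M[R]_n.+1).

Lemma coord_le_norm v j : `|v j 0| <= `|v|.
Proof.
rewrite /Num.norm /= mx_normrE.
exact: (le_bigmax _ (fun i : 'I_n.+1 * 'I_1 => `|v i.1 i.2|) (j, 0)).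
Qed.

Lemma entry_le_norm A i j : `|A i j| <= `|A|.
Proof.
rewrite /Num.norm /= mx_normrE.
exact: (le_bigmax _ (fun k : 'I_n.+1 * 'I_n.+1 => `|A k.1 k.2|) (i, j)).
Qed.

Lemma norm_le_coord v (c : R) : 0 <= c -> (forall j, `|v j 0| <= c) -> `|v| <= c.
Proof.
move=> c0 H; rewrite /Num.norm /= mx_normrE; apply: bigmax_le => // -[i j] _ /=.
by rewrite ord1.
Qed.

Lemma norm_const_mx (a : R) : `|const_mx a : 'cV[R]_n.+1| = `|a|.
Proof.
apply/eqP; rewrite eq_le norm_le_coord // => [|j]; last by rewrite mxE.
by have := coord_le_norm (const_mx a) 0; rewrite mxE.
Qed.

Lemma norm_scale (a : R) v : 0 <= a -> `|a *: v| = a * `|v|.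
Proof. by move=> a0; rewrite normrZ ger0_norm. Qed.

(** The matrix norm is the largest entry, not an operator norm; the factor [n.+1] turns it into a
    bound for the operator norm. *)
Definition opbound A : R := n.+1%:R * `|A|.

Lemma opbound_ge0 A : 0 <= opbound A.
Proof. by rewrite mulr_ge0. Qed.

Lemma norm_mulmx_le A v : `|A *m v| <= opbound A * `|v|.
Proof.
apply: norm_le_coord; first by rewrite mulr_ge0 ?opbound_ge0.
move=> j; rewrite mxE; apply: le_trans (ler_norm_sum _ _ _) _.
apply: (@le_trans _ _ (\sum_(i < n.+1) `|A| * `|v|)).
  apply: ler_sum => i _; rewrite normrM.
  by apply: ler_pM => //; [exact: entry_le_norm|exact: coord_le_norm].
by rewrite sumr_const card_ord /opbound -mulrA mulr_natl.
Qed.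

End VectorNorm.

(** * From exponential stability to contraction by Euler steps *)

Section ExponentialStability.
Variables (R : realType) (n : nat).
Implicit Types (F : 'cV[R]_n.+1 -> 'cV[R]_n.+1) (z : R -> 'cV[R]_n.+1).

Lemma euler_error_split (u p q y y' x : 'cV[R]_n.+1) :
  u + p - (y' - x) = u - (y - x) + (p - q) - (y' - y - q).
Proof. by apply/matrixP => i j; rewrite !mxE; ring. Qed.

(** One step of a discrete Gronwall estimate: [d] is the error after [j] steps, [x] the growth per
    step, [r] the local error and [q] the accumulated growth [(1 + x) ^+ j]. *)
Lemma euler_error_bound (f d b g x r q j : R) :
  f <= d + b -> b <= x * d -> g <= r ->
  (1 + x) * d <= (1 + x) * (j * r * q) -> r <= r * ((1 + x) * q) ->
  f + g <= (j + 1) * r * ((1 + x) * q).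
Proof. by move=> *; lra. Qed.

Lemma solution_step F X z (t h : R) (c : 'cV[R]_n.+1) (e : R) : is_solution F X z ->
  0 <= t -> 0 <= h -> 0 <= e ->
  (forall s, t < s <= t + h -> `|F (z s) - c| <= e) ->
  `|z (t + h) - z t - h *: c| <= h * e.
Proof.
move=> sz t0 h0 e0 H; apply: norm_le_coord; first exact: mulr_ge0.
move=> j; rewrite !mxE.
have [_ /(_ j)[_ E1]] := sz t t0.
have [_ /(_ j)[I2 E2]] := sz (t + h) (addr_ge0 t0 h0).
rewrite E1 E2.
have -> (u v w d : R) : u + v - (u + w) - d = v - w - d by ring.
apply: int_step_near => // s st.
by have := coord_le_norm (F (z s) - c) j; rewrite !mxE => /le_trans; apply; apply: H.
Qed.

(** Stands in for the statement that [A] is Hurwitz, as an inequality for powers of a single matrix;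
    no matrix exponential is involved. *)
Definition euler_contractive (A : 'M[R]_n.+1) : Prop :=
  exists2 h : R, 0 < h & exists m : nat, (0 < m)%N /\
    forall v : 'cV_n.+1, `|(1 + h *: A) ^+ m *m v| <= `|v| / 2.

Lemma exp_stable_euler F (xe : 'cV[R]_n.+1) (A : 'M[R]_n.+1) (C r : R) : 0 < r -> 0 <= C ->
  (forall e : 'cV[R]_n.+1, `|e| <= r -> `|F (xe + e) - A *m e| <= C * `|e| ^+ 2) ->
  exp_stable_equilibrium F setT xe -> euler_contractive A.
Proof.
move=> r0 C0 HF [_ [c [k [l [c0 k0 l0 HS]]]]].
(* Since [expR (4 * k) >= 1 + 4 * k], after this time a solution has at most a quarter of its
   initial size. *)
pose T := 4 * k / l; have T0 : 0 < T by rewrite !mulr_gt0 ?invr_gt0.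
have kT : k * expR (- l * T) <= 1 / 4.
  have -> : - l * T = - (4 * k) by rewrite /T; field; rewrite gt_eqF.
  rewrite expRN ler_pdivrMr ?expR_gt0 //.
  by have := expR_ge1Dx (4 * k); lra.
move: T T0 kT => T T0 kT.
pose a := opbound A; have a0 : 0 <= a := opbound_ge0 A.
pose E := expR (a * T); have E0 : 0 < E := expR_gt0 _.
pose L := a + C * r; have L0 : 0 <= L by rewrite addr_ge0 // mulr_ge0 // ltW.
(* Over [0, T], [K1 * eta] collects the quadratic remainder of [F] and [K2 * h] the motion of the
   solution within the Euler steps. Both are made at most 1/8, so the polygon ends within [eta / 4]
   of the solution. *)
pose K1 := T * E * C * k ^+ 2.
have K10 : 0 <= K1 by rewrite !mulr_ge0 ?sqr_ge0 // ltW.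
pose K2 := T * E * a * L * k.
have K20 : 0 <= K2 by rewrite !mulr_ge0 // ltW.
pose m := (Num.trunc (8 * K2 * T)).+1.
have mT : 8 * K2 * T < m%:R by apply: truncnS_gt.
have m0 : 0 < m%:R :> R by rewrite ltr0n.
pose h := T / m%:R; have h0 : 0 < h by rewrite divr_gt0.
have hm : h * m%:R = T by rewrite divfK // gt_eqF.
have hK2 : K2 * h <= 1 / 8.
  rewrite /h mulrA ler_pdivrMr //; lra.
pose eta := Num.min c (Num.min (r / k) (1 / (8 * (K1 + 1)))).
have eta0 : 0 < eta.
  by rewrite !lt_min c0 !divr_gt0 ?mulr_gt0 //; lra.
have etac : eta <= c by rewrite ge_min lexx.
have etar : k * eta <= r.
  rewrite mulrC -ler_pdivlMr // /eta !ge_min lexx /=.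
  by rewrite orbT.
have etaK : K1 * eta <= 1 / 8.
  have : eta <= 1 / (8 * (K1 + 1)) by rewrite /eta !ge_min lexx !orbT.
  by rewrite ler_pdivlMr; nra.
exists h => //; exists m; split=> //.
have key (v : 'cV[R]_n.+1) : `|v| = eta -> `|(1 + h *: A) ^+ m *m v| <= `|v| / 2.
  move=> veta.
  have [|[z [sz z0]] /(_ z sz z0) Hz] := HS (xe + v) I.
    by rewrite addrC addKr veta.
  have {}Hz s : 0 <= s -> `|z s - xe| <= k * expR (- l * s) * eta.
    by move=> s0; rewrite -veta; have := Hz s s0; rewrite (addrC xe) addrK.
  pose ze := k * eta; have ze0 : 0 <= ze by rewrite mulr_ge0 // ltW.
  have Hze s : 0 <= s -> `|z s - xe| <= ze.
    move=> s0; apply: le_trans (Hz s s0) _; rewrite /ze -mulrA ler_wpM2l //.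
      exact: ltW.
    rewrite -[leRHS]mul1r ler_wpM2r //; first exact: ltW.
    by rewrite -expR0 ler_expR mulNr oppr_le0 mulr_ge0 // ltW.
  have HFz s : 0 <= s -> `|F (z s) - A *m (z s - xe)| <= C * ze ^+ 2.
    move=> s0; have := HF (z s - xe); rewrite subrKC => H.
    apply: le_trans (H _) _; first exact: le_trans (Hze s s0) etar.
    by rewrite ler_wpM2l // ler_pXn2r ?nnegrE // Hze.
  have HFz2 s : 0 <= s -> `|F (z s) - 0| <= L * ze.
    move=> s0; rewrite subr0.
    have -> : F (z s) = (F (z s) - A *m (z s - xe)) + A *m (z s - xe).
      by rewrite subrK.
    apply: le_trans (ler_normD _ _) _.
    have := HFz s s0; have := norm_mulmx_le A (z s - xe).
    have : a * `|z s - xe| <= a * ze by rewrite ler_wpM2l // Hze.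
    have : C * ze ^+ 2 <= C * r * ze.
      by rewrite expr2 -mulrA ler_wpM2l // ler_wpM2r.
    rewrite /L -/a; lra.
  have inc t s : 0 <= t -> t <= s -> `|z s - z t| <= (s - t) * (L * ze).
    move=> t0 ts.
    have := @solution_step F setT z t (s - t) 0 (L * ze) sz t0.
    rewrite subrKC scaler0 subr0; apply.
    - by rewrite subr_ge0.
    - by rewrite mulr_ge0.
    - by move=> u /andP[tu _]; apply: HFz2; lra.
  (* Local defect: the remainder of the linearization, plus the displacement of [z] during one
     step. *)
  pose rho := C * ze ^+ 2 + a * (h * (L * ze)).
  have rho0 : 0 <= rho by rewrite addr_ge0 ?mulr_ge0 ?exprn_ge0 // ltW.
  have step t : 0 <= t ->
      `|z (t + h) - z t - h *: (A *m (z t - xe))| <= h * rho.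
    move=> t0; apply: (solution_step sz) => //; first exact: ltW.
    move=> s /andP[ts sth].
    have -> : F (z s) - A *m (z t - xe) =
        (F (z s) - A *m (z s - xe)) + A *m (z s - z t).
      have -> : z s - z t = (z s - xe) - (z t - xe) by rewrite opprB addrA subrK.
      by rewrite (mulmxBr A (z s - xe)) addrA subrK.
    apply: le_trans (ler_normD _ _) _; apply: lerD; first by apply: HFz; lra.
    apply: le_trans (norm_mulmx_le _ _) _; rewrite -/a ler_wpM2l //.
    apply: le_trans (inc t s t0 (ltW ts)) _.
    apply: ler_wpM2r; first exact: mulr_ge0.
    by clear -sth; move: sth; rewrite lerBlDl.
  have ha0 : 0 <= h * a by rewrite mulr_ge0 // ltW.
  have euler (j : nat) : `|(1 + h *: A) ^+ j *m v - (z (j%:R * h) - xe)| <=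
      j%:R * (h * rho) * (1 + h * a) ^+ j.
    elim: j => [|j IH].
      by rewrite expr0 mul1mx !mul0r z0 [xe + v]addrC addrK subrr normr0.
    have jh0 : 0 <= j%:R * h by rewrite mulr_ge0 // ltW.
    have := step _ jh0.
    have -> : j.+1%:R * h = j%:R * h + h by rewrite mulrSr mulrDl mul1r.
    set y := z (j%:R * h); set y' := z _.
    set u := (1 + h *: A) ^+ j *m v in IH *.
    have -> : (1 + h *: A) ^+ j.+1 *m v = u + h *: (A *m u).
      by rewrite exprS -mulmxE -mulmxA -/u mulmxDl mul1mx scalemxAl.
    move=> S.
    have -> : u + h *: (A *m u) - (y' - xe) =
      (u - (y - xe)) + h *: (A *m (u - (y - xe)))
        - (y' - y - h *: (A *m (y - xe))).
      rewrite [A *m (u - _)]mulmxBr scalerBr.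
      exact: euler_error_split.
    apply: le_trans (ler_normB _ _) _.
    have N1 := ler_normD (u - (y - xe)) (h *: (A *m (u - (y - xe)))).
    have N2 : `|h *: (A *m (u - (y - xe)))| <= h * a * `|u - (y - xe)|.
      by rewrite normrZ gtr0_norm // -mulrA ler_wpM2l ?norm_mulmx_le // ltW.
    have P1 : 1 <= (1 + h * a) ^+ j.+1 by apply: exprn_ege1; rewrite lerDl.
    have : (1 + h * a) * `|u - (y - xe)| <=
           (1 + h * a) * (j%:R * (h * rho) * (1 + h * a) ^+ j).
      by rewrite ler_wpM2l // addr_ge0.
    have hr0 : 0 <= h * rho by rewrite mulr_ge0 // ltW.
    have : h * rho <= h * rho * (1 + h * a) ^+ j.+1 by rewrite ler_peMr.
    rewrite exprS mulrSr => H1 H2; exact: euler_error_bound N1 N2 S H2 H1.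
  have := euler m; have -> : m%:R * h = T by rewrite mulrC hm.
  have Em : (1 + h * a) ^+ m <= E.
    have -> : E = expR (h * a) ^+ m.
      by rewrite -expRM_natl /E -hm; congr expR; ring.
    by rewrite ler_pXn2r ?nnegrE ?expR_ge0 ?expR_ge1Dx // addr_ge0.
  move=> D.
  have D2 : m%:R * (h * rho) * (1 + h * a) ^+ m <= T * rho * E.
    by rewrite mulrA [m%:R * h]mulrC hm ler_wpM2l // mulr_ge0 // ltW.
  have D3 : T * rho * E = (K1 * eta + K2 * h) * eta.
    by rewrite /rho /K1 /K2 /ze; ring.
  have D4 : (K1 * eta + K2 * h) * eta <= 1 / 4 * eta.
    by apply: ler_wpM2r; [exact: ltW|clear -hK2 etaK; lra].
  have D5 : `|z T - xe| <= 1 / 4 * eta.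
    by apply: le_trans (Hz T (ltW T0)) _; rewrite ler_wpM2r // ltW.
  rewrite veta -[_ *m v](subrK (z T - xe)); apply: le_trans (ler_normD _ _) _.
  move: (le_trans D D2) D4 D5; rewrite D3.
  set p := `|_ - _|; set q := `|z T - xe| => P1 P2 P3.
  by have := lerD (le_trans P1 P2) P3; move: (p + q) => ?; clear; lra.
(* Homogeneity carries the bound from the sphere of radius [eta] to all vectors. *)
move=> v; have [->|v0] := eqVneq v 0.
  by rewrite mulmx0 normr0 mul0r.
have nv : 0 < `|v| by rewrite normr_gt0.
have nev : 0 < eta / `|v| by rewrite divr_gt0.
have := key ((eta / `|v|) *: v).
rewrite -scalemxAr !norm_scale ?(ltW nev) // divfK ?gt_eqF // => /(_ erefl).
move: nev nv; move: `|_ *m v| `|v| => x y nev nv.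
rewrite mulrC -ler_pdivlMr // => /le_trans; apply.
by rewrite le_eqVlt; apply/orP; left; apply/eqP; field; rewrite !gt_eqF.
Qed.

End ExponentialStability.

(** * Adapted norms and their gluing over the input interval *)

Section LyapunovNorms.
Variables (R : realType) (n : nat).
Implicit Types (v w : 'cV[R]_n.+1) (A : R -> 'M[R]_n.+1).
Implicit Types (N : R -> 'cV[R]_n.+1 -> R).

(* [lyap_euler] says that the logarithmic norm of [A i] induced by [N i] is at
   most [- al]. *)
Record lyapunov_norms A (c d : R) N (c2 c3 al h0 : R) : Prop := LyapunovNorms {
  lyap_c3 : 0 <= c3;
  lyap_al : 0 < al;
  lyap_h0 : 0 < h0;
  lyap_lower : forall (i : R) v, `|v| <= N i v;
  lyap_upper : forall i v, N i v <= c2 * `|v|;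
  lyap_add : forall i v w, N i (v + w) <= N i v + N i w;
  lyap_lip : forall (i j : R) v, `|N i v - N j v| <= c3 * `|i - j| * `|v|;
  lyap_euler : forall (i h : R) v, c <= i <= d -> 0 <= h <= h0 ->
     N i (v + h *: (A i *m v)) <= (1 - al * h) * N i v }.

Definition has_lyapunov_norms A (c d : R) :=
  exists (N : R -> 'cV[R]_n.+1 -> R) (c2 c3 al h0 : R), lyapunov_norms A c d N c2 c3 al h0.

Lemma lyap_ge0 A (c d : R) N (c2 c3 al h0 : R) : lyapunov_norms A c d N c2 c3 al h0 ->
  forall i v, 0 <= N i v.
Proof. by move=> L i v; apply: le_trans (lyap_lower L i v). Qed.

Lemma lyap_upper_ge0 A (c d : R) N (c2 c3 al h0 : R) :
  lyapunov_norms A c d N c2 c3 al h0 -> 1 <= c2.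
Proof.
move=> L; pose v : 'cV[R]_n.+1 := const_mx 1.
have v1 : 0 < `|v|.
  rewrite normr_gt0; apply/eqP => /matrixP /(_ 0 0); rewrite !mxE.
  by move/eqP; rewrite oner_eq0.
rewrite -(ler_pM2r v1) mul1r.
exact: le_trans (lyap_lower L 0 v) (lyap_upper L 0 v).
Qed.

Lemma lyap_dist A (c d : R) N (c2 c3 al h0 : R) : lyapunov_norms A c d N c2 c3 al h0 ->
  forall i v w, N i v <= N i w + c2 * `|v - w|.
Proof.
move=> L i v w; rewrite -{1}[v](subrK w) addrC.
by apply: le_trans (lyap_add L _ _ _) _; rewrite lerD2l (lyap_upper L).
Qed.

Section PowerSum.
Variables (B : 'M[R]_n.+1) (m : nat) (rho : R).

Definition power_sum_norm v : R := \sum_(k < m) rho ^- k * `|B ^+ k *m v|.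

Lemma power_sum_lower v : (0 < m)%N -> 0 < rho -> `|v| <= power_sum_norm v.
Proof.
rewrite /power_sum_norm; case: m => // m' _ rho0.
rewrite big_ord_recl /= expr0 invr1 mul1r expr0 mul1mx lerDl sumr_ge0 // => k _.
by rewrite mulr_ge0 // invr_ge0 exprn_ge0 // ltW.
Qed.

Lemma power_sum_upper v : 0 < rho ->
  power_sum_norm v <= (\sum_(k < m) rho ^- k * opbound (B ^+ k)) * `|v|.
Proof.
move=> rho0; rewrite mulr_suml; apply: ler_sum => k _; rewrite -mulrA.
by rewrite ler_wpM2l ?norm_mulmx_le // invr_ge0 exprn_ge0 // ltW.
Qed.

Lemma power_sum_add v w : 0 < rho ->
  power_sum_norm (v + w) <= power_sum_norm v + power_sum_norm w.
Proof.
move=> rho0; rewrite -big_split /=; apply: ler_sum => k _.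
by rewrite -mulrDr ler_wpM2l ?mulmxDr ?ler_normD // invr_ge0 exprn_ge0 // ltW.
Qed.

Lemma power_sum_scale (a : R) v : 0 <= a ->
  power_sum_norm (a *: v) = a * power_sum_norm v.
Proof.
move=> a0; rewrite mulr_sumr; apply: eq_bigr => k _.
by rewrite -scalemxAr norm_scale // mulrCA.
Qed.

(** Applying [B] shifts the weighted sum by one index; the term that appears at the end is no larger
    than the term [|v|] lost at the beginning. *)
Lemma power_sum_contract v : 0 < rho -> `|B ^+ m *m v| <= rho ^+ m * `|v| ->
  power_sum_norm (B *m v) <= rho * power_sum_norm v.
Proof.
move=> rho0 H.
have -> : power_sum_norm (B *m v) =
    rho * (\sum_(k < m) rho ^- k.+1 * `|B ^+ k.+1 *m v|).
  rewrite mulr_sumr; apply: eq_bigr => k _.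
  rewrite [B ^+ k.+1]exprSr -mulmxE mulmxA mulrA; congr (_ * _).
  by rewrite exprS invfM mulrA divff ?mul1r // gt_eqF.
rewrite ler_pM2l //.
have E : `|v| + \sum_(k < m) rho ^- k.+1 * `|B ^+ k.+1 *m v| =
    power_sum_norm v + rho ^- m * `|B ^+ m *m v|.
  transitivity (\sum_(k < m.+1) rho ^- k * `|B ^+ k *m v|).
    by rewrite big_ord_recl /= !expr0 invr1 mul1r mul1mx.
  by rewrite big_ord_recr.
have : rho ^- m * `|B ^+ m *m v| <= `|v|.
  by rewrite mulrC ler_pdivrMr ?exprn_gt0 // mulrC.
move: E; move: (\sum_(k < m) _) `|v| (power_sum_norm v) (_ * _) => a b p q.
by clear; lra.
Qed.

End PowerSum.

(** For [h' <= h] the map [1 + h' *: A] is a convex combination of the identity and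
    [B = 1 + h *: A], so a contraction by [B] yields a rate valid for all smaller steps. *)
Lemma euler_lyapunov_norm (A : 'M[R]_n.+1) (h : R) (m : nat) :
  0 < h -> (0 < m)%N ->
  (forall v, `|(1 + h *: A) ^+ m *m v| <= `|v| / 2) ->
  exists (N : 'cV[R]_n.+1 -> R) (c2 al : R),
   [/\ 0 < al, forall v, `|v| <= N v, forall v, N v <= c2 * `|v|,
    forall v w, N (v + w) <= N v + N w &
    forall (h' : R) v, 0 <= h' <= h -> N (v + h' *: (A *m v)) <= (1 - al * h') * N v].
Proof.
move=> h0 m0 H; have mR : 0 < m%:R :> R by rewrite ltr0n.
have m1 : 1 <= m%:R :> R by rewrite ler1n.
have imR : 0 < (2 * m%:R)^-1 :> R by rewrite invr_gt0 mulr_gt0.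
have im1 : (2 * m%:R)^-1 <= 1 / 2 :> R.
  by rewrite -[leLHS]mul1r ler_pdivrMr ?mulr_gt0 //; lra.
(* By the Bernoulli inequality [rho ^+ m >= 1 / 2], so halving by [B ^+ m] is contraction by at
   least [rho ^+ m]. *)
pose rho : R := 1 - (2 * m%:R)^-1.
have rho0 : 0 < rho by rewrite /rho; lra.
have rhom : 1 / 2 <= rho ^+ m.
  suff B (k : nat) : 1 - k%:R * (2 * m%:R)^-1 <= rho ^+ k.
    apply: le_trans (B m); rewrite le_eqVlt; apply/orP; left; apply/eqP.
    by field; rewrite gt_eqF.
  elim: k => [|k IH]; first by rewrite mul0r expr0 subr0.
  rewrite exprS mulrSr; apply: (@le_trans _ _ (rho * (1 - k%:R * (2 * m%:R)^-1))).
    have : 0 <= k%:R * ((2 * m%:R)^-1 * (2 * m%:R)^-1) :> R.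
      by rewrite !mulr_ge0 // ltW.
    by rewrite /rho; lra.
  by rewrite ler_wpM2l // ltW.
pose B : 'M[R]_n.+1 := 1 + h *: A.
pose N := power_sum_norm B m rho.
have N0 v : 0 <= N v by apply: le_trans (power_sum_lower _ _ _ _).
exists N, (\sum_(k < m) rho ^- k * opbound (B ^+ k)), ((2 * m%:R)^-1 / h).
split.
- by rewrite divr_gt0.
- by move=> v; apply: power_sum_lower.
- by move=> v; apply: power_sum_upper.
- by move=> v w; apply: power_sum_add.
move=> h' v /andP[h'0 h'h].
have t01 : 0 <= h' / h by rewrite divr_ge0 // ltW.
have t1 : 0 <= 1 - h' / h by rewrite subr_ge0 ler_pdivrMr // mul1r.
have -> : v + h' *: (A *m v) = (1 - h' / h) *: v + (h' / h) *: (B *m v).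
  rewrite mulmxDl mul1mx -scalemxAl scalerDr scalerA divfK ?gt_eqF //.
  by rewrite addrA -scalerDl subrK scale1r.
apply: le_trans (power_sum_add _ _ _ _ rho0) _.
rewrite !power_sum_scale // -/N.
have : N (B *m v) <= rho * N v.
  apply: power_sum_contract => //; apply: le_trans (H v) _.
  by rewrite mulrC ler_wpM2r // -[2^-1]mul1r.
move/(ler_wpM2l t01); rewrite /rho; set x := (2 * m%:R)^-1.
have -> : x / h * h' = x * (h' / h) by ring.
move: (N v) (N _) (h' / h) x => p q y x; clear; lra.
Qed.

(** The linear ramp, 0 to the left of [c] and 1 to the right of [d]. *)
Definition hat (c d i : R) : R := Num.min 1 (Num.max 0 ((i - c) / (d - c))).

Lemma hat_itv (c d i : R) : 0 <= hat c d i <= 1.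
Proof. by rewrite /hat le_min ler01 le_max lexx /= ge_min lexx. Qed.

Lemma minr_dist (x y z : R) : `|Num.min z x - Num.min z y| <= `|x - y|.
Proof.
have H1 := ler_norm (x - y); have := ler_norm (y - x); rewrite distrC => H2.
apply/ler_normlP; rewrite /Num.min /Order.min.
by case: ltP => h1; case: ltP => h2; split; lra.
Qed.

Lemma maxr_dist (x y z : R) : `|Num.max z x - Num.max z y| <= `|x - y|.
Proof.
have H1 := ler_norm (x - y); have := ler_norm (y - x); rewrite distrC => H2.
apply/ler_normlP; rewrite /Num.max /Order.max.
by case: ltP => h1; case: ltP => h2; split; lra.
Qed.

Lemma hat_lip (c d i j : R) : c < d ->
  `|hat c d i - hat c d j| <= (d - c)^-1 * `|i - j|.
Proof.
move=> cd; apply: le_trans (minr_dist _ _ _) _.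
apply: le_trans (maxr_dist _ _ _) _.
rewrite -mulrBl normrM mulrC [ `|(d - c)^-1|]gtr0_norm ?invr_gt0 ?subr_gt0 //.
by have -> : i - c - (j - c) = i - j by ring.
Qed.

Lemma hat_left (c d i : R) : c < d -> i <= c -> hat c d i = 0.
Proof.
move=> cd ic; rewrite /hat max_l ?min_r //.
by rewrite pmulr_lle0 ?subr_le0 // invr_gt0 subr_gt0.
Qed.

Lemma hat_right (c d i : R) : c < d -> d <= i -> hat c d i = 1.
Proof.
move=> cd di; rewrite /hat min_l // le_max; apply/orP; right.
by rewrite ler_pdivlMr ?subr_gt0 // mul1r lerD2r.
Qed.

(** On the overlap [c', d] a convex combination of two norms decays because both do; outside it the
    weight selects the norm whose decay is known. The ramp is Lipschitz, hence so is the glued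
    family. *)
Lemma lyapunov_glue A (c c' d e : R) : c' < d ->
  has_lyapunov_norms A c d -> has_lyapunov_norms A c' e ->
  has_lyapunov_norms A c e.
Proof.
move=> cd [N [c2 [c3 [al [h0 L]]]]] [N' [c2' [c3' [al' [h0' L']]]]].
pose psi := hat c' d.
pose K := (d - c')^-1; have K0 : 0 < K by rewrite invr_gt0 subr_gt0.
have psi01 i : 0 <= psi i <= 1 := hat_itv c' d i.
have c21 := lyap_upper_ge0 L; have c21' := lyap_upper_ge0 L'.
have c30 := lyap_c3 L; have c30' := lyap_c3 L'.
exists (fun i v => (1 - psi i) * N i v + psi i * N' i v), (c2 + c2'),
  (c3 + c3' + K * (c2 + c2')), (Num.min al al'), (Num.min h0 h0').
split.
- by rewrite !addr_ge0 // mulr_ge0 ?addr_ge0 //; lra.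
- by rewrite lt_min (lyap_al L) (lyap_al L').
- by rewrite lt_min (lyap_h0 L) (lyap_h0 L').
- move=> i v; have /andP[p0 p1] := psi01 i.
  have := lyap_lower L i v; have := lyap_lower L' i v; nra.
- move=> i v; have /andP[p0 p1] := psi01 i.
  have := lyap_upper L i v; have := lyap_upper L' i v.
  have := lyap_ge0 L i v; have := lyap_ge0 L' i v; nra.
- move=> i v w; have /andP[p0 p1] := psi01 i.
  have := lyap_add L i v w; have := lyap_add L' i v w; nra.
- move=> i j v.
  (* Separates the variation of the two norms from the variation of the weight. *)
  have -> : (1 - psi i) * N i v + psi i * N' i v -
      ((1 - psi j) * N j v + psi j * N' j v) =
      ((1 - psi i) * (N i v - N j v) + psi i * (N' i v - N' j v)) +
      (psi i - psi j) * (N' j v - N j v) by ring.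
  have /andP[p0 p1] := psi01 i.
  have q0 : 0 <= 1 - psi i by lra.
  have P := hat_lip i j cd; rewrite -/psi -/K in P.
  apply: le_trans (ler_normD _ _) _.
  have A1 : `|(1 - psi i) * (N i v - N j v) + psi i * (N' i v - N' j v)| <=
       c3 * `|i - j| * `|v| + c3' * `|i - j| * `|v|.
    apply: le_trans (ler_normD _ _) _; rewrite !normrM (ger0_norm q0) (ger0_norm p0).
    have H1 := lyap_lip L i j v; have H2 := lyap_lip L' i j v.
    have N1 := normr_ge0 (N i v - N j v); have N2 := normr_ge0 (N' i v - N' j v).
    apply: lerD.
      by apply: le_trans H1; rewrite ler_piMl //; lra.
    by apply: le_trans H2; rewrite ler_piMl.
  have A2 : `|(psi i - psi j) * (N' j v - N j v)| <=
      K * `|i - j| * ((c2 + c2') * `|v|).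
    rewrite normrM; apply: ler_pM => //.
    have := lyap_upper L j v; have := lyap_upper L' j v.
    have := lyap_ge0 L j v; have := lyap_ge0 L' j v.
    by move=> *; apply/ler_normlP; split; lra.
  apply: le_trans (lerD A1 A2) _; rewrite le_eqVlt; apply/orP; left; apply/eqP.
  by ring.
move=> i h v /andP[ci ie] /andP[hp]; rewrite le_min => /andP[hh0 hh0'].
have /andP[p0 p1] := psi01 i.
have l1 : Num.min al al' <= al by rewrite ge_min lexx.
have l2 : Num.min al al' <= al' by rewrite ge_min lexx orbT.
have n1 := lyap_ge0 L i v; have n2 := lyap_ge0 L' i v.
set l := Num.min al al' in l1 l2 *.
have W1 : i <= d -> N i (v + h *: (A i *m v)) <= (1 - l * h) * N i v.
  move=> id; apply: le_trans (lyap_euler L _ _ _) _; rewrite ?ci ?hp //.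
  by rewrite ler_wpM2r // lerD2l lerN2 ler_wpM2r.
have W2 : c' <= i -> N' i (v + h *: (A i *m v)) <= (1 - l * h) * N' i v.
  move=> id; apply: le_trans (lyap_euler L' _ _ _) _; rewrite ?id ?hp //.
  by rewrite ler_wpM2r // lerD2l lerN2 ler_wpM2r.
case: (leP i c') => [ic|ic].
  rewrite /psi hat_left // !subr0 !mul1r !mul0r !addr0.
  by apply: W1; lra.
case: (leP i d) => [id|di].
  rewrite mulrDr; apply: lerD; rewrite mulrCA ler_wpM2l //; first lra.
    exact: W1.
  by apply: W2; lra.
have -> : psi i = 1 by apply: hat_right => //; exact: ltW.
rewrite subrr !mul0r !mul1r !add0r; apply: W2.
exact: le_trans (ltW cd) (ltW di).
Qed.

(** The norm adapted to [A i0], kept constant in [i], still decays for nearby matrices. *)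
Lemma lyapunov_local A (a b LA i0 : R) : a <= i0 <= b -> 0 <= LA ->
  (forall (i j : R) v, a <= i <= b -> a <= j <= b ->
     `|A i *m v - A j *m v| <= LA * `|i - j| * `|v|) ->
  euler_contractive (A i0) ->
  exists2 r : R, 0 < r & forall c d : R, a <= c -> d <= b -> i0 - r <= c -> d <= i0 + r ->
    has_lyapunov_norms A c d.
Proof.
move=> i0ab LA0 HA [h h0 [m [m0 Hm]]].
have [N [c2 [al [al0 N1 N2 N3 N4]]]] := euler_lyapunov_norm h0 m0 Hm.
have N0 v : 0 <= N v by apply: le_trans (N1 v).
pose v1 : 'cV[R]_n.+1 := const_mx 1.
have c20 : 0 <= c2.
  have v10 : 0 < `|v1|.
    rewrite normr_gt0; apply/eqP => /matrixP /(_ 0 0); rewrite !mxE.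
    by move/eqP; rewrite oner_eq0.
  by rewrite -(pmulr_lge0 _ v10); apply: le_trans (N2 v1).
(* Within this radius the perturbation of the matrix costs at most half of the rate; the [+ 1]
   avoids a division by 0. *)
pose r := al / 2 / (c2 * LA + 1).
have q0 : 0 <= c2 * LA by rewrite mulr_ge0.
have r0 : 0 < r by rewrite !divr_gt0 //; lra.
have rLA : c2 * LA * r <= al / 2.
  rewrite /r mulrA ler_pdivrMr; last lra.
  by rewrite mulrC ler_wpM2l ?divr_ge0 ?(ltW al0) //; lra.
clearbody r.
exists r => // c d ac db ic di.
exists (fun=> N), c2, 0, (al / 2), h; split=> //.
- by rewrite divr_gt0.
- by move=> i j v; rewrite subrr normr0 !mul0r.
move=> i h' v /andP[ci id] /andP[h'0 h'h].
have iab : a <= i <= b by rewrite (le_trans ac) // (le_trans id).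
have ii0 : `|i - i0| <= r by apply/ler_normlP; split; lra.
have -> : v + h' *: (A i *m v) =
    (v + h' *: (A i0 *m v)) + h' *: (A i *m v - A i0 *m v).
  by rewrite scalerBr -addrA (addrC (h' *: (A i0 *m v))) subrK.
apply: le_trans (N3 _ _) _.
have B1 : N (v + h' *: (A i0 *m v)) <= (1 - al * h') * N v.
  by apply: N4; rewrite h'0.
have B2 : N (h' *: (A i *m v - A i0 *m v)) <= h' * (al / 2) * N v.
  apply: le_trans (N2 _) _; rewrite norm_scale // mulrCA -mulrA ler_wpM2l //.
  apply: (@le_trans _ _ (c2 * (LA * r * `|v|))).
    rewrite ler_wpM2l //; apply: le_trans (HA _ _ _ iab i0ab) _.
    by rewrite ler_wpM2r // ler_wpM2l.
  apply: (@le_trans _ _ (al / 2 * `|v|)); last by rewrite ler_wpM2l // divr_ge0 // ltW.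
  by rewrite !mulrA ler_wpM2r.
lra.
Qed.

(** Real induction on the right end point takes the place of a finite subcover. *)
Lemma has_lyapunov_norms_itv A (a b LA : R) : a <= b -> 0 <= LA ->
  (forall (i j : R) v, a <= i <= b -> a <= j <= b ->
     `|A i *m v - A j *m v| <= LA * `|i - j| * `|v|) ->
  (forall i : R, a <= i <= b -> euler_contractive (A i)) ->
  has_lyapunov_norms A a b.
Proof.
move=> ab LA0 HA Hm.
have loc i : a <= i <= b -> _ := fun ib => lyapunov_local ib LA0 HA (Hm i ib).
apply: (real_induction (P := fun t => t <= b -> has_lyapunov_norms A a t)
   _ _ _ ab (lexx b)).
- move=> _; have [|r r0 H] := loc a; first by rewrite lexx.
  by apply: H => //; lra.
- move=> t at_ IH; have [bt|tb] := leP b t.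
    by exists 1 => // s /andP[ts _] sb; lra.
  have [|r r0 H] := loc t; first by rewrite at_ ltW.
  exists r => // s /andP[ts st] sb.
  have [ta|ta] := eqVneq t a.
    by apply: H => //; lra.
  have {}ta : a < t by rewrite lt_neqAle eq_sym ta.
  have m1 : a <= Num.max a (t - r / 2) by rewrite le_max lexx.
  have m2 : t - r / 2 <= Num.max a (t - r / 2) by rewrite le_max lexx orbT.
  have m3 : Num.max a (t - r / 2) < t by rewrite gt_max ta; lra.
  apply: (lyapunov_glue m3).
    by apply: IH; rewrite ?lexx ?at_ // ltW.
  by apply: H; lra.
- move=> t at_ IH tb; have [|r r0 H] := loc t; first by rewrite tb ltW.
  have m1 : a <= Num.max a (t - r / 2) by rewrite le_max lexx.
  have m2 : t - r / 2 <= Num.max a (t - r / 2) by rewrite le_max lexx orbT.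
  have m3 : Num.max a (t - r / 2) < t by rewrite gt_max at_; lra.
  set c' := Num.max _ _ in m1 m2 m3.
  (* Here the family on the left is known only up to times before [t], so the overlap has to end
     strictly before [t]. *)
  apply: (@lyapunov_glue A a c' ((c' + t) / 2) t); first lra.
    by apply: IH; [apply/andP; split|]; lra.
  by apply: H; lra.
Qed.

End LyapunovNorms.

(** * A fast stable plant driven by a slow integrator *)

Section SlowFast.
Variables (R : realType) (n : nat).
Notation vec := 'cV[R]_n.+1.
Implicit Types (f : R -> vec -> vec) (Q : vec -> R) (Xi : R -> vec).

(** All constants are parameters, not existentially bound: the original and the truncated plant then
    share them, and with them the gain bound and the region of attraction. *)
Record plant f Q Xi (A : R -> 'M[R]_n.+1) (a b : R) (N : R -> vec -> R)
    (c2 c3 al h0 C2 CQ LX LG mu : R) : Prop := Plant {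
  pl_lyap : lyapunov_norms A a b N c2 c3 al h0;
  pl_C2 : 0 <= C2; pl_CQ : 0 <= CQ; pl_LX : 0 <= LX; pl_LG : 0 <= LG;
  pl_mu : 0 < mu;
  pl_lin : forall (i : R) (e : vec), a <= i <= b -> `|e| <= 1 ->
    `|f i (Xi i + e) - A i *m e| <= C2 * `|e| ^+ 2;
  pl_out : forall (i : R) (e : vec), a <= i <= b -> `|e| <= 1 ->
    `|Q (Xi i + e) - Q (Xi i)| <= CQ * `|e|;
  pl_Xi : forall i j : R, a <= i <= b -> a <= j <= b ->
    `|Xi i - Xi j| <= LX * `|i - j|;
  pl_G : forall i j : R, a <= i <= b -> a <= j <= b ->
    `|Q (Xi i) - Q (Xi j)| <= LG * `|i - j|;
  pl_mono : forall i j : R, a <= i <= b -> a <= j <= b -> i <= j ->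
    mu * (j - i) <= Q (Xi j) - Q (Xi i) }.

(* The last two inequalities are all that the convergence proof needs to know
   about the saturating integrator. *)
Record trajectory f Q Xi (a b ifr Kt r : R) (x : R -> vec) (i : R -> R) : Prop :=
 Trajectory {
  tr_x : ccont x; tr_i : ccont i;
  tr_itv : forall t, 0 <= t -> a <= i t <= b;
  tr_fast : forall t, 0 <= t -> `|x t - Xi (i t)| <= r -> forall e, 0 < e ->
    exists2 d, 0 < d & forall h, 0 < h < d ->
      `|x (t + h) - x t - h *: f (i t) (x t)| <= h * e;
  tr_slow : forall t, 0 <= t -> forall e, 0 < e ->
    exists2 d, 0 < d & forall h, 0 < h < d ->
      [/\ `|i (t + h) - i t| <= h * (`|(Q (Xi ifr) - Q (x t)) / Kt| + e),
          ifr < i t -> i (t + h) - i t <= h * ((Q (Xi ifr) - Q (x t)) / Kt + e) &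
          i t < ifr -> h * ((Q (Xi ifr) - Q (x t)) / Kt - e) <= i (t + h) - i t] }.

Definition slow_fast_norm (N : R -> vec -> R) (Xi : R -> vec) (gam ifr : R)
    (x : vec) (i : R) : R :=
  Num.max (gam * N i (x - Xi i)) `|i - ifr|.

(** [N0] is the norm of the fast error before the step, [N1] and [N2] those after it in the old and
    in the new norm, and [d] is the motion of the input. The quadratic remainder costs [al / 4]; the
    motion enters through the shift of the equilibrium ([c2 * LX]) and the change of norm ([c3]). *)
Lemma fast_step_bound (N0 N1 N2 e0 h al c2 c3 C2 LX d eps' w r : R) :
  0 <= h -> 0 <= e0 -> e0 <= N0 -> e0 <= r -> 0 <= c2 -> 0 <= C2 ->
  0 <= LX -> 0 <= c3 ->
  c2 * C2 * r <= al / 4 ->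
  N2 <= N1 + c3 * d ->
  N1 <= (1 - al * h) * N0 + c2 * (h * eps' + h * (C2 * e0 ^+ 2) + LX * d) ->
  d <= h * (w + eps') ->
  N2 <= (1 - 3 / 4 * al * h) * N0 + h * ((c2 * LX + c3) * w)
        + h * ((c2 + (c2 * LX + c3)) * eps').
Proof.
move=> h0 e00 eN er c20 C20 LX0 c30 H1 H2 H3 H4.
have B0 : 0 <= c2 * LX + c3 by rewrite addr_ge0 // mulr_ge0.
have := ler_wpM2l B0 H4.
have : c2 * C2 * e0 ^+ 2 <= al / 4 * N0.
  have cc0 : 0 <= c2 * C2 by rewrite mulr_ge0.
  apply: (@le_trans _ _ (c2 * C2 * r * e0)).
    by rewrite expr2 mulrA ler_wpM2r // ler_wpM2l.
  apply: ler_pM => //; rewrite mulr_ge0 //; exact: le_trans e00 er.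
move/(ler_wpM2l h0); lra.
Qed.

(** The drive [w] is proportional to the gain [kp], and the bound on [kp] limits its effect to
    [al / 4] of [W]; of the rate [3 / 4 * al] there remains [al / 2]. *)
Lemma fast_contract_bound (N0 N2 gam h al B kp LG CQ W y w eps eps' c : R) :
  0 <= h -> 0 < gam -> 0 <= B -> 0 <= kp -> 0 <= LG -> 0 <= CQ -> 0 <= N0 ->
  0 <= y -> al * h <= 1 -> 0 <= al ->
  kp * (B * (gam * LG + CQ)) <= al / 4 ->
  w <= kp * (LG * y + CQ * N0) ->
  N2 <= (1 - 3 / 4 * al * h) * N0 + h * (B * w) + h * (c * eps') ->
  gam * (c * eps') <= eps ->
  gam * N0 <= W -> y <= W ->
  gam * N2 <= (1 - al / 2 * h) * W + eps * h.
Proof.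
move=> h0 g0 B0 kp0 LG0 CQ0 N00 y0 ah al0 H1 H2 H3 H4 H5 H6.
have W0 : 0 <= W by apply: le_trans H6.
have A1 := ler_wpM2l (ltW g0) H3.
have A2 : h * (gam * (B * w)) <= h * (al / 4 * W).
  rewrite ler_wpM2l //; apply: (@le_trans _ _ (gam * (B * (kp * (LG * y + CQ * N0))))).
    by rewrite ler_wpM2l ?(ltW g0) // ler_wpM2l.
  apply: (@le_trans _ _ (kp * (B * (gam * LG + CQ)) * W)); last exact: ler_wpM2r.
  have -> : gam * (B * (kp * (LG * y + CQ * N0))) =
    kp * (B * (gam * LG * y + CQ * (gam * N0))) by ring.
  rewrite -!mulrA ler_wpM2l // ler_wpM2l // mulrDl lerD //.
    by rewrite -mulrA ler_wpM2l ?(ltW g0) // ler_wpM2l.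
  by rewrite ler_wpM2l.
have A3 : (1 - 3 / 4 * al * h) * (gam * N0) <= (1 - 3 / 4 * al * h) * W.
  by rewrite ler_wpM2l // subr_ge0; have := mulr_ge0 al0 h0; lra.
have A4 := ler_wpM2l h0 H4.
by move: A1 A2 A3 A4; clear; move=> *; lra.
Qed.

(** The output error due to the fast state is at most [CQ / gam] times [W], and [2 * CQ <= mu * gam]
    makes this half of the restoring slope [mu]. *)
Lemma slow_contract_bound (y0 y1 h kp mu CQ gam N0 W eps : R) :
  0 <= h -> 0 < gam -> 0 <= kp -> 0 < mu -> 0 <= CQ -> 0 <= y0 ->
  2 * CQ <= mu * gam -> kp * mu * h <= 1 ->
  y1 <= y0 + h * (kp * (CQ * N0 - mu * y0) + eps) ->
  gam * N0 <= W -> y0 <= W ->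
  y1 <= (1 - kp * mu / 2 * h) * W + eps * h.
Proof.
move=> h0 g0 kp0 mu0 CQ0 y00 H1 H2 H3 H4 H5.
have W0 : 0 <= W by apply: le_trans H5.
have A1 : CQ * N0 <= mu / 2 * W.
  rewrite -(ler_pM2l g0) mulrCA; apply: (@le_trans _ _ (CQ * W)).
    by rewrite ler_wpM2l.
  by rewrite mulrA ler_wpM2r //; lra.
have A2 : (1 - kp * mu * h) * y0 <= (1 - kp * mu * h) * W.
  by rewrite ler_wpM2l // subr_ge0.
have := ler_wpM2l (mulr_ge0 h0 kp0) A1.
move: H3 A2; clear; move=> *; lra.
Qed.

(** The last hypothesis makes the step too short to cross [ifr], unless it starts there. On either
    side only the inequality towards [ifr] matters; at [ifr] itself the drive comes from the fast
    error alone. *)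
Lemma slow_step_bound (i0 i1 ifr w h kp mu CQ e0 eps q : R) :
  0 < h -> 0 <= kp -> `|w| <= q -> (i0 = ifr -> q <= kp * (CQ * e0)) ->
  (ifr < i0 -> w <= kp * (CQ * e0 - mu * `|i0 - ifr|)) ->
  (i0 < ifr -> - w <= kp * (CQ * e0 - mu * `|i0 - ifr|)) ->
  `|i1 - i0| <= h * (`|w| + eps) ->
  (ifr < i0 -> i1 - i0 <= h * (w + eps)) ->
  (i0 < ifr -> h * (w - eps) <= i1 - i0) ->
  h * (`|w| + eps) <= `|i0 - ifr| \/ i0 = ifr ->
  `|i1 - ifr| <= `|i0 - ifr| + h * (kp * (CQ * e0 - mu * `|i0 - ifr|) + eps).
Proof.
move=> h0 kp0 wq Hq H1 H2 H3 H4 H5 H6; have [lt|gt|eq] := ltgtP i0 ifr.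
- have E0 : `|i0 - ifr| = ifr - i0 by rewrite distrC gtr0_norm // subr_gt0.
  case: H6; last lra; move=> H6.
  have := H5 lt; have := H2 lt; move/(ler_wpM2l (ltW h0)).
  have : i1 <= ifr by have := ler_norm (i1 - i0); lra.
  move=> i1f; have -> : `|i1 - ifr| = ifr - i1 by rewrite distrC ger0_norm // subr_ge0.
  by rewrite E0; move=> *; lra.
- have E0 : `|i0 - ifr| = i0 - ifr by rewrite gtr0_norm // subr_gt0.
  case: H6; last lra; move=> H6.
  have := H4 gt; have := H1 gt; move/(ler_wpM2l (ltW h0)).
  have : ifr <= i1 by have := ler_norm (i0 - i1); rewrite distrC; lra.
  move=> i1f; have -> : `|i1 - ifr| = i1 - ifr by rewrite ger0_norm // subr_ge0.
  by rewrite E0; move=> *; lra.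
- rewrite eq subrr normr0 mulr0 subr0 add0r -{1}eq.
  apply: le_trans H3 _; rewrite ler_wpM2l ?(ltW h0) // lerD2r.
  by apply: le_trans wq (Hq eq).
Qed.

Lemma fast_error_split (x x' z z' p q : vec) (h : R) :
  x' - z' - ((x - z) + h *: p) =
  (x' - x - h *: q) + h *: (q - p) - (z' - z).
Proof. by apply/matrixP => i j; rewrite !mxE; ring. Qed.

Lemma slow_step_mono (y0 h kp mu p q eps eps' : R) : 0 <= h -> 0 <= kp ->
  p <= q -> eps' <= eps ->
  y0 + h * (kp * (p - mu * y0) + eps') <= y0 + h * (kp * (q - mu * y0) + eps).
Proof.
by move=> h0 k0 pq ee; rewrite lerD2l ler_wpM2l // lerD // ler_wpM2l // lerD2r.
Qed.

Lemma max_dist_le (x y x' y' c : R) : `|x - x'| <= c -> `|y - y'| <= c ->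
  `|Num.max x y - Num.max x' y'| <= c.
Proof.
move=> /ler_normlP[A1 A2] /ler_normlP[A3 A4]; apply/ler_normlP.
by rewrite /Num.max /Order.max; case: ltP => h1; case: ltP => h2; split; lra.
Qed.

Lemma slow_fast_norm_ccont f Q Xi A (a b : R) N (c2 c3 al h0 C2 CQ LX LG mu : R)
    (gam ifr Kt r : R) (x : R -> vec) (i : R -> R) :
  plant f Q Xi A a b N c2 c3 al h0 C2 CQ LX LG mu -> 0 <= gam ->
  trajectory f Q Xi a b ifr Kt r x i ->
  ccont (fun t => x t - Xi (i t)) /\
  ccont (fun t => slow_fast_norm N Xi gam ifr (x t) (i t)).
Proof.
move=> pl g0 tr; have L := pl_lyap pl.
have c20 : 0 <= c2 by have := lyap_upper_ge0 L; lra.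
have cXi : ccont (fun t => Xi (i t)).
  apply: (ccont_dom (tr_i tr) (tr_i tr)) => t t0; exists LX; first exact: pl_LX pl.
  move=> s s0; apply: le_trans (pl_Xi pl (tr_itv tr s0) (tr_itv tr t0)) _.
  by rewrite ler_wpM2l ?(pl_LX pl) // lerDl.
have ce := ccont_sub (tr_x tr) cXi; split=> //.
apply: (ccont_dom ce (tr_i tr)) => t t0.
set e := fun t => x t - Xi (i t).
exists (gam * (c2 + c3 * `|e t|) + 1).
  by rewrite addr_ge0 // mulr_ge0 // addr_ge0 // mulr_ge0 // (lyap_c3 L).
move=> s s0; rewrite /slow_fast_norm -/(e s) -/(e t).
have E1 : `|gam * N (i s) (e s) - gam * N (i t) (e t)| <=
    gam * (c2 + c3 * `|e t|) * (`|e s - e t| + `|i s - i t|).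
  rewrite -mulrBr normrM ger0_norm // -mulrA ler_wpM2l //.
  have H1 := lyap_dist L (i s) (e s) (e t); have H2 := lyap_dist L (i s) (e t) (e s).
  rewrite distrC in H2; have /ler_normlP[H3 H4] := lyap_lip L (i s) (i t) (e t).
  have P1 : 0 <= c3 * `|e t| * `|e s - e t|.
    by rewrite !mulr_ge0 // (lyap_c3 L).
  have P2 : 0 <= c2 * `|i s - i t| by rewrite mulr_ge0.
  have -> : (c2 + c3 * `|e t|) * (`|e s - e t| + `|i s - i t|) =
    c2 * `|e s - e t| + c3 * `|i s - i t| * `|e t| +
    (c3 * `|e t| * `|e s - e t| + c2 * `|i s - i t|) by ring.
  move: H1 H2 H3 H4 P1 P2; move: (N _ _) (N (i s) (e t)) (N _ _) => n1 n2 n3.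
  move: (c2 * `|e s - e t|) (c3 * _ * _) (c2 * _) (c3 * _ * _) => m1 m2 m3 m4.
  by clear; move=> *; apply/ler_normlP; split; lra.
have E2 : `| `|i s - ifr| - `|i t - ifr| | <= `|i s - i t|.
  apply: le_trans (ler_dist_dist _ _) _.
  by have -> : i s - ifr - (i t - ifr) = i s - i t by ring.
have P3 : 0 <= gam * (c2 + c3 * `|e t|).
  by rewrite mulr_ge0 // addr_ge0 // mulr_ge0 // (lyap_c3 L).
have P4 : 0 <= `|e s - e t| + `|i s - i t| by rewrite addr_ge0.
have P5 : `|i s - i t| <= `|e s - e t| + `|i s - i t| by rewrite lerDr.
apply: max_dist_le.
  by apply: le_trans E1 _; rewrite ler_wpM2r // lerDl.
apply: le_trans E2 _; apply: le_trans P5 _.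
by rewrite -[leLHS]mul1r ler_wpM2r // lerDr.
Qed.

(** The constants [gam], [kap], [r] precede the plant, the target and the gain, and so serve any
    plant with the same bounds; only the rate [lam] depends on [Kt]. *)
Lemma slow_fast_decay f Q Xi A (a b : R) N (c2 c3 al h0 C2 CQ LX LG mu : R) :
  a < b -> plant f Q Xi A a b N c2 c3 al h0 C2 CQ LX LG mu ->
  exists gam kap r : R, [/\ 0 < gam, 0 < kap, 0 < r, r <= 1 &
   forall f' Q', plant f' Q' Xi A a b N c2 c3 al h0 C2 CQ LX LG mu ->
   forall ifr Kt : R, a <= ifr <= b -> kap^-1 < Kt ->
   exists2 lam : R, 0 < lam & forall (x : R -> vec) (i : R -> R),
     trajectory f' Q' Xi a b ifr Kt r x i ->
     gam * N (i 0) (x 0 - Xi (i 0)) <= b - a ->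
     forall t, 0 <= t ->
       `|x t - Xi (i t)| <= r /\
       slow_fast_norm N Xi gam ifr (x t) (i t) <=
         expR (- lam * t) * slow_fast_norm N Xi gam ifr (x 0) (i 0)].
Proof.
move=> ab pl; have L := pl_lyap pl.
have c21 := lyap_upper_ge0 L; have c30 := lyap_c3 L; have al0 := lyap_al L.
have h00 := lyap_h0 L; have C20 := pl_C2 pl; have CQ0 := pl_CQ pl.
have LX0 := pl_LX pl; have LG0 := pl_LG pl; have mu0 := pl_mu pl.
have c20 : 0 <= c2 by lra.
have N0 := lyap_ge0 L.
have cC : 0 <= c2 * C2 by rewrite mulr_ge0.
(* The quadratic remainder may use a quarter of the rate; [r <= 1 / 2] leaves room for the error to
   stay below 1 after a short step. *)
have [r [r0 r2 rC]] : exists r : R, [/\ 0 < r, r <= 1 / 2 & c2 * C2 * r <= al / 4].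
  exists (Num.min (1 / 2) (al / (4 * (c2 * C2 + 1)))); split.
  - by rewrite lt_min divr_gt0 //= divr_gt0 // mulr_gt0 //; lra.
  - by rewrite ge_min lexx.
  - apply: (@le_trans _ _ (c2 * C2 * (al / (4 * (c2 * C2 + 1))))).
      by rewrite ler_wpM2l // ge_min lexx orbT.
    rewrite mulrA ler_pdivrMr; last by rewrite mulr_gt0 //; lra.
    by have := mulr_ge0 cC (ltW al0); lra.
pose Y := b - a; have Y0 : 0 < Y by rewrite subr_gt0.
(* The first summand subordinates the output error to the slow rate; the second ensures that
   [W <= 2 * Y] forces the fast error below [r]. *)
pose gam := 2 * CQ / mu + 2 * Y / r.
have g1 : 0 <= 2 * CQ / mu by rewrite divr_ge0 ?mulr_ge0 // ltW.
have g2 : 0 < 2 * Y / r by rewrite divr_gt0 ?mulr_gt0.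
have g0 : 0 < gam by rewrite /gam; lra.
have gCQ : 2 * CQ <= mu * gam.
  by rewrite [mu * _]mulrC -ler_pdivrMr // /gam; lra.
have gr : 2 * Y <= gam * r by rewrite -ler_pdivrMr // /gam; lra.
clearbody gam.
pose B := c2 * LX + c3; have B0 : 0 <= B by rewrite addr_ge0 // mulr_ge0.
pose D := B * (gam * LG + CQ).
have D0 : 0 <= D by rewrite mulr_ge0 // addr_ge0 // mulr_ge0 // ltW.
(* [D] is the effect of the input motion on the fast part per unit of gain; a gain below [kap] keeps
   it under [al / 4]. *)
pose kap := al / (4 * (D + 1)).
have kap0 : 0 < kap by rewrite divr_gt0 // mulr_gt0 //; lra.
exists gam, kap, r; split=> //; first lra.
move=> {pl} {}f {}Q pl ifr Kt ifrab Ktk.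
have Kt0 : 0 < Kt by apply: lt_trans Ktk; rewrite invr_gt0.
pose kp := Kt^-1; have kp0 : 0 < kp by rewrite invr_gt0.
have kpk : kp <= kap by rewrite -[kap]invrK lef_pV2 ?posrE ?invr_gt0 // ltW.
have kpD : kp * D <= al / 4.
  apply: (@le_trans _ _ (kap * D)); first by rewrite ler_wpM2r.
  rewrite /kap mulrAC ler_pdivrMr; last by rewrite mulr_gt0 //; lra.
  by have := mulr_ge0 (ltW al0) D0; lra.
(* The last factor 1/2 is the one lost in [dini_expR_decay]. *)
pose lam := Num.min (al / 2) (kp * mu / 2) / 2.
have kpm : 0 < kp * mu by rewrite mulr_gt0.
have lam0 : 0 < lam by rewrite divr_gt0 // lt_min !divr_gt0.
have lam1 : 2 * lam <= al / 2 by rewrite mulrC divfK // ge_min lexx.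
have lam2 : 2 * lam <= kp * mu / 2 by rewrite mulrC divfK // ge_min lexx orbT.
have kpE : Kt^-1 = kp by [].
clearbody lam kp.
exists lam => // x i tr init.
pose W t := slow_fast_norm N Xi gam ifr (x t) (i t).
have [ce cW] := slow_fast_norm_ccont pl (ltW g0) tr.
have W0 t : 0 <= t -> 0 <= W t by move=> _; rewrite le_max normr_ge0 orbT.
have WY : W 0 <= Y.
  rewrite ge_max init /=.
  have /andP[i1 i2] := tr_itv tr (lexx 0); have /andP[j1 j2] := ifrab.
  by rewrite /Y; clear -i1 i2 j1 j2; apply/ler_normlP; split; lra.
have reg t : W t <= 2 * Y -> `|x t - Xi (i t)| <= r.
  rewrite ge_max => /andP[H _]; apply: le_trans (lyap_lower L (i t) _) _.
  by rewrite -(ler_pM2l g0); apply: le_trans H gr.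
suff main : forall t, 0 <= t -> W t <= expR (- lam * t) * W 0.
  move=> t t0; split; last exact: main.
  apply: reg; apply: le_trans (main t t0) _.
  apply: (@le_trans _ _ (1 * W 0)); last by rewrite mul1r; clear -WY Y0; lra.
  rewrite ler_wpM2r ?W0 // -expR0 ler_expR mulNr oppr_le0.
  by rewrite mulr_ge0 // ltW.
apply: (dini_expR_decay lam0 Y0 cW WY W0) => t t0 WtY eps eps0.
have er := reg t WtY; have itab := tr_itv tr t0.
pose et := x t - Xi (i t).
pose c := c2 + B; have c0 : 0 <= c by rewrite addr_ge0.
pose eps' := eps / (gam * c + 1).
have gc0 : 0 <= gam * c by rewrite mulr_ge0 // ltW.
have eps'0 : 0 < eps' by rewrite divr_gt0 //; clear -gc0; lra.
have gce : gam * (c * eps') <= eps.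
  rewrite /eps' !mulrA -mulrA mulrCA ler_piMr ?(ltW eps0) //.
  by rewrite ler_pdivrMr ?mul1r; clear -gc0; lra.
have epse : eps' <= eps by rewrite ler_pdivrMr ?ler_peMr ?(ltW eps0) //; clear -gc0; lra.
clearbody eps'.
have [d1 d10 D1] := tr_fast tr t0 er eps'0.
have [d2 d20 D2] := tr_slow tr t0 eps'0.
have [d3 d30 D3] := ce t t0 (1 / 2) ltac:(clear; lra).
pose w := (Q (Xi ifr) - Q (x t)) / Kt; rewrite -/w in D2.
have w0 : 0 < `|w| + eps' by rewrite ltr_wpDl.
(* Steps short enough for the input not to cross [ifr]. *)
have [d4 d40 D4] : exists2 d4, 0 < d4 & forall h, 0 < h < d4 ->
    h * (`|w| + eps') <= `|i t - ifr| \/ i t = ifr.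
  have [eq|neq] := eqVneq (i t) ifr.
    by exists 1 => // h _; right.
  exists (`|i t - ifr| / (`|w| + eps')).
    by rewrite divr_gt0 // normr_gt0 subr_eq0.
  by move=> h /andP[_ hd]; left; rewrite -ler_pdivlMr // ltW.
exists (Num.min (Num.min (Num.min d1 d2) (Num.min d3 d4))
   (Num.min h0 (Num.min al^-1 (kp * mu)^-1))).
  by rewrite !lt_min d10 d20 d30 d40 h00 !invr_gt0 al0 kpm.
move=> h /andP[hp]; rewrite !lt_min.
move=> /andP[/andP[/andP[hd1 hd2] /andP[hd3 hd4]] /andP[hh0 /andP[hal hkm]]].
have hd h' : h < h' -> 0 < h < h' by move=> ?; rewrite hp.
have F1 := D1 h (hd _ hd1); have [S1 S2 S3] := D2 h (hd _ hd2).
have th0 : 0 <= t + h by rewrite addr_ge0 // ltW.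
have F3 := D3 (t + h) th0 ltac:(by rewrite addrAC subrr add0r gtr0_norm).
have S4 := D4 h (hd _ hd4).
have ah1 : al * h <= 1.
  by rewrite mulrC -ler_pdivlMr // mul1r ltW.
have km1 : kp * mu * h <= 1.
  by rewrite mulrC -ler_pdivlMr // mul1r ltW.
have ith := tr_itv tr th0.
pose y0 := `|i t - ifr|; have y00 : 0 <= y0 := normr_ge0 _.
pose e0 := `|et|; have e00 : 0 <= e0 := normr_ge0 _.
have e01 : e0 <= 1 by apply: le_trans er _; apply: le_trans r2 _; clear; lra.
pose n0 := N (i t) et; have n00 : 0 <= n0 := N0 _ _.
have en : e0 <= n0 := lyap_lower L _ _.
have Qe : `|Q (x t) - Q (Xi (i t))| <= CQ * e0.
  by have := pl_out pl itab e01; rewrite subrKC.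
have QG := pl_G pl ifrab itab; rewrite (distrC ifr) -/y0 in QG.
have wE : w = kp * (Q (Xi ifr) - Q (x t)) by rewrite /w kpE mulrC.
have wq : `|w| <= kp * (LG * y0 + CQ * e0).
  rewrite wE normrM gtr0_norm // ler_pM2l //.
  have -> : Q (Xi ifr) - Q (x t) =
    (Q (Xi ifr) - Q (Xi (i t))) - (Q (x t) - Q (Xi (i t))) by ring.
  by apply: le_trans (ler_normB _ _) _; apply: lerD.
have wpos : ifr < i t -> w <= kp * (CQ * e0 - mu * y0).
  move=> lt; rewrite wE ler_pM2l //.
  have := pl_mono pl ifrab itab (ltW lt).
  have -> : i t - ifr = y0 by rewrite /y0 gtr0_norm // subr_gt0.
  move: Qe => /ler_normlP[A1 A2]; move: A1; clear; move=> *; lra.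
have wneg : i t < ifr -> - w <= kp * (CQ * e0 - mu * y0).
  move=> lt; rewrite wE -mulrN ler_pM2l //.
  have := pl_mono pl itab ifrab (ltW lt).
  have -> : ifr - i t = y0 by rewrite /y0 distrC gtr0_norm // subr_gt0.
  move: Qe => /ler_normlP[A1 A2]; move: A2; clear; move=> *; lra.
have weq : i t = ifr -> kp * (LG * y0 + CQ * e0) <= kp * (CQ * e0).
  by move=> E; rewrite /y0 E subrr normr0 mulr0 add0r.
have WtE : W t = Num.max (gam * n0) y0 by [].
have nW : gam * n0 <= W t by rewrite WtE le_max lexx.
have yW : y0 <= W t by rewrite WtE le_max lexx orbT.
have CQn : CQ * e0 <= CQ * n0 by rewrite ler_wpM2l.
have Wt0 := W0 t t0.
rewrite /W /slow_fast_norm ge_max; apply/andP; split.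
- pose e' := x (t + h) - Xi (i (t + h)).
  have e'1 : `|e'| <= 1.
    rewrite -[e'](subrK et); apply: le_trans (ler_normD _ _) _.
    by apply: le_trans (lerD F3 (le_trans er r2)) _; clear; lra.
  have n2E : N (i (t + h)) e' <= N (i t) e' + c3 * `|i (t + h) - i t|.
    have /ler_normlP[_ H] := lyap_lip L (i (t + h)) (i t) e'.
    by rewrite -lerBlDl; apply: le_trans H _; rewrite ler_piMr // mulr_ge0.
  have n1E : N (i t) e' <= (1 - al * h) * n0 +
      c2 * (h * eps' + h * (C2 * e0 ^+ 2) + LX * `|i (t + h) - i t|).
    apply: le_trans (lyap_dist L (i t) e' (et + h *: (A (i t) *m et))) _.
    apply: lerD; first by apply: (lyap_euler L); rewrite ?itab // (ltW hp) ltW.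
    rewrite ler_wpM2l //.
    have -> : e' - (et + h *: (A (i t) *m et)) =
       (x (t + h) - x t - h *: f (i t) (x t)) +
       h *: (f (i t) (x t) - A (i t) *m et) - (Xi (i (t + h)) - Xi (i t)).
      exact: fast_error_split.
    apply: le_trans (ler_normB _ _) _; apply: lerD; last exact: (pl_Xi pl ith itab).
    apply: le_trans (ler_normD _ _) _; apply: lerD => //.
    rewrite norm_scale ?(ltW hp) // ler_wpM2l ?(ltW hp) //.
    by have := pl_lin pl itab e01; rewrite subrKC.
  have step := fast_step_bound (ltW hp) e00 en er c20 C20 LX0 c30 rC n2E n1E S1.
  have wn : `|w| <= kp * (LG * y0 + CQ * n0).
    by apply: le_trans wq _; rewrite ler_wpM2l ?(ltW kp0) // lerD2l.
  have bnd := fast_contract_bound (ltW hp) g0 B0 (ltW kp0) LG0 CQ0 n00 y00 ah1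
    (ltW al0) kpD wn step gce nW yW.
  apply: le_trans bnd _; rewrite lerD2r ler_wpM2r // lerD2l lerN2.
  by rewrite ler_wpM2r // ltW.
- have step := slow_step_bound hp (ltW kp0) wq weq wpos wneg S1 S2 S3 S4.
  have bnd := slow_contract_bound (ltW hp) g0 (ltW kp0) mu0 CQ0 y00 gCQ km1
    (le_trans step (slow_step_mono y0 mu (ltW hp) (ltW kp0) CQn epse)) nW yW.
  apply: le_trans bnd _; rewrite lerD2r ler_wpM2r // lerD2l lerN2.
  by rewrite ler_wpM2r // ltW.
Qed.

End SlowFast.

(** * Integral equations whose right-hand side may depend on the past *)

Section Volterra.
Variables (R : realType) (n : nat).
Notation mu := (@lebesgue_measure R).
Notation vec := 'cV[R]_n.+1.

Lemma ccont_coord (y : R -> vec) : ccont y -> forall j, ccont (fun t => y t j 0).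
Proof.
move=> cy j t t0 e e0; have [d d0 D] := cy t t0 e e0; exists d => // s s0 sd.
by have := coord_le_norm (y s - y t) j; rewrite !mxE => /le_trans; apply; apply: D.
Qed.

Lemma ccont_vec (y : R -> vec) : (forall j, ccont (fun t => y t j 0)) -> ccont y.
Proof.
move=> cy t t0 e e0.
have /choice[d Hd] : forall j, exists d, 0 < d /\ forall s : R, 0 <= s ->
    `|s - t| < d -> `|y s j 0 - y t j 0| <= e.
  by move=> j; have [d d0 D] := cy j t t0 e e0; exists d; split.
exists (\big[Num.min/1]_j d j).
  by apply: lt_bigmin => // j _; have [] := Hd j.
move=> s s0 sd; apply: norm_le_coord; first exact: ltW.
move=> j; rewrite !mxE; have [_ ] := Hd j; apply=> //.
by apply: lt_le_trans sd _; apply: bigmin_le_cond.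
Qed.

Lemma int_nil (g : R -> R) : \int[mu]_(s in `[0, 0]) g s = 0.
Proof. by rewrite set_itv1 Rintegral_set1. Qed.

Lemma int_near (g : R -> R) (t c e : R) : 0 <= t ->
  mu.-integrable `[0, t] (EFin \o g) ->
  (forall s, 0 < s <= t -> `|g s - c| <= e) ->
  `|\int[mu]_(s in `[0, t]) g s - t * c| <= t * e.
Proof.
move=> t0 ig H; have := @int_step_near R g 0 t c e (lexx 0) t0.
by rewrite add0r int_nil subr0; apply.
Qed.

Lemma int_dist (f g : R -> R) (t e : R) : 0 <= t -> ccont f -> ccont g ->
  (forall s, 0 <= s <= t -> `|f s - g s| <= e) ->
  `|\int[mu]_(s in `[0, t]) f s - \int[mu]_(s in `[0, t]) g s| <= t * e.
Proof.
move=> t0 cf cg H; rewrite -RintegralB //; try exact: ccont_integrable.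
have := @int_near (fun s => f s - g s) t 0 e t0; rewrite mulr0 subr0; apply.
  exact/ccont_integrable/ccont_sub.
by move=> s /andP[s0 st]; rewrite subr0 H // ltW.
Qed.

(* The constant 2, instead of 1, lets the Dini comparison go through. *)
Lemma int_exp_bound (g : R -> R) (a C : R) : 0 < a -> 0 <= C -> ccont g ->
  (forall s, 0 <= s -> `|g s| <= C * expR (a * s)) ->
  forall t, 0 <= t ->
    `|\int[mu]_(s in `[0, t]) g s| <= 2 * C / a * expR (a * t).
Proof.
move=> a0 C0 cg H.
have ig t : mu.-integrable `[0, t] (EFin \o g) by exact: ccont_integrable.
have cI : ccont (fun t => \int[mu]_(s in `[0, t]) g s) by exact: int_ccont.
have cnI : ccont (fun t => `|\int[mu]_(s in `[0, t]) g s|).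
  apply: (ccont_dom cI cI) => t t0; exists 1 => // s s0; rewrite mul1r.
  by apply: le_trans (ler_dist_dist _ _) _; rewrite lerDl.
apply: comparison => //; first exact: expR_ccont.
  by rewrite int_nil normr0 !mulr_ge0 ?invr_ge0 ?expR_ge0 // ltW.
move=> t t0 IH; exists a^-1; first by rewrite invr_gt0.
move=> h /andP[h0 ha].
have {}ha : a * h <= 1 by rewrite mulrC -ler_pdivlMr // mul1r ltW.
set E := expR (a * t) in IH *; have E0 : 0 < E := expR_gt0 _.
set F := expR (a * (t + h)).
have := @int_step_near R g t h 0 (C * F) t0 (ltW h0) (ig _).
rewrite mulr0 subr0 => S.
have {}S : `|\int[mu]_(s in `[0, t + h]) g s - \int[mu]_(s in `[0, t]) g s| <= h * (C * F).
  apply: S => s /andP[ts sth]; rewrite subr0; apply: le_trans (H s _) _; first lra.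
  by rewrite ler_wpM2l // ler_expR ler_pM2l.
have FE : F = E * expR (a * h) by rewrite /F mulrDr expRD.
have K : E * (1 + a * h) <= F by rewrite FE ler_pM2l // expR_ge1Dx.
have F0 : 0 < F := expR_gt0 _.
have K2 : a * h / 2 * F <= F - E.
  have : E * 2 <= (2 - a * h) * F.
    have p : 0 < 1 + a * h by have := mulr_gt0 a0 h0; lra.
    rewrite -(ler_pM2r p); apply: (@le_trans _ _ (2 * F)); first lra.
    rewrite mulrAC ler_pM2r //; have : a * h * (a * h) <= a * h * 1.
      by rewrite ler_wpM2l // mulr_ge0 // ltW.
    lra.
  lra.
have K3 : h * (C * F) <= 2 * C / a * (F - E).
  apply: (@le_trans _ _ (2 * C / a * (a * h / 2 * F))).
    by rewrite le_eqVlt; apply/orP; left; apply/eqP; field; rewrite gt_eqF.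
  by rewrite ler_wpM2l // divr_ge0 ?mulr_ge0 // ltW.
set x := \int[mu]_(s in `[0, t + h]) g s in S *.
set y := \int[mu]_(s in `[0, t]) g s in S IH *.
have := ler_normD (x - y) y; rewrite subrK.
by move: S IH K3; clear; move=> *; lra.
Qed.

Lemma half_pow_small (c e : R) : 0 <= c -> 0 < e ->
  exists k : nat, c * 2^-1 ^+ k <= e.
Proof.
move=> c0 e0; pose k := (Num.trunc (c / e)).+1.
have ck : c / e < k%:R by apply: truncnS_gt.
exists k; rewrite exprVn ler_pdivrMr ?exprn_gt0 //.
rewrite mulrC -ler_pdivrMr //; apply: le_trans (ltW ck) _.
by rewrite -natrX ler_nat ltnW // ltn_expl.
Qed.

(** The intervals of radius [2 * c * 2^-1 ^+ k] around [u k] are nested; the supremum of their left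
    ends lies in all of them, which gives the limit together with the rate. *)
Lemma geometric_limit (u : nat -> R) (c : R) :
  (forall k, `|u k.+1 - u k| <= c * 2^-1 ^+ k) ->
  exists l, forall k, `|u k - l| <= 2 * c * 2^-1 ^+ k.
Proof.
move=> H; pose lo k := u k - 2 * c * 2^-1 ^+ k; pose hi k := u k + 2 * c * 2^-1 ^+ k.
have c0 : 0 <= c by have := H 0%N; rewrite expr0 mulr1; apply: le_trans.
have p0 k : 0 <= 2 * c * 2^-1 ^+ k :> R by rewrite !mulr_ge0 // exprn_ge0 // invr_ge0.
have loS k : lo k <= lo k.+1.
  by rewrite /lo exprS; have /ler_normlP[] := H k; lra.
have hiS k : hi k.+1 <= hi k.
  by rewrite /hi exprS; have /ler_normlP[] := H k; lra.
have lom k m : lo k <= lo (k + m)%N.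
  by elim: m => [|m IH]; rewrite ?addn0 // addnS (le_trans IH).
have him k m : hi (k + m)%N <= hi k.
  by elim: m => [|m IH]; rewrite ?addn0 // addnS (le_trans _ IH).
have lohi k m : lo k <= hi m.
  apply: le_trans (lom k m) _; rewrite addnC; apply: le_trans (him m k).
  by rewrite /lo /hi; have := p0 (m + k)%N; lra.
have ub m : ubound (range lo) (hi m) by move=> _ [k _ <-].
exists (sup (range lo)) => k.
have l1 : lo k <= sup (range lo).
  by apply: ub_le_sup; [exists (hi 0%N)|exists k].
have l2 : sup (range lo) <= hi k by apply: ge_sup => //; exists (lo 0%N), 0%N.
by move: l1 l2; rewrite /lo /hi => *; apply/ler_normlP; split; lra.
Qed.

Definition primitive (y0 : vec) (g : R -> vec) (t : R) : vec :=
  \col_j (y0 j 0 + \int[mu]_(s in `[0, t]) g s j 0).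

Lemma primitive_ccont y0 g : ccont g -> ccont (primitive y0 g).
Proof.
move=> cg; apply: ccont_vec => j.
have cI : ccont (fun t => \int[mu]_(s in `[0, t]) g s j 0).
  by apply: int_ccont => t _; apply/ccont_integrable/ccont_coord.
apply: (ccont_dom cI cI) => t t0; exists 1 => // s s0; rewrite mul1r !mxE.
by rewrite opprD addrACA subrr add0r lerDl.
Qed.

(* Picard iteration in the weighted norm sup_t e^(-4Kt) |y t|. *)
Lemma volterra_exists (H : (R -> vec) -> R -> vec) (K M : R) (y0 : vec) :
  0 < K -> (forall y, ccont y -> ccont (H y)) ->
  (forall y1 y2, ccont y1 -> ccont y2 -> forall t D, 0 <= t ->
     (forall s, 0 <= s <= t -> `|y1 s - y2 s| <= D) ->
     `|H y1 t - H y2 t| <= K * D) ->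
  (forall t, 0 <= t -> `|H (fun=> y0) t| <= M) ->
  exists2 y, ccont y & forall t, 0 <= t -> y t = primitive y0 (H y) t.
Proof.
move=> K0 Hc HL HM.
pose Y k := iter k (fun y => primitive y0 (H y)) (fun=> y0).
have cY k : ccont (Y k).
  elim: k => [|k IH] /=; last exact/primitive_ccont/Hc.
  by move=> t t0 e e0; exists 1 => // s s0 _; rewrite subrr normr0 ltW.
have M0 : 0 <= M by apply: le_trans (HM 0 (lexx 0)).
(* [int_exp_bound] costs a factor [2 / a], so each Picard step contracts by [2 * K / a = 1 / 2]. *)
pose a := 4 * K; have a0 : 0 < a by rewrite mulr_gt0.
pose c := 2 * M / a; have c0 : 0 <= c by rewrite divr_ge0 ?mulr_ge0 // ltW.
have E1 t : 0 <= t -> 1 <= expR (a * t).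
  by move=> t0; rewrite -expR0 ler_expR mulr_ge0 // ltW.
have emono s t : s <= t -> expR (a * s) <= expR (a * t).
  by move=> st; rewrite ler_expR ler_pM2l.
have inc k : forall t, 0 <= t ->
    `|Y k.+1 t - Y k t| <= c * 2^-1 ^+ k * expR (a * t).
  elim: k => [|k IH] t t0.
    rewrite expr0 mulr1; apply: norm_le_coord.
      by rewrite mulr_ge0 ?expR_ge0.
    move=> j; rewrite !mxE addrAC subrr add0r.
    apply: int_exp_bound => //; first exact/ccont_coord/Hc/(cY 0%N).
    move=> s s0; apply: le_trans (coord_le_norm _ _) _; apply: le_trans (HM s s0) _.
    by rewrite ler_peMr // E1.
  have b0 : 0 <= c * 2^-1 ^+ k by rewrite mulr_ge0 // exprn_ge0 // invr_ge0.
  apply: norm_le_coord.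
    by rewrite mulr_ge0 ?expR_ge0 // exprS mulrCA mulr_ge0 // invr_ge0.
  move=> j; rewrite /= !mxE opprD addrACA subrr add0r.
  have cc m : ccont (fun s => H (Y m) s j 0) by exact/ccont_coord/Hc/cY.
  have icc m : mu.-integrable `[0, t] (EFin \o (fun s => H (Y m) s j 0)).
    exact/ccont_integrable/cc.
  rewrite -RintegralB //;  last exact: (icc k.+1).
  have -> : c * 2^-1 ^+ k.+1 = 2 * (K * (c * 2^-1 ^+ k)) / a.
    by rewrite exprS /a; field; rewrite gt_eqF.
  apply: int_exp_bound => //; first by rewrite mulr_ge0 // ltW.
    exact: ccont_sub (cc k.+1) (cc k).
  move=> s s0; have := coord_le_norm (H (Y k.+1) s - H (Y k) s) j.
  rewrite !mxE => /le_trans; apply; rewrite -mulrA; apply: HL => //.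
  move=> u /andP[u0 us]; apply: le_trans (IH u u0) _.
  by rewrite ler_wpM2l // emono.
clearbody c.
(* Claimed for [0 <= t] only, so that [choice] gives a total path, unspecified at negative times. *)
have Hex : forall t : R, exists v : vec, 0 <= t -> forall k,
    `|Y k t - v| <= 2 * (c * expR (a * t)) * 2^-1 ^+ k.
  move=> t; case: (leP 0 t) => [t0|t0]; last by exists 0 => t0'; lra.
  have /choice[l Hl] : forall j, exists l, forall k,
      `|Y k t j 0 - l| <= 2 * (c * expR (a * t)) * 2^-1 ^+ k.
    move=> j; apply: geometric_limit => k.
    have := coord_le_norm (Y k.+1 t - Y k t) j; rewrite !mxE => /le_trans; apply.
    by rewrite mulrAC; apply: inc.
  exists (\col_j l j) => _ k; apply: norm_le_coord.
    by rewrite !mulr_ge0 ?expR_ge0 ?exprn_ge0 // invr_ge0.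
  by move=> j; rewrite !mxE.
have [y Hy] := choice Hex.
have cy : ccont y.
  move=> t t0 e e0.
  have [k Hk] := @half_pow_small (2 * (c * expR (a * (t + 1)))) (e / 3)
    ltac:(by rewrite !mulr_ge0 ?expR_ge0) ltac:(by rewrite divr_gt0).
  have near s : 0 <= s -> s <= t + 1 -> `|Y k s - y s| <= e / 3.
    move=> s0 st; apply: le_trans (Hy s s0 k) _; apply: le_trans Hk.
    by rewrite ler_wpM2r ?exprn_ge0 ?invr_ge0 // ler_wpM2l // ler_wpM2l // emono.
  have [d d0 Hd] := cY k t t0 (e / 3) ltac:(by rewrite divr_gt0).
  exists (Num.min d 1); first by rewrite lt_min d0 ltr01.
  move=> s s0; rewrite lt_min => /andP[sd s1].
  have st : s <= t + 1 by move: s1 => /ltr_normlP[]; lra.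
  have N1 := near s s0 st; have N2 := near t t0 ltac:(lra).
  have N3 := Hd s s0 sd.
  rewrite -[y s - y t](subrK (Y k t - y t)); set p := Y k t - y t in N2 *.
  have -> : y s - y t - p = (Y k s - Y k t) - (Y k s - y s).
    by rewrite /p !opprB addrA subrK [RHS]addrC !addrA subrK.
  apply: le_trans (ler_normD _ _) _.
  apply: le_trans (lerD (ler_normB _ _) (lexx _)) _.
  apply: le_trans (lerD (lerD N3 N1) N2) _; clear; lra.
exists y => // t t0; apply/matrixP => j l; rewrite (ord1 l) mxE {l}.
have cH z : ccont z -> ccont (fun s => H z s j 0) by move=> cz; exact/ccont_coord/Hc.
apply/eqP; rewrite -subr_eq0 -normr_eq0 eq_le normr_ge0 andbT.
apply/ler_addgt0Pr => e e0; rewrite add0r.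
pose C := 2 * (c * expR (a * t)).
have C0 : 0 <= C by rewrite !mulr_ge0 ?expR_ge0.
have [k Hk] := @half_pow_small (C + t * (K * C)) e
  ltac:(by rewrite addr_ge0 // !mulr_ge0 // ltW) e0.
have q0 : 0 <= 2^-1 ^+ k :> R by rewrite exprn_ge0 // invr_ge0.
have A1 : `|Y k.+1 t j 0 - y t j 0| <= C * 2^-1 ^+ k.
  have := coord_le_norm (Y k.+1 t - y t) j; rewrite !mxE => /le_trans; apply.
  apply: le_trans (Hy t t0 k.+1) _; rewrite ler_wpM2l // exprS.
  by rewrite ler_piMl //; lra.
have A2 : `|Y k.+1 t j 0 - (y0 j 0 + \int[mu]_(s in `[0, t]) H y s j 0)|
    <= t * (K * (C * 2^-1 ^+ k)).
  rewrite /= mxE opprD addrACA subrr add0r; apply: int_dist => //;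
    [exact/cH/cY|exact: cH|].
  move=> s /andP[s0 st]; have := coord_le_norm (H (Y k) s - H y s) j.
  rewrite !mxE => /le_trans; apply; apply: HL => // u /andP[u0 us].
  apply: le_trans (Hy u u0 k) _; rewrite ler_wpM2r // ler_wpM2l // ler_wpM2l //.
  by rewrite emono // (le_trans us).
apply: le_trans Hk; rewrite distrC in A1.
set z := Y k.+1 t j 0 in A1 A2.
have -> : y t j 0 - (y0 j 0 + \int[mu]_(s in `[0, t]) H y s j 0) =
  (y t j 0 - z) + (z - (y0 j 0 + \int[mu]_(s in `[0, t]) H y s j 0)).
  by rewrite addrA subrK.
apply: le_trans (ler_normD _ _) _; apply: le_trans (lerD A1 A2) _.
by rewrite mulrDl -!mulrA.
Qed.

End Volterra.

(** * The two-sided Skorokhod reflection *)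

Section Skorokhod.
Variable R : realType.
Implicit Types (psi : R -> R) (a t s h x D : R).

(** The numbers below one of the competitors in the formula for [skor]: the first alternative is
    [min(0, inf_[0,t] psi)], the second [min(psi s - a, inf_[s,t] psi)] for some [s]. Infima become
    universal statements, so a single supremum remains. *)
Definition skor_set psi a t : set R := [set x |
  (x <= 0 /\ forall u, 0 <= u <= t -> x <= psi u) \/
  exists2 s, 0 <= s <= t &
    x <= psi s - a /\ forall u, s <= u <= t -> x <= psi u].

(* The regulator of the two-sided Skorokhod reflection: [psi - skor psi a] is
   the path [psi] reflected at the ends of [0, a].  This is the formula
     max(min(0, inf_[0,t] psi), sup_(s <= t) min(psi s - a, inf_[s,t] psi))
   of Kruk, Lehoczky, Ramanan and Shreve, written as a single supremum. *)
Definition skor psi a t : R := sup (skor_set psi a t).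

Lemma skor_set_le psi a t x : 0 <= t -> skor_set psi a t x -> x <= psi t.
Proof.
move=> t0 [[_]|[s /andP[s0 st] [_]]]; first by apply; rewrite t0 lexx.
by apply; rewrite st lexx.
Qed.

Lemma skor_set_top psi a t : 0 <= t -> 0 <= a -> skor_set psi a t (psi t - a).
Proof.
move=> t0 a0; right; exists t; first by rewrite t0 lexx.
split=> // u /andP[tu ut]; have -> : u = t by apply/eqP; rewrite eq_le tu ut.
by rewrite lerBlDr lerDl.
Qed.

Lemma skor_ge psi a t x : 0 <= t -> skor_set psi a t x -> x <= skor psi a t.
Proof.
by move=> t0 Ex; apply: ub_le_sup => //; exists (psi t) => y; apply: skor_set_le.
Qed.

Lemma skor_le psi a t x : 0 <= t -> 0 <= a ->
  (forall y, skor_set psi a t y -> y <= x) -> skor psi a t <= x.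
Proof.
by move=> t0 a0 H; apply: ge_sup => //; exists (psi t - a); apply: skor_set_top.
Qed.

Lemma skor_itv psi a t : 0 <= t -> 0 <= a ->
  psi t - a <= skor psi a t <= psi t.
Proof.
move=> t0 a0; apply/andP; split; first by apply: skor_ge => //; apply: skor_set_top.
by apply: skor_le => // y; apply: skor_set_le.
Qed.

Lemma skor_gt psi a t x : 0 <= t -> 0 <= a -> x < skor psi a t ->
  exists2 y, skor_set psi a t y & x < y.
Proof.
by move=> t0 a0; apply: sup_gt; exists (psi t - a); apply: skor_set_top.
Qed.

(** If [psi1 <= psi2 + D], then lowering a member of the set of [psi1] by [D] gives a member of the
    set of [psi2]. *)
Lemma skor_lip psi1 psi2 a t D : 0 <= t -> 0 <= a ->
  (forall u, 0 <= u <= t -> `|psi1 u - psi2 u| <= D) ->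
  `|skor psi1 a t - skor psi2 a t| <= D.
Proof.
move=> t0 a0 H.
have half p1 p2 : (forall u, 0 <= u <= t -> p1 u <= p2 u + D) -> 0 <= D ->
    skor p1 a t <= skor p2 a t + D.
  move=> Hp D0; apply: skor_le => // y Ey; rewrite -lerBlDr; apply: skor_ge => //.
  case: Ey => [[y0 Hy]|[s /andP[s0 st] [ys Hy]]].
    left; split; first by lra.
    by move=> u ut; have := Hy u ut; have := Hp u ut; lra.
  right; exists s; rewrite ?s0 //; split; first by have := Hp s; rewrite s0 st => /(_ isT); lra.
  move=> u /andP[su ut]; have := Hy u; rewrite su ut => /(_ isT).
  by have := Hp u; rewrite (le_trans s0 su) ut => /(_ isT); lra.
have D0 : 0 <= D by apply: le_trans (H 0 _); rewrite ?lexx.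
have A := half psi1 psi2 _ D0; have B := half psi2 psi1 _ D0.
apply/ler_normlP; split.
  have : skor psi2 a t <= skor psi1 a t + D; last by lra.
  by apply: B => u /H /ler_normlP[]; lra.
have : skor psi1 a t <= skor psi2 a t + D; last by lra.
by apply: A => u /H /ler_normlP[]; lra.
Qed.

Lemma skor_time psi a t t' D : 0 <= t -> 0 <= a -> t <= t' ->
  (forall u, t <= u <= t' -> `|psi u - psi t| <= D) ->
  `|skor psi a t' - skor psi a t| <= D.
Proof.
move=> t0 a0 tt' H; have t'0 := le_trans t0 tt'.
have D0 : 0 <= D by apply: le_trans (H t _); rewrite ?lexx.
have Hu u : t <= u -> u <= t' -> psi t - D <= psi u <= psi t + D.
  move=> tu ut; have := H u; rewrite tu ut => /(_ isT) /ler_normlP[].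
  by move=> *; apply/andP; split; lra.
apply/ler_normlP; split; last first.
  rewrite lerBlDr; apply: skor_le => // y Ey.
  have [yt|ty] := leP y (psi t - a + D).
    have /andP[+ _] := skor_itv psi t0 a0; lra.
  suff : y <= skor psi a t by lra.
  apply: skor_ge => //; case: Ey => [[y0 Hy]|[s /andP[s0 st] [ys Hy]]].
    by left; split=> // u /andP[u0 ut]; apply: Hy; rewrite u0 (le_trans ut).
  have [ts|ts] := leP s t.
    right; exists s; rewrite ?s0 //; split=> // u /andP[su ut].
    by apply: Hy; rewrite su (le_trans ut).
  by have /andP[_] := Hu s (ltW ts) st; lra.
rewrite opprB lerBlDr; apply: skor_le => // y Ey.
have yt := skor_set_le t0 Ey.
rewrite -lerBlDl; apply: skor_ge => //.
case: Ey => [[y0 Hy]|[s /andP[s0 st] [ys Hy]]].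
  left; split; first lra.
  move=> u /andP[u0 ut]; have [ut'|tu] := leP u t.
    by have := Hy u; rewrite u0 ut' => /(_ isT); lra.
  by have /andP[] := Hu u (ltW tu) ut; lra.
right; exists s; first by rewrite s0 (le_trans st).
split; first lra.
move=> u /andP[su ut]; have [ut'|tu] := leP u t.
  by have := Hy u; rewrite su ut' => /(_ isT); lra.
by have /andP[] := Hu u (ltW tu) ut; lra.
Qed.

(** The regulator does not move as long as the path, with the regulator frozen, stays between the
    barriers. *)
Lemma skor_const psi a t t' : 0 <= t -> 0 <= a -> t <= t' ->
  (forall u, t <= u <= t' -> psi u - a <= skor psi a t <= psi u) ->
  skor psi a t' = skor psi a t.
Proof.
move=> t0 a0 tt' H; have t'0 := le_trans t0 tt'.
apply/eqP; rewrite eq_le; apply/andP; split.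
  apply: skor_le => // y [[y0 Hy]|[s /andP[s0 st] [ys Hy]]].
    apply: skor_ge => //; left; split=> // u /andP[u0 ut].
    by apply: Hy; rewrite u0 (le_trans ut).
  have [ts|ts] := leP s t.
    apply: skor_ge => //; right; exists s; rewrite ?s0 //; split=> // u /andP[su ut].
    by apply: Hy; rewrite su (le_trans ut).
  by apply: le_trans ys _; have := H s; rewrite (ltW ts) st => /(_ isT) /andP[].
apply: skor_le => // y Ey; have yS := skor_ge t0 Ey; apply: skor_ge => //.
case: Ey => [[y0 Hy]|[s /andP[s0 st] [ys Hy]]].
  left; split=> // u /andP[u0 ut]; have [ut'|tu] := leP u t.
    by apply: Hy; rewrite u0.
  by apply: le_trans yS _; have := H u; rewrite (ltW tu) ut => /(_ isT) /andP[].
right; exists s; first by rewrite s0 (le_trans st).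
split=> // u /andP[su ut]; have [ut'|tu] := leP u t.
  by apply: Hy; rewrite su.
by apply: le_trans yS _; have := H u; rewrite (ltW tu) ut => /(_ isT) /andP[].
Qed.

Lemma skor0 psi a : 0 <= psi 0 <= a -> skor psi a 0 = 0.
Proof.
move=> /andP[p0 pa]; have a0 := le_trans p0 pa.
apply/eqP; rewrite eq_le; apply/andP; split.
  apply: skor_le => // y [[//]|[s /andP[s0 s0'] [ys _]]].
  have E : s = 0 by apply/eqP; rewrite eq_le s0 s0'.
  by move: ys; rewrite E; lra.
apply: skor_ge => //; left; split=> // u /andP[u0 u0'].
by have -> : u = 0 by apply/eqP; rewrite eq_le u0 u0'.
Qed.

(** A member of the set close to [psi t] would have to lie below all values of [psi] on [t - h, t],
    or else start from some [psi s - a] with [s] in that interval; both are too low. *)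
Lemma skor_contact_low psi a t h : 0 < a -> 0 < h <= t ->
  (forall u, t - h <= u < t -> psi u < psi t) -> skor psi a t < psi t.
Proof.
move=> a0 /andP[h0 ht] H; have t0 : 0 <= t by lra.
rewrite ltNge; apply/negP => Hk.
have m : Num.max (psi t - a) (psi (t - h)) < skor psi a t.
  apply: lt_le_trans Hk; rewrite gt_max; apply/andP; split; first lra.
  by apply: H; lra.
have [y Ey] := skor_gt t0 (ltW a0) m; rewrite gt_max => /andP[y1 y2].
have nh : ~ (forall u, t - h <= u <= t -> y <= psi u).
  by move=> /(_ (t - h)); rewrite lexx /=; lra.
case: Ey => [[_ Hy]|[s /andP[s0 st] [ys Hy]]].
  by apply: nh => u /andP[u1 u2]; apply: Hy; apply/andP; split; lra.
have [sh|hs] := leP s (t - h).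
  by apply: nh => u /andP[u1 u2]; apply: Hy; apply/andP; split; lra.
have : psi s <= psi t.
  by move: st; rewrite le_eqVlt => /predU1P[-> //|st]; apply/ltW/H; lra.
lra.
Qed.

Lemma skor_contact_high psi a t h : 0 < a -> 0 < h <= t ->
  (forall u, t - h <= u < t -> psi t < psi u) -> psi t - a < skor psi a t.
Proof.
move=> a0 /andP[h0 ht] H; have t0 : 0 <= t by lra.
pose x := Num.min (psi (t - h) - a) (psi t).
have x1 : psi t - a < x.
  rewrite lt_min; apply/andP; split; last lra.
  by have := H (t - h); rewrite lexx /=; lra.
apply: lt_le_trans x1 _; apply: skor_ge => //; right; exists (t - h).
  by apply/andP; split; lra.
split; first by rewrite ge_min lexx.
move=> u /andP[u1 u2]; apply: (@le_trans _ _ (psi t)); first by rewrite ge_min lexx orbT.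
by move: u2; rewrite le_eqVlt => /predU1P[-> //|u2]; apply/ltW/H; rewrite u1.
Qed.

Lemma skor_ccont psi a : 0 <= a -> ccont psi -> ccont (skor psi a).
Proof.
move=> a0 cp t t0 e e0; have [d d0 D] := cp t t0 (e / 2) ltac:(lra).
exists d => // s s0 sd.
have near u v : 0 <= u -> 0 <= v -> `|u - t| < d -> `|v - t| < d ->
    `|psi u - psi v| <= e.
  move=> u0 v0 ud vd; have -> : psi u - psi v = (psi u - psi t) - (psi v - psi t) by ring.
  apply: le_trans (ler_normB _ _) _; have := D u u0 ud; have := D v v0 vd; lra.
have t_t : `|t - t| < d by rewrite subrr normr0.
have [ts|st] := leP t s.
  apply: skor_time => // u /andP[tu us]; apply: near => //; first exact: le_trans tu.
  by rewrite ger0_norm ?subr_ge0 //; move: sd; rewrite ger0_norm ?subr_ge0 //; lra.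
rewrite distrC; apply: skor_time => //; first exact: ltW.
move=> u /andP[su ut]; apply: near => //; first exact: le_trans su.
by move: sd => /ltr_normlP[] *; apply/ltr_normlP; split; lra.
Qed.

End Skorokhod.

(** * The reflected path solves the saturated integrator *)

Section SaturatedIntegrator.
Variable R : realType.
Notation mu := (@lebesgue_measure R).
Variables lo hi : R.
Hypothesis lohi : lo < hi.

Let a := hi - lo.
Let a0 : 0 < a. Proof. by rewrite subr_gt0. Qed.

Definition reflect_path (u : R -> R) (t : R) : R :=
  u t - skor (fun s => u s - lo) (hi - lo) t.

Lemma reflect_path_itv u t : 0 <= t -> lo <= reflect_path u t <= hi.
Proof.
move=> t0; have /andP[] := skor_itv (fun s => u s - lo) t0 (ltW a0).
by rewrite /reflect_path /a => *; apply/andP; split; lra.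
Qed.

Lemma reflect_path_lip u v t D : 0 <= t ->
  (forall s, 0 <= s <= t -> `|u s - v s| <= D) ->
  `|reflect_path u t - reflect_path v t| <= 2 * D.
Proof.
move=> t0 H; have /ler_normlP[A1 A2] : `|skor (fun s => u s - lo) (hi - lo) t -
    skor (fun s => v s - lo) (hi - lo) t| <= D.
  apply: skor_lip => //; first exact: ltW.
  by move=> s st; (have -> : u s - lo - (v s - lo) = u s - v s by ring); apply: H.
have := H t; rewrite t0 lexx => /(_ isT) /ler_normlP[B1 B2].
by apply/ler_normlP; rewrite /reflect_path; split; lra.
Qed.

Lemma reflect_path_ccont u : ccont u -> ccont (reflect_path u).
Proof.
move=> cu; apply: ccont_sub => //; apply: skor_ccont; first exact: ltW.
exact/ccont_sub/ccont_cst.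
Qed.

(** The affine map of [lo, hi] onto [-1, 1]; its even powers equal 1 exactly at the two limits. *)
Definition centered (y : R) : R := (2 * y - lo - hi) / a.

Lemma centered_itv y : lo <= y <= hi -> `|centered y| <= 1.
Proof.
move=> /andP[y1 y2]; apply/ler_normlP; rewrite /centered; split.
  by rewrite -mulNr ler_pdivrMr // mul1r /a; lra.
by rewrite ler_pdivrMr // mul1r /a; lra.
Qed.

Lemma centered_interior y : lo < y < hi -> `|centered y| < 1.
Proof.
move=> /andP[y1 y2]; apply/ltr_normlP; rewrite /centered; split.
  by rewrite -mulNr ltr_pdivrMr // mul1r /a; lra.
by rewrite ltr_pdivrMr // mul1r /a; lra.
Qed.

Lemma centered_boundary y :
  lo <= y <= hi -> ~~ (lo < y < hi) -> centered y ^+ 2 = 1.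
Proof.
move=> /andP[l1 l2]; rewrite negb_and -!leNgt => yb.
have [->|->] : y = lo \/ y = hi.
    by case/orP: yb => ?; [left|right]; apply/eqP; rewrite eq_le ?l1 ?l2 ?andbT.
  rewrite /centered; have -> : 2 * lo - lo - hi = - a by rewrite /a; ring.
  by rewrite mulNr divff ?gt_eqF // sqrrN expr1n.
rewrite /centered; have -> : 2 * hi - lo - hi = a by rewrite /a; ring.
by rewrite divff ?gt_eqF // expr1n.
Qed.

(** Taylor expansion of a power with a crude remainder, by induction on the exponent. *)
Lemma pow_second_order (m : nat) (y z : R) : `|y| <= 1 -> `|z| <= 1 ->
  `|z ^+ m.+1 - y ^+ m.+1 - m.+1%:R * y ^+ m * (z - y)| <=
  m.+1%:R ^+ 2 * (z - y) ^+ 2.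
Proof.
move=> y1 z1; elim: m => [|m IH].
  rewrite !expr1 expr0 mulr1 mul1r subrr normr0 mulr_ge0 ?sqr_ge0 //.
have -> : z ^+ m.+2 - y ^+ m.+2 - m.+2%:R * y ^+ m.+1 * (z - y) =
   z * (z ^+ m.+1 - y ^+ m.+1 - m.+1%:R * y ^+ m * (z - y)) +
   m.+1%:R * y ^+ m * (z - y) ^+ 2.
  by rewrite [in m.+2%:R]mulrSr !exprS; ring.
apply: le_trans (ler_normD _ _) _.
have s0 : 0 <= (z - y) ^+ 2 by apply: sqr_ge0.
have A : `|z * (z ^+ m.+1 - y ^+ m.+1 - m.+1%:R * y ^+ m * (z - y))| <=
    m.+1%:R ^+ 2 * (z - y) ^+ 2.
  by rewrite normrM; apply: le_trans IH; rewrite ler_piMl.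
have B : `|m.+1%:R * y ^+ m * (z - y) ^+ 2| <= m.+1%:R * (z - y) ^+ 2.
  rewrite normrM (ger0_norm s0) ler_wpM2r // normrM ger0_norm // ler_piMr //.
  by rewrite normrX exprn_ile1.
apply: le_trans (lerD A B) _; rewrite -mulrDl ler_wpM2r //.
rewrite [m.+2%:R]mulrSr; have : 0 <= m.+1%:R :> R by [].
by move: m.+1%:R => p p0; have := sqr_ge0 p; lra.
Qed.

(* An antiderivative of [1 - centered ^ (2k)], which vanishes at [lo] and [hi]
   and tends to 1 in between; so [cutoff k] composed with a reflected path is
   differentiable from the right even where the path touches the boundary. *)
Definition cutoff (k : nat) (y : R) : R :=
  y - a / 2 / (2 * k).+1%:R * centered y ^+ (2 * k).+1.

Lemma cutoff_second_order k y z : lo <= y <= hi -> lo <= z <= hi ->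
  `|cutoff k z - cutoff k y - (1 - centered y ^+ (2 * k)) * (z - y)| <=
  2 / a * (2 * k).+1%:R * (z - y) ^+ 2.
Proof.
move=> yi zi; have n0 : 0 < (2 * k).+1%:R :> R by [].
set m := (2 * k)%N in n0 *.
have H := pow_second_order m (centered_itv yi) (centered_itv zi).
have E : centered z - centered y = 2 / a * (z - y).
  by rewrite /centered; field; rewrite gt_eqF.
have -> : cutoff k z - cutoff k y - (1 - centered y ^+ m) * (z - y) =
   - (a / 2 / m.+1%:R) * (centered z ^+ m.+1 - centered y ^+ m.+1 -
      m.+1%:R * centered y ^+ m * (centered z - centered y)).
  rewrite E /cutoff -/m; field.
  by rewrite (gt_eqF a0) /= nat1r gt_eqF.
have c0 : 0 < a / 2 / m.+1%:R by rewrite !divr_gt0.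
rewrite normrM normrN (gtr0_norm c0).
apply: (@le_trans _ _ (a / 2 / m.+1%:R * (m.+1%:R ^+ 2 * (centered z - centered y) ^+ 2))).
  by rewrite ler_pM2l.
rewrite E le_eqVlt; apply/orP; left; apply/eqP; field.
by rewrite (gt_eqF a0) /= nat1r gt_eqF.
Qed.

Lemma cutoff_near k y : lo <= y <= hi -> `|cutoff k y - y| <= a / k.+1%:R.
Proof.
move=> yi; rewrite /cutoff addrAC subrr add0r normrN normrM.
have n0 : 0 < (2 * k).+1%:R :> R by [].
have k0 : 0 < k.+1%:R :> R by [].
have c0 : 0 < a / 2 / (2 * k).+1%:R by rewrite !divr_gt0.
rewrite (gtr0_norm c0).
apply: (@le_trans _ _ (a / 2 / (2 * k).+1%:R * 1)).
  by rewrite ler_pM2l // normrX exprn_ile1 // centered_itv.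
rewrite mulr1 -mulrA ler_pM2l // -invfM lef_pV2 ?posrE ?mulr_gt0 //.
rewrite !mulrSr natrM; have : 0 <= k%:R :> R by [].
by move: k%:R => p; lra.
Qed.

Section Path.
Variables (i0 : R) (w u : R -> R).
Hypothesis i0_itv : lo <= i0 <= hi.
Hypothesis cw : ccont w.
Hypothesis uE : forall t, 0 <= t -> u t = i0 + \int[mu]_(s in `[0, t]) w s.

Let i := reflect_path u.
Let psi := fun s => u s - lo.

Let cu : ccont u.
Proof.
have cI : ccont (fun t => \int[mu]_(s in `[0, t]) w s).
  by apply: int_ccont => t _; exact: ccont_integrable.
apply: (ccont_dom cI cI) => t t0; exists 1 => // s s0.
by rewrite mul1r !uE // opprD addrACA subrr add0r lerDl.
Qed.

Let ci : ccont i := reflect_path_ccont cu.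
Let iab t : 0 <= t -> lo <= i t <= hi := @reflect_path_itv u t.
Let iE t : i t = lo + (psi t - skor psi a t).
Proof. by rewrite /i /reflect_path /psi /a; ring. Qed.

Lemma reflect_path0 : i 0 = i0.
Proof.
have u0 : u 0 = i0 by rewrite uE // int_nil addr0.
rewrite iE skor0 /psi u0; first by ring.
by move: i0_itv => /andP[*]; apply/andP; split; rewrite /a; lra.
Qed.

Let psi_step t h : 0 <= t -> 0 <= h ->
  psi (t + h) - psi t =
  \int[mu]_(s in `[0, t + h]) w s - \int[mu]_(s in `[0, t]) w s.
Proof. by move=> t0 h0; rewrite /psi !uE ?addr_ge0 //; ring. Qed.

Let psi_near t e : 0 <= t -> 0 < e -> exists2 d, 0 < d &
  forall h, 0 <= h < d -> `|psi (t + h) - psi t - h * w t| <= h * e.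
Proof.
move=> t0 e0; have [d d0 D] := cw t0 e0; exists d => // h /andP[h0 hd].
rewrite psi_step //; apply: int_step_near => //; first exact: ccont_integrable.
move=> s /andP[ts sth]; apply: D; first lra.
by rewrite gtr0_norm ?subr_gt0 //; lra.
Qed.

Let psi_rise t s : 0 <= t -> t <= s -> forall c,
  (forall v, t < v <= s -> c <= w v) -> (s - t) * c <= psi s - psi t.
Proof.
move=> t0 ts c H; rewrite -{2}(subrKC t s) psi_step ?subr_ge0 //.
apply: int_step_ge => //; rewrite ?subr_ge0 //; first exact: ccont_integrable.
by rewrite subrKC.
Qed.

Let psi_fall t s : 0 <= t -> t <= s -> forall c,
  (forall v, t < v <= s -> w v <= c) -> psi s - psi t <= (s - t) * c.
Proof.
move=> t0 ts c H; rewrite -{1}(subrKC t s) psi_step ?subr_ge0 //.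
apply: int_step_le => //; rewrite ?subr_ge0 //; first exact: ccont_integrable.
by rewrite subrKC.
Qed.

(** A positive drive at [t] makes [u] rise strictly up to [t], which would have lifted the path off
    the lower limit; [0 < t] provides the past needed for this. *)
Lemma contact_low t : 0 < t -> i t <= lo -> w t <= 0.
Proof.
move=> t0; rewrite iE => Hi; rewrite leNgt; apply/negP => wt.
have [d d0 D] := cw (ltW t0) (divr_gt0 wt (ltr0n _ 2)).
pose h := Num.min t d.
have h0 : 0 < h by rewrite lt_min t0.
have ht : h <= t by rewrite ge_min lexx.
have hd : h <= d by rewrite ge_min lexx orbT.
suff : skor psi a t < psi t by lra.
apply: (@skor_contact_low _ psi a t h) => //; first by rewrite h0.
move=> v /andP[v1 v2]; rewrite -subr_gt0.
have v0 : 0 <= v by lra.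
have : (t - v) * (w t / 2) <= psi t - psi v.
  apply: psi_rise => //; first exact: ltW.
  move=> s /andP[vs st]; have s0 : 0 <= s by lra.
  have sd : `|s - t| < d by rewrite distrC ger0_norm ?subr_ge0 //; lra.
  by have /ler_normlP[] := D s s0 sd; lra.
by apply: lt_le_trans; rewrite mulr_gt0 ?subr_gt0 ?divr_gt0.
Qed.

Lemma contact_high t : 0 < t -> hi <= i t -> 0 <= w t.
Proof.
move=> t0; rewrite iE => Hi; rewrite leNgt; apply/negP => wt.
have wt' : 0 < - w t / 2 by lra.
have [d d0 D] := cw (ltW t0) wt'.
pose h := Num.min t d.
have h0 : 0 < h by rewrite lt_min t0.
have ht : h <= t by rewrite ge_min lexx.
have hd : h <= d by rewrite ge_min lexx orbT.
suff : psi t - a < skor psi a t by rewrite /a; lra.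
apply: (@skor_contact_high _ psi a t h) => //; first by rewrite h0.
move=> v /andP[v1 v2]; rewrite -subr_lt0.
have v0 : 0 <= v by lra.
have : psi t - psi v <= (t - v) * (w t / 2).
  apply: psi_fall => //; first exact: ltW.
  move=> s /andP[vs st]; have s0 : 0 <= s by lra.
  have sd : `|s - t| < d by rewrite distrC ger0_norm ?subr_ge0 //; lra.
  by have /ler_normlP[] := D s s0 sd; lra.
by move=> /le_lt_trans; apply; rewrite pmulr_rlt0 ?subr_gt0 //; lra.
Qed.

(** At a limit only the size of the increment is controlled, through the oscillation of [psi]; in
    the interior the regulator is locally constant and the increment follows the drive. *)
Let small_step t e : 0 <= t -> 0 < e -> exists2 d, 0 < d & forall h,
  0 < h < d ->
  `|i (t + h) - i t| <= 2 * h * (`|w t| + e) /\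
  (lo < i t < hi -> `|i (t + h) - i t - h * w t| <= h * e).
Proof.
move=> t0 e0; have [d1 d10 D1] := psi_near t0 e0.
have a0' := ltW a0.
have osc h : 0 < h < d1 -> forall v, t <= v <= t + h ->
    `|psi v - psi t| <= h * (`|w t| + e).
  move=> /andP[h0 hd] v /andP[tv vh]; have := D1 (v - t).
  rewrite subrKC => /(_ ltac:(apply/andP; split; lra)) A.
  rewrite -(subrK ((v - t) * w t) (psi v - psi t)).
  apply: le_trans (ler_normD _ _) _; apply: (@le_trans _ _ ((v - t) * (`|w t| + e))).
    rewrite mulrDr addrC lerD // normrM ger0_norm // subr_ge0 //.
  by rewrite ler_wpM2r ?addr_ge0 ?(ltW e0) //; lra.
have gap : exists2 d2, 0 < d2 & forall h, 0 < h < d2 -> lo < i t < hi ->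
    skor psi a (t + h) = skor psi a t.
  have [/andP[i1 i2]|Ni] := boolP (lo < i t < hi); last by exists 1.
  have g0 : 0 < Num.min (i t - lo) (hi - i t) by rewrite lt_min !subr_gt0 i1.
  have [d d0 D] := @ccont_sub _ _ _ _ cu (ccont_cst lo) t t0 _ g0.
  exists d => // h /andP[h0 hd] _; apply: skor_const => //; first lra.
  move=> v /andP[tv vh]; have vd : `|v - t| < d.
    by rewrite ger0_norm ?subr_ge0 //; lra.
  have := D v (le_trans t0 tv) vd; rewrite -/(psi v) -/(psi t).
  rewrite le_min => /andP[/ler_normlP[A1 A2] /ler_normlP[B1 B2]].
  move: A1 A2 B1 B2; rewrite iE /a; move: (skor _ _ _) => *.
  by apply/andP; split; lra.
have [d2 d20 D2] := gap.
exists (Num.min d1 d2); first by rewrite lt_min d10.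
move=> h /andP[h0]; rewrite lt_min => /andP[hd1 hd2].
have hd1' : 0 < h < d1 by rewrite h0.
have O := osc h hd1'; split.
  have S : `|skor psi a (t + h) - skor psi a t| <= h * (`|w t| + e).
    by apply: skor_time => //; lra.
  have := O (t + h); rewrite lexx andbT lerDl (ltW h0) => /(_ isT) P.
  rewrite !iE; have -> : lo + (psi (t + h) - skor psi a (t + h)) -
     (lo + (psi t - skor psi a t)) = (psi (t + h) - psi t) -
     (skor psi a (t + h) - skor psi a t) by ring.
  by apply: le_trans (ler_normB _ _) _; have := lerD P S; lra.
move=> iint; rewrite !iE (D2 h) ?h0 //.
have -> : lo + (psi (t + h) - skor psi a t) - (lo + (psi t - skor psi a t)) =
  psi (t + h) - psi t by ring.
by apply: D1; rewrite ltW.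
Qed.

(** The right derivative of [cutoff k] along the path. Its weight vanishes at the limits, where the
    increment of the path is not determined by the drive. *)
Let damp (k : nat) (t : R) : R := (1 - centered (i t) ^+ (2 * k)) * w t.

Let centered_sqr_itv t (k : nat) : 0 <= t -> 0 <= centered (i t) ^+ (2 * k) <= 1.
Proof.
move=> t0; have c1 := centered_itv (iab t0).
by rewrite exprM exprn_ge0 ?sqr_ge0 //= exprn_ile1 ?sqr_ge0 // -real_normK ?num_real // exprn_ile1.
Qed.

Let ccentered : ccont (fun t => centered (i t)).
Proof.
apply: (ccont_dom ci ci) => t t0; exists (2 / a); first by rewrite divr_ge0 ?(ltW a0).
move=> s s0; have -> : centered (i s) - centered (i t) = 2 / a * (i s - i t).
  by rewrite /centered; field; rewrite gt_eqF.
have c0 : 0 <= 2 / a by rewrite divr_ge0 ?(ltW a0).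
by rewrite normrM ger0_norm // ler_wpM2l // lerDl.
Qed.

Let cdamp k : ccont (damp k).
Proof.
apply: ccont_mul => //; apply: ccont_sub; first exact: ccont_cst.
exact: ccont_exp.
Qed.

Let ccutoff k : ccont (fun t => cutoff k (i t)).
Proof.
apply: ccont_sub => //; apply: ccont_mul; first exact: ccont_cst.
exact: ccont_exp.
Qed.

Let cutoff_integral k t : 0 <= t ->
  cutoff k (i t) - cutoff k (i 0) = \int[mu]_(s in `[0, t]) damp k s.
Proof.
move=> t0.
have cI : ccont (fun t => \int[mu]_(s in `[0, t]) damp k s).
  by apply: int_ccont => s _; exact/ccont_integrable/cdamp.
suff D : forall t, 0 <= t -> forall e, 0 < e -> exists2 d, 0 < d & forall h,
    0 < h < d -> `|(cutoff k (i (t + h)) - cutoff k (i t)) -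
      (\int[mu]_(s in `[0, t + h]) damp k s - \int[mu]_(s in `[0, t]) damp k s)|
      <= h * e.
  have := right_derivative_unique (ccutoff k) cI D t0.
  by rewrite int_nil subr0.
move=> {t0} {}t t0 e e0.
have e4 : 0 < e / 4 by lra.
have [d1 d10 D1] := small_step t0 e4.
have [d2 d20 D2] := cdamp k t0 e4.
pose B := 2 / a * (2 * k).+1%:R * (2 * (`|w t| + e / 4)) ^+ 2.
have c0 : 0 <= 2 / a * (2 * k).+1%:R.
  by apply: mulr_ge0 => //; rewrite divr_ge0 ?(ltW a0).
have B0 : 0 <= B by apply: mulr_ge0 => //; exact: sqr_ge0.
exists (Num.min (Num.min d1 d2) (e / 4 / (B + 1))).
  by rewrite !lt_min d10 d20 divr_gt0 //; lra.
move=> h /andP[h0]; rewrite !lt_min => /andP[/andP[hd1 hd2] hB].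
have [S1 S2] := D1 h ltac:(by rewrite h0).
have th0 : 0 <= t + h by lra.
have C := cutoff_second_order k (iab t0) (iab th0).
have I : `|\int[mu]_(s in `[0, t + h]) damp k s - \int[mu]_(s in `[0, t]) damp k s
    - h * damp k t| <= h * (e / 4).
  apply: int_step_near => //; [exact: ltW|exact/ccont_integrable/cdamp|].
  move=> s /andP[ts sth]; apply: D2; first lra.
  by rewrite gtr0_norm ?subr_gt0 //; lra.
have C2 : 2 / a * (2 * k).+1%:R * (i (t + h) - i t) ^+ 2 <= h * (e / 4).
  apply: (@le_trans _ _ (h * (h * B))).
    have -> : h * (h * B) = 2 / a * (2 * k).+1%:R * (2 * h * (`|w t| + e / 4)) ^+ 2.
      by rewrite /B; ring.
    apply: ler_wpM2l => //.
    by rewrite -[leLHS]real_normK ?num_real // ler_pXn2r // nnegrE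
       ?mulr_ge0 ?addr_ge0 // ltW.
  rewrite ler_pM2l //; move: hB; rewrite ltr_pdivlMr; last lra.
  by rewrite mulrDr mulr1; lra.
(* In the interior by the second half of [small_step]; at a limit because the weight is 0. *)
have Z : `|(1 - centered (i t) ^+ (2 * k)) * (i (t + h) - i t - h * w t)| <= h * (e / 4).
  have /andP[q0 q1] := centered_sqr_itv k t0.
  have [iint|] := boolP (lo < i t < hi).
    rewrite normrM; apply: le_trans (S2 iint).
    by rewrite ler_piMl // ger0_norm; lra.
  move=> /(centered_boundary (iab t0)) E.
  by rewrite exprM E expr1n subrr mul0r normr0 mulr_ge0 // ltW.
move: C I Z; rewrite /damp; set p := 1 - _; move=> C I Z.
set X := cutoff k _ - cutoff k _ in C *; set Y := _ - \int[mu]_(s in `[0, t]) _ in I *.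
have -> : X - Y = (X - p * (i (t + h) - i t)) + p * (i (t + h) - i t - h * w t)
   - (Y - h * (p * w t)) by ring.
apply: le_trans (ler_normB _ _) _.
apply: le_trans (lerD (ler_normD _ _) (lexx _)) _.
by have := mulr_gt0 h0 e0; have := le_trans C C2; lra.
Qed.

Let sat (s : R) : R := saturate lo hi (i s) (w s).

Let satE s : 0 < s -> sat s = if lo < i s < hi then w s else 0.
Proof.
move=> s0; have /andP[l1 l2] := iab (ltW s0); rewrite /sat /saturate.
have [il|li] := leP (i s) lo; first by rewrite max_r //; exact: contact_low.
have [ih|hi'] := ltP (i s) hi; first by [].
by rewrite min_r //; exact: contact_high.
Qed.

Let damp_le k s : 0 <= s -> `|damp k s| <= `|w s|.
Proof.
move=> s0; have /andP[q0 q1] := centered_sqr_itv k s0.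
by rewrite /damp normrM ler_piMl // ger0_norm; lra.
Qed.

Let damp_cvg s : 0 < s -> damp ^~ s @ \oo --> sat s.
Proof.
move=> s0; rewrite satE //; have c1 := centered_itv (iab (ltW s0)).
have [iint|] := boolP (lo < i s < hi).
  rewrite -[X in _ --> X]mul1r; apply: cvgM; last exact: cvg_cst.
  rewrite -[X in _ --> X]subr0; apply: cvgB; first exact: cvg_cst.
  under eq_fun do rewrite exprM.
  apply: cvg_expr; rewrite normrX expr_lt1 //; exact: centered_interior.
move=> /(centered_boundary (iab (ltW s0))) E.
suff Z k : damp k s = 0 by under eq_fun do rewrite Z; exact: cvg_cst.
by rewrite /damp exprM E expr1n subrr mul0r.
Qed.

(** Each [cutoff k] obeys an exact integral identity. As [k] grows, [cutoff k] tends to the identity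
    and [damp k] to the saturated drive, dominated by [|w|]. *)
Lemma saturated_integral t : 0 <= t ->
  mu.-integrable `[0, t] (EFin \o sat) /\
  i t = i 0 + \int[mu]_(s in `[0, t]) sat s.
Proof.
(* The contact lemmas say nothing at time 0, a null set left out by the half-open interval. *)
move=> t0; pose D := `]0, t]%classic.
have sD : D `<=` `[0, t]%classic by apply: subset_itvr; rewrite bnd_simp.
have iw : mu.-integrable D (EFin \o (fun s => `|w s|)).
  apply: integrable_norm; apply: integrableS (ccont_integrable t cw);
    by [exact: measurable_itv|exact: sD].
have id k : mu.-integrable D (EFin \o damp k).
  apply: integrableS (ccont_integrable t (cdamp k));
    by [exact: measurable_itv|exact: sD].
have md k := measurable_int mu (id k).
have cd s : D s -> (fun k => (EFin \o damp k) s) @ \oo --> (EFin \o sat) s.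
  rewrite /D /= in_itv /= => /andP[s0 st].
  by apply: cvg_EFin; [exact: nearW|exact: damp_cvg].
(* The saturated drive may be discontinuous in time; it is measurable as a pointwise limit of
   continuous functions. *)
have ms := emeasurable_fun_cvg _ _ md cd.
have [is1 _ cvgI] : [/\ mu.-integrable D (EFin \o sat),
   [sequence \int[mu]_(x in D) `|(EFin \o damp k) x - (EFin \o sat) x|]_k @ \oo --> 0 &
   [sequence \int[mu]_(x in D) (EFin \o damp k) x]_k @ \oo -->
     \int[mu]_(x in D) (EFin \o sat) x]%E.
  apply: (dominated_convergence _ md ms _ iw); first exact: measurable_itv.
    exact: aeW.
  apply: aeW => s k; rewrite /D /= in_itv /= => /andP[s0 st].
  by rewrite lee_fin; apply: damp_le; exact: ltW.
have is2 : mu.-integrable `[0, t] (EFin \o sat).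
  move/integrableP: is1 => [_ fin1]; apply/integrableP; split.
    exact/emeasurable_fun_itv_obnd_cbndP.
  rewrite -integral_itv_obnd_cbnd //.
  by apply: measurableT_comp => //.
split=> //; apply/eqP; rewrite addrC -subr_eq; apply/eqP.
rewrite -Rintegral_itv_obnd_cbnd //.
have cvgR : (fun k => \int[mu]_(s in D) damp k s) @ \oo --> \int[mu]_(s in D) sat s.
  apply: fine_cvg; rewrite fineK; first exact: cvgI.
  by apply: integrable_fin_num => //; exact: measurable_itv.
have cut y : lo <= y <= hi -> cutoff ^~ y @ \oo --> y.
  move=> yi; apply/cvgrPdist_le => e e0.
  exists (Num.trunc (a / e)).+1 => // k /= Nk.
  rewrite distrC; apply: le_trans (cutoff_near k yi) _.
  rewrite ler_pdivrMr // mulrC -ler_pdivrMr //.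
  have : a / e < (Num.trunc (a / e)).+1%:R by apply: truncnS_gt.
  by move=> /ltW /le_trans; apply; rewrite ler_nat; apply: leq_trans Nk _.
have cvgC : (fun k => \int[mu]_(s in D) damp k s) @ \oo --> i t - i 0.
  have E : (fun k => \int[mu]_(s in D) damp k s) =
     (fun k => cutoff k (i t) - cutoff k (i 0)).
    by apply/funext => k; rewrite cutoff_integral // Rintegral_itv_obnd_cbnd.
  by rewrite E; apply: cvgB; apply: cut; exact: iab.
exact: (cvg_unique _ cvgC cvgR).
Qed.

End Path.
End SaturatedIntegrator.

(** * The closed loop as a slow-fast trajectory *)

Section ClosedLoop.
Variable R : realType.
Notation mu := (@lebesgue_measure R).
Notation vec := 'cV[R]_4.
Implicit Types (f : R -> vec -> vec) (Q : vec -> R) (z : R -> 'cV[R]_(4 + 1)).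

(** [vfieldCL] for an arbitrary field and output, so as to include the truncated plant. *)
Definition closed_loop f Q (lo hi Qt Kt : R) (z : 'cV[R]_(4 + 1)) :
    'cV[R]_(4 + 1) :=
  mkz (f (if_ z) (x_ z)) (saturate lo hi (if_ z) ((Qt - Q (x_ z)) / Kt)).

Lemma x_mkz (x : vec) (i : R) : x_ (mkz x i) = x.
Proof. exact: col_mxKu. Qed.

Lemma if_mkz (x : vec) (i : R) : if_ (mkz x i) = i.
Proof. by rewrite /if_ /mkz col_mxKd mxE eqxx mulr1n. Qed.

Lemma mkz_eta (z : 'cV[R]_(4 + 1)) : mkz (x_ z) (if_ z) = z.
Proof.
rewrite /mkz /x_ /if_ -[RHS]vsubmxK; congr col_mx.
by apply/matrixP => i j; rewrite !ord1 mxE eqxx mulr1n.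
Qed.

Lemma mkzB (x y : vec) (i j : R) : mkz x i - mkz y j = mkz (x - y) (i - j).
Proof. by rewrite /mkz opp_col_mx add_col_mx -raddfB. Qed.

Lemma mkz_up (x : vec) (i : R) (j : 'I_4) : mkz x i (lshift 1 j) 0 = x j 0.
Proof. by rewrite /mkz col_mxEu. Qed.

Lemma mkz_down (x : vec) (i : R) (j : 'I_1) : mkz x i (rshift 4 j) 0 = i.
Proof. by rewrite /mkz col_mxEd ord1 mxE eqxx mulr1n. Qed.

Lemma x_coord (z : 'cV[R]_(4 + 1)) (j : 'I_4) : x_ z j 0 = z (lshift 1 j) 0.
Proof. by rewrite -{2}(mkz_eta z) mkz_up. Qed.

Lemma if_coord (z : 'cV[R]_(4 + 1)) : if_ z = z (rshift 4 ord0) 0.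
Proof. by rewrite -{2}(mkz_eta z) mkz_down. Qed.

Lemma x_norm (z : 'cV[R]_(4 + 1)) : `|x_ z| <= `|z|.
Proof. by apply: norm_le_coord => // j; rewrite x_coord; apply: coord_le_norm. Qed.

Lemma if_norm (z : 'cV[R]_(4 + 1)) : `|if_ z| <= `|z|.
Proof. by rewrite if_coord; apply: coord_le_norm. Qed.

Lemma mkz_norm (x : vec) (i c : R) : `|x| <= c -> `|i| <= c -> `|mkz x i| <= c.
Proof.
move=> xc ic; apply: norm_le_coord; first exact: (le_trans (normr_ge0 x) xc).
move=> j; case: (@split_ordP 4 1 j) => k ->.
  by rewrite mkz_up; apply: le_trans (coord_le_norm _ _) xc.
by rewrite mkz_down.
Qed.

Lemma x_B (z z' : 'cV[R]_(4 + 1)) : x_ z - x_ z' = x_ (z - z').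
Proof. by rewrite -{2}(mkz_eta z) -{2}(mkz_eta z') mkzB x_mkz. Qed.

Lemma if_B (z z' : 'cV[R]_(4 + 1)) : if_ z - if_ z' = if_ (z - z').
Proof. by rewrite -{2}(mkz_eta z) -{2}(mkz_eta z') mkzB if_mkz. Qed.

Lemma x_ccont z : ccont z -> ccont (fun t => x_ (z t)).
Proof.
move=> cz; apply: (ccont_dom cz cz) => t t0; exists 1 => // s s0.
by rewrite mul1r x_B; apply: le_trans (x_norm _) _; rewrite lerDl.
Qed.

Lemma if_ccont z : ccont z -> ccont (fun t => if_ (z t)).
Proof.
move=> cz; apply: (ccont_dom cz cz) => t t0; exists 1 => // s s0.
by rewrite mul1r if_B; apply: le_trans (if_norm _) _; rewrite lerDl.
Qed.

Lemma mkz_ccont (x : R -> vec) (i : R -> R) : ccont x -> ccont i ->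
  ccont (fun t => mkz (x t) (i t)).
Proof.
move=> cx ci; apply: (ccont_dom cx ci) => t t0; exists 1 => // s s0.
by rewrite mul1r mkzB; apply: mkz_norm; rewrite ?lerDl ?lerDr.
Qed.

Lemma closed_loop_solutionP f Q (lo hi Qt Kt : R) (X : set 'cV[R]_(4 + 1)) z :
  is_solution (closed_loop f Q lo hi Qt Kt) X z <->
  forall t, 0 <= t -> [/\ X (z t),
   forall j, mu.-integrable `[0, t]
       (EFin \o (fun s => f (if_ (z s)) (x_ (z s)) j 0)) /\
     x_ (z t) j 0 = x_ (z 0) j 0 +
       \int[mu]_(s in `[0, t]) f (if_ (z s)) (x_ (z s)) j 0 &
   mu.-integrable `[0, t] (EFin \o
     (fun s => saturate lo hi (if_ (z s)) ((Qt - Q (x_ (z s))) / Kt))) /\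
   if_ (z t) = if_ (z 0) + \int[mu]_(s in `[0, t])
      saturate lo hi (if_ (z s)) ((Qt - Q (x_ (z s))) / Kt)].
Proof.
have FEx j : (fun s => closed_loop f Q lo hi Qt Kt (z s) (lshift 1 j) 0) =
    (fun s => f (if_ (z s)) (x_ (z s)) j 0).
  by apply/funext => s; rewrite /closed_loop mkz_up.
have FEi j : (fun s => closed_loop f Q lo hi Qt Kt (z s) (rshift 4 j) 0) =
    (fun s => saturate lo hi (if_ (z s)) ((Qt - Q (x_ (z s))) / Kt)).
  by apply/funext => s; rewrite /closed_loop mkz_down.
split=> H t t0.
  have [Xt Hj] := H t t0; split=> // [j|].
    by rewrite -FEx !x_coord; exact: Hj.
  by rewrite -(FEi ord0) !if_coord; exact: Hj.
have [Xt Hj Hi] := H t t0; split=> // j.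
case: (@split_ordP 4 1 j) => k ->; first by rewrite FEx -!x_coord; exact: Hj.
by rewrite FEi (ord1 k) -!if_coord.
Qed.

Lemma saturate_norm (lo hi i w : R) : `|saturate lo hi i w| <= `|w|.
Proof.
rewrite /saturate; case: ifP => _; last case: ifP => _ //.
  by rewrite /Num.max /Order.max; case: ifP => // _; rewrite normr0.
by rewrite /Num.min /Order.min; case: ifP => // _; rewrite normr0.
Qed.

Lemma saturate_le (lo hi i w : R) : lo < i -> saturate lo hi i w <= w.
Proof.
move=> li; rewrite /saturate (leNgt i lo) li /=; case: ifP => // _.
by rewrite ge_min lexx.
Qed.

Lemma saturate_ge (lo hi i w : R) : i < hi -> w <= saturate lo hi i w.
Proof.
move=> li; rewrite /saturate li; case: ifP => // _.
by rewrite le_max lexx.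
Qed.

Lemma ccont_near (y : R -> R) (t e : R) : ccont y -> 0 <= t -> 0 < e ->
  exists2 d, 0 < d & forall h, 0 < h < d ->
    forall s, t < s <= t + h -> `|y s - y t| <= e.
Proof.
move=> cy t0 e0; have [d d0 D] := cy t t0 e e0; exists d => // h /andP[h0 hd].
move=> s /andP[ts sth]; apply: D; first by lra.
by rewrite gtr0_norm ?subr_gt0 //; lra.
Qed.

(** Also applied to the scalar output, encoded as the constant vector [const_mx (Q x)]. *)
Definition continuous_field f (lo hi : R) : Prop :=
  forall (x : R -> vec) (i : R -> R), ccont x -> ccont i ->
    (forall t, 0 <= t -> lo <= i t <= hi) -> ccont (fun t => f (i t) (x t)).

(** The integrand may jump, so the slow inequalities are obtained by bounding it over a short step.
    As [ifr] lies in [lo, hi], an input above [ifr] is off the lower limit and [saturate_le]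
    applies; below [ifr], [saturate_ge] does. *)
Lemma solution_trajectory f Q (Xi : R -> vec) (lo hi ifr Kt r : R) z :
  lo <= ifr <= hi -> 0 < Kt ->
  continuous_field f lo hi -> continuous_field (fun _ x => const_mx (Q x)) lo hi ->
  is_solution (closed_loop f Q lo hi (Q (Xi ifr)) Kt) (stateCL lo hi) z ->
  trajectory f Q Xi lo hi ifr Kt r (fun t => x_ (z t)) (fun t => if_ (z t)).
Proof.
move=> ifrab Kt0 cf cQ /closed_loop_solutionP sol.
have itv t : 0 <= t -> lo <= if_ (z t) <= hi by move=> /sol[].
have cx : ccont (fun t => x_ (z t)).
  apply: ccont_vec => j.
  have cI := int_ccont (fun t t0 => let: And3 _ H _ := sol t t0 in (H j).1).
  apply: (ccont_dom cI cI) => t t0; exists 1 => // s s0; rewrite mul1r.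
  have [_ /(_ j)[_ ->] _] := sol s s0; have [_ /(_ j)[_ ->] _] := sol t t0.
  by rewrite opprD addrACA subrr add0r lerDl.
have ci : ccont (fun t => if_ (z t)).
  have cI := int_ccont (fun t t0 => let: And3 _ _ H := sol t t0 in H.1).
  apply: (ccont_dom cI cI) => t t0; exists 1 => // s s0; rewrite mul1r.
  have [_ _ [_ ->]] := sol s s0; have [_ _ [_ ->]] := sol t t0.
  by rewrite opprD addrACA subrr add0r lerDl.
have cfz := cf _ _ cx ci itv.
have cw : ccont (fun t => (Q (Xi ifr) - Q (x_ (z t))) / Kt).
  have cq := ccont_coord (cQ _ _ cx ci itv) ord0.
  apply: (ccont_dom cq cq) => t t0; exists Kt^-1; first by rewrite invr_ge0 ltW.
  move=> s s0; rewrite !mxE -mulrBl.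
  have -> : Q (Xi ifr) - Q (x_ (z s)) - (Q (Xi ifr) - Q (x_ (z t))) =
     - (Q (x_ (z s)) - Q (x_ (z t))) by ring.
  rewrite normrM normrN mulrC [ `|Kt^-1|]gtr0_norm ?invr_gt0 //.
  by rewrite ler_wpM2l ?lerDl // invr_ge0 ltW.
split=> // t t0.
- move=> _ e e0; have [d d0 D] := cfz t t0 e e0.
  exists d => // h /andP[h0 hd]; have th0 : 0 <= t + h by lra.
  apply: norm_le_coord; first by rewrite mulr_ge0 ?(ltW h0) ?(ltW e0).
  move=> j; rewrite !mxE.
  have [_ /(_ j)[I2 E2] _] := sol _ th0; have [_ /(_ j)[_ E1] _] := sol t t0.
  rewrite !x_coord in E1 E2; rewrite E1 E2.
  have -> (u v w d' : R) : u + v - (u + w) - d' = v - w - d' by ring.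
  apply: int_step_near => //; first exact: ltW.
  move=> s /andP[ts sth]; have s0 : 0 <= s by lra.
  have sd : `|s - t| < d by rewrite gtr0_norm ?subr_gt0 //; lra.
  have := coord_le_norm (f (if_ (z s)) (x_ (z s)) - f (if_ (z t)) (x_ (z t))) j.
  by rewrite !mxE => /le_trans; apply; apply: D.
move=> e e0; set w := (_ / Kt).
have [d1 d10 D1] := ccont_near cw t0 e0; rewrite -/w in D1.
(* By continuity the input remains on its side of [ifr] for a short time. *)
have [d2 d20 D2] : exists2 d2, 0 < d2 & forall h, 0 < h < d2 ->
    forall s, t < s <= t + h -> (ifr < if_ (z t) -> ifr < if_ (z s)) /\
      (if_ (z t) < ifr -> if_ (z s) < ifr).
  have [E|NE] := eqVneq (if_ (z t)) ifr.
    by exists 1 => // h _ s _; rewrite E ltxx.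
  have g0 : 0 < `|if_ (z t) - ifr| / 2 by rewrite divr_gt0 // normr_gt0 subr_eq0.
  have [d d0 D] := ccont_near ci t0 g0; exists d => // h hd s st.
  have /ler_normlP[A1 A2] := D h hd s st; split=> lt.
    by move: A1 A2; rewrite gtr0_norm ?subr_gt0 //; lra.
  by move: A1 A2; rewrite distrC gtr0_norm ?subr_gt0 //; lra.
exists (Num.min d1 d2); first by rewrite lt_min d10.
move=> h /andP[h0]; rewrite lt_min => /andP[hd1 hd2].
have {}D1 := D1 h ltac:(by rewrite h0); have {}D2 := D2 h ltac:(by rewrite h0).
have th0 : 0 <= t + h by lra.
have [_ _ [I2 E2]] := sol _ th0; have [_ _ [_ E1]] := sol t t0.
have /andP[fr1 fr2] := ifrab.
have -> : if_ (z (t + h)) - if_ (z t) = \int[mu]_(s in `[0, t + h])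
      saturate lo hi (if_ (z s)) ((Q (Xi ifr) - Q (x_ (z s))) / Kt) -
    \int[mu]_(s in `[0, t])
      saturate lo hi (if_ (z s)) ((Q (Xi ifr) - Q (x_ (z s))) / Kt).
  by rewrite E2 E1 opprD addrACA subrr add0r.
split.
- have -> (p : R) : `|p| = `|p - h * 0| by rewrite mulr0 subr0.
  apply: int_step_near => //; first exact: ltW.
  move=> s st; rewrite subr0; apply: le_trans (saturate_norm _ _ _ _) _.
  have := D1 s st; set ws := (_ / Kt) => Dws.
  by have := ler_normD (ws - w) w; rewrite subrK; lra.
- move=> lt; apply: int_step_le => //; first exact: ltW.
  move=> s st; have [/(_ lt) ls _] := D2 s st.
  apply: le_trans (saturate_le _ _ (le_lt_trans fr1 ls)) _.
  by have /ler_normlP[] := D1 s st; lra.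
- move=> lt; apply: int_step_ge => //; first exact: ltW.
  move=> s st; have [_ /(_ lt) ls] := D2 s st.
  apply: le_trans _ (saturate_ge _ _ (lt_le_trans ls fr2)).
  by have /ler_normlP[] := D1 s st; lra.
Qed.

End ClosedLoop.

(** * Existence of solutions for the truncated closed loop *)

Section Existence.
Variable R : realType.
Notation mu := (@lebesgue_measure R).
Notation vec := 'cV[R]_4.
Implicit Types (f : R -> vec -> vec) (Q : vec -> R).

Definition lipschitz_on_bounded f (lo hi : R) : Prop :=
  forall M : R, 0 <= M -> exists2 K : R, 0 <= K & forall (i j : R) (x y : vec),
    lo <= i <= hi -> lo <= j <= hi -> `|x| <= M -> `|y| <= M ->
    `|f i x - f j y| <= K * (`|i - j| + `|x - y|).

Lemma lipschitz_continuous_field f lo hi :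
  lipschitz_on_bounded f lo hi -> continuous_field f lo hi.
Proof.
move=> Lf x i cx ci itv; apply: (ccont_local_dom cx ci) => t t0.
have [K K0 HK] := Lf (`|x t| + 1) ltac:(by rewrite addr_ge0).
exists K => // s s0 xs; rewrite [X in K * X]addrC; apply: HK; rewrite ?itv ?lerDl //.
rewrite -[x s](subrK (x t)) addrC; apply: le_trans (ler_normD _ _) _.
by rewrite lerD2l.
Qed.

(** The nonexpansive retraction onto the sup-norm ball of radius [M]. *)
Definition clip (M : R) (x : vec) : vec :=
  \col_j Num.max (- M) (Num.min M (x j 0)).

Lemma clip_norm M x : 0 <= M -> `|clip M x| <= M.
Proof.
move=> M0; apply: norm_le_coord => // j; rewrite mxE ler_norml.
by rewrite le_max lexx /= ge_max ge_min lexx andbT; lra.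
Qed.

Lemma clip_lip M x y : `|clip M x - clip M y| <= `|x - y|.
Proof.
apply: norm_le_coord => // j; rewrite !mxE.
apply: le_trans (maxr_dist _ _ _) _; apply: le_trans (minr_dist _ _ _) _.
by have := coord_le_norm (x - y) j; rewrite !mxE.
Qed.

Lemma clip_id M x : `|x| <= M -> clip M x = x.
Proof.
move=> xM; apply/matrixP => j k; rewrite (ord1 k) mxE.
have := le_trans (coord_le_norm x j) xM => /ler_normlP[A B].
by rewrite min_r // max_r //; lra.
Qed.

Lemma lipschitz_clip f lo hi M : lo <= hi -> 0 <= M ->
  lipschitz_on_bounded f lo hi ->
  exists K B : R, [/\ 0 <= K,
    forall (i j : R) (x y : vec), lo <= i <= hi -> lo <= j <= hi ->
      `|f i (clip M x) - f j (clip M y)| <= K * (`|i - j| + `|x - y|) &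
    forall (i : R) (x : vec), lo <= i <= hi -> `|f i (clip M x)| <= B].
Proof.
move=> lohi M0 Lf; have [K K0 HK] := Lf _ M0.
exists K, (`|f lo 0| + K * ((hi - lo) + M)); split=> //.
  move=> i j x y ib jb; apply: le_trans (HK _ _ _ _ ib jb _ _) _; rewrite ?clip_norm //.
  by rewrite ler_wpM2l // lerD2l clip_lip.
move=> i x ib; rewrite -[f i _](subrK (f lo 0)) addrC.
apply: le_trans (ler_normD _ _) _; rewrite lerD2l.
have lob : lo <= lo <= hi by rewrite lexx.
apply: le_trans (HK _ _ _ _ ib lob (clip_norm _ M0) _) _; first by rewrite normr0.
rewrite ler_wpM2l // subr0 lerD ?clip_norm //.
by move: ib => /andP[*]; rewrite ger0_norm ?subr_ge0 //; lra.
Qed.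

(** The unknown is [x] together with the free integral of the drive, and the input is its
    reflection. The right-hand side becomes a Lipschitz functional of the past, although the
    saturated field is not continuous in the state. *)
Lemma clipped_solution_exists f Q (lo hi Qt Kt M : R) (x0 : vec) (i0 : R) :
  lo < hi -> 0 < Kt -> 0 <= M -> lo <= i0 <= hi ->
  lipschitz_on_bounded f lo hi ->
  lipschitz_on_bounded (fun _ x => const_mx (Q x)) lo hi ->
  exists z, is_solution (closed_loop (fun i x => f i (clip M x))
      (fun x => Q (clip M x)) lo hi Qt Kt) (stateCL lo hi) z /\
    z 0 = mkz x0 i0.
Proof.
move=> lohi Kt0 M0 i0ab Lf LQ.
have [Kf [Bf [Kf0 Hf HBf]]] := lipschitz_clip (ltW lohi) M0 Lf.
have [Kq [Bq [Kq0 Hq' HBq']]] := lipschitz_clip (ltW lohi) M0 LQ.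
have lob : lo <= lo <= hi by rewrite lexx ltW.
have Hq (x y : vec) : `|Q (clip M x) - Q (clip M y)| <= Kq * `|x - y|.
  have := Hq' lo lo x y lob lob; rewrite subrr normr0 add0r => /(le_trans _); apply.
  by rewrite -raddfB norm_const_mx.
have HBq (x : vec) : `|Q (clip M x)| <= Bq.
  apply: le_trans (HBq' lo x lob).
  by rewrite norm_const_mx.
pose w (x : vec) := (Qt - Q (clip M x)) / Kt.
have wlip x y : `|w x - w y| <= Kq / Kt * `|x - y|.
  rewrite /w -mulrBl normrM [ `|Kt^-1|]gtr0_norm ?invr_gt0 // mulrAC.
  rewrite ler_wpM2r ?invr_ge0 ?(ltW Kt0) //.
  have -> : Qt - Q (clip M x) - (Qt - Q (clip M y)) =
    - (Q (clip M x) - Q (clip M y)) by ring.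
  by rewrite normrN.
pose u (Y : R -> 'cV[R]_(4 + 1)) := fun t => if_ (Y t).
pose ip Y := reflect_path lo hi (u Y).
pose H (Y : R -> 'cV[R]_(4 + 1)) t : 'cV[R]_(4 + 1) :=
  mkz (f (ip Y t) (clip M (x_ (Y t)))) (w (x_ (Y t))).
have ipab Y t : 0 <= t -> lo <= ip Y t <= hi by move=> t0; apply: reflect_path_itv.
have KqKt : 0 <= Kq / Kt by rewrite divr_ge0 // ltW.
(* Reflection at most doubles distances, hence 2 + 1 = 3; the final 1 makes [K] positive. *)
pose K := Kf * 3 + Kq / Kt + 1.
have K0 : 0 < K by rewrite ltr_wpDl // addr_ge0 // mulr_ge0.
have cip Y : ccont Y -> ccont (ip Y).
  by move=> cY; apply: reflect_path_ccont => //; apply: if_ccont.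
have Hc Y : ccont Y -> ccont (H Y).
  move=> cY; apply: mkz_ccont.
    apply: (ccont_dom (cip Y cY) (x_ccont cY)) => t t0; exists Kf => // s s0.
    by apply: Hf; apply: ipab.
  apply: (ccont_dom (x_ccont cY) (x_ccont cY)) => t t0; exists (Kq / Kt) => // s s0.
  by apply: le_trans (wlip _ _) _; rewrite ler_wpM2l // lerDl.
have HL Y1 Y2 : ccont Y1 -> ccont Y2 -> forall t D, 0 <= t ->
    (forall s, 0 <= s <= t -> `|Y1 s - Y2 s| <= D) -> `|H Y1 t - H Y2 t| <= K * D.
  move=> _ _ t D t0 HD.
  have Dt : `|Y1 t - Y2 t| <= D by apply: HD; rewrite t0 lexx.
  have D0 : 0 <= D := le_trans (normr_ge0 _) Dt.
  have xD : `|x_ (Y1 t) - x_ (Y2 t)| <= D by rewrite x_B (le_trans (x_norm _)).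
  have iD : `|ip Y1 t - ip Y2 t| <= 2 * D.
    apply: reflect_path_lip => // s st.
    by rewrite /u if_B (le_trans (if_norm _)) // HD.
  have KD1 : 0 <= Kf * 3 * D by rewrite !mulr_ge0.
  have KD2 : 0 <= Kq / Kt * D by rewrite mulr_ge0.
  rewrite /H mkzB; apply: mkz_norm.
    apply: le_trans (Hf _ _ _ _ (ipab _ _ t0) (ipab _ _ t0)) _.
    apply: le_trans (ler_wpM2l Kf0 (lerD iD xD)) _.
    by rewrite /K; move: KD1 KD2 D0; clear; move=> *; lra.
  apply: le_trans (wlip _ _) _; apply: le_trans (ler_wpM2l KqKt xD) _.
  by rewrite /K; move: KD1 KD2 D0; clear; move=> *; lra.
pose Bw := (`|Qt| + Bq) / Kt.
have Bf0 : 0 <= Bf := le_trans (normr_ge0 _) (HBf _ 0 i0ab).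
have Bq0 : 0 <= Bq := le_trans (normr_ge0 _) (HBq 0).
have HM t : 0 <= t -> `|H (fun=> mkz x0 i0) t| <= Bf + Bw.
  move=> t0; apply: mkz_norm.
    apply: le_trans (HBf _ _ (ipab _ _ t0)) _.
    by rewrite lerDl divr_ge0 ?addr_ge0 // ltW.
  rewrite /w normrM [ `|Kt^-1|]gtr0_norm ?invr_gt0 //.
  apply: (@le_trans _ _ Bw); last by rewrite lerDr.
  rewrite /Bw ler_wpM2r ?invr_ge0 ?(ltW Kt0) //.
  by apply: le_trans (ler_normB _ _) _; rewrite lerD2l.
have [Y cY YE] := @volterra_exists R 4 H K (Bf + Bw) (mkz x0 i0) K0 Hc HL HM.
have wc : ccont (fun t => w (x_ (Y t))).
  have := ccont_coord (Hc Y cY) (rshift 4 ord0).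
  by under eq_fun do rewrite mkz_down.
have uE t : 0 <= t -> u Y t = i0 + \int[mu]_(s in `[0, t]) w (x_ (Y s)).
  move=> t0; rewrite /u if_coord YE // mxE mkz_down; congr (_ + _).
  by apply: eq_Rintegral => s _; rewrite mkz_down.
have ip0 := reflect_path0 i0ab uE.
have xE t (j : 'I_4) : 0 <= t -> x_ (Y t) j 0 = x0 j 0 +
    \int[mu]_(s in `[0, t]) f (ip Y s) (clip M (x_ (Y s))) j 0.
  move=> t0; rewrite x_coord YE // mxE mkz_up; congr (_ + _).
  by apply: eq_Rintegral => s _; rewrite mkz_up.
have x00 : x_ (Y 0) = x0.
  by apply/matrixP => j k; rewrite (ord1 k) xE // int_nil addr0.
exists (fun t => mkz (x_ (Y t)) (ip Y t)); split; last by rewrite x00 /ip ip0.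
apply/closed_loop_solutionP => t t0; split.
- by rewrite /stateCL /= if_mkz; apply: ipab.
- move=> j; rewrite !x_mkz x00 xE //.
  have FE : (fun s => f (if_ (mkz (x_ (Y s)) (ip Y s)))
        (clip M (x_ (mkz (x_ (Y s)) (ip Y s)))) j 0) =
      (fun s => f (ip Y s) (clip M (x_ (Y s))) j 0).
    by apply/funext => s; rewrite if_mkz x_mkz.
  rewrite FE; split=> //; apply: ccont_integrable.
  have := ccont_coord (Hc Y cY) (lshift 1 j).
  by under eq_fun do rewrite mkz_up.
have FE : (fun s => saturate lo hi (if_ (mkz (x_ (Y s)) (ip Y s)))
     ((Qt - Q (clip M (x_ (mkz (x_ (Y s)) (ip Y s))))) / Kt)) =
   (fun s => saturate lo hi (ip Y s) (w (x_ (Y s)))).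
  by apply/funext => s; rewrite if_mkz x_mkz.
by rewrite FE !if_mkz; exact: (saturated_integral lohi wc uE t0).
Qed.

End Existence.

(** * Stability of a generic plant under low-gain integral control *)

Section LowGain.
Variable R : realType.
Notation mu := (@lebesgue_measure R).
Notation vec := 'cV[R]_4.

Lemma exp_bound_converges (W : normedModType R) (lam C : R) (y : R -> W) (l : W) :
  0 < lam -> (forall t, 0 <= t -> `|y t - l| <= C * expR (- lam * t)) ->
  exp_converges lam y l.
Proof.
move=> lam0 H; split; last by exists C.
have C0 : 0 <= C.
  have := H 0 (lexx 0); rewrite mulr0 expR0 mulr1; exact: le_trans (normr_ge0 _).
apply/cvgrPdist_le => e e0.
have B0 : 0 <= C / (lam * e) by rewrite divr_ge0 // mulr_ge0 // ltW.
near=> t.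
have tB : C / (lam * e) <= t by near: t; apply: nbhs_pinfty_ge; exact: num_real.
have t0 : 0 <= t := le_trans B0 tB.
rewrite distrC; apply: le_trans (H t t0) _.
rewrite mulNr expRN ler_pdivrMr ?expR_gt0 //.
move: tB; rewrite ler_pdivrMr ?mulr_gt0 // => tB.
apply: (@le_trans _ _ (e * (1 + lam * t))); first lra.
by rewrite ler_pM2l // expR_ge1Dx.
Unshelve. all: by end_near.
Qed.

Lemma solution_eq_on (F F' : 'cV[R]_(4 + 1) -> 'cV[R]_(4 + 1)) X
    (z : R -> 'cV[R]_(4 + 1)) :
  (forall t, 0 <= t -> F (z t) = F' (z t)) ->
  is_solution F X z -> is_solution F' X z.
Proof.
move=> E sol t t0; have [Xt Hi] := sol t t0; split=> // i.
have Es s : s \in `[0, t]%classic -> F (z s) i 0 = F' (z s) i 0.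
  by rewrite inE /= in_itv /= => /andP[s0 _]; rewrite E.
have [I ->] := Hi i; split.
  apply: eq_integrable I; first exact: measurable_itv.
  by move=> s /Es H; rewrite /= H.
by congr (_ + _); apply: eq_Rintegral.
Qed.

Variables (f : R -> vec -> vec) (Q : vec -> R) (Xi : R -> vec).
Variables (A : R -> 'M[R]_4) (lo hi : R) (N : R -> vec -> R).
Variables (c2 c3 al h0 C2 CQ LX LG mu0 : R).
Hypothesis lohi : lo < hi.
Hypothesis Lf : lipschitz_on_bounded f lo hi.
Hypothesis LQ : lipschitz_on_bounded (fun _ x => const_mx (Q x)) lo hi.
Hypothesis pl : plant f Q Xi A lo hi N c2 c3 al h0 C2 CQ LX LG mu0.

(** Exceeds every [|Xi i|] by 1, so truncation changes nothing within distance 1 of the equilibria,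
    where the plant inequalities are stated. *)
Let M : R := `|Xi lo| + LX * (hi - lo) + 1.

Let M0 : 0 <= M.
Proof. by rewrite !addr_ge0 // mulr_ge0 ?(pl_LX pl) // subr_ge0 ltW. Qed.

Let near_M i e : lo <= i <= hi -> `|e| <= 1 -> `|Xi i + e| <= M.
Proof.
move=> iab e1; apply: le_trans (ler_normD _ _) _; rewrite /M lerD //.
rewrite -[Xi i](subrK (Xi lo)) addrC; apply: le_trans (ler_normD _ _) _.
rewrite lerD2l; apply: le_trans (pl_Xi pl iab _) _; first by rewrite lexx ltW.
rewrite ler_wpM2l ?(pl_LX pl) //.
by move: iab => /andP[*]; rewrite ger0_norm ?subr_ge0 //; lra.
Qed.

Let clip_near i e : lo <= i <= hi -> `|e| <= 1 -> clip M (Xi i + e) = Xi i + e.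
Proof. by move=> iab e1; apply/clip_id/near_M. Qed.

Let clip_Xi i : lo <= i <= hi -> clip M (Xi i) = Xi i.
Proof. by move=> iab; rewrite -[Xi i]addr0 clip_near // normr0. Qed.

Let clipped_plant : plant (fun i x => f i (clip M x)) (fun x => Q (clip M x))
  Xi A lo hi N c2 c3 al h0 C2 CQ LX LG mu0.
Proof.
case: (pl) => H1 H2 H3 H4 H5 H6 H7 H8 H9 H10 H11; split=> //.
- by move=> i e iab e1; rewrite clip_near //; apply: H7.
- by move=> i e iab e1; rewrite clip_near // clip_Xi //; apply: H8.
- by move=> i j iab jab; rewrite !clip_Xi //; apply: H10.
- by move=> i j iab jab ij; rewrite !clip_Xi //; apply: H11.
Qed.

Lemma lipschitz_clip_field (g : R -> vec -> vec) :
  lipschitz_on_bounded g lo hi ->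
  lipschitz_on_bounded (fun i x => g i (clip M x)) lo hi.
Proof.
move=> Lg B B0; have [K K0 HK] := Lg M M0; exists K => // i j x y ib jb xB yB.
apply: le_trans (HK _ _ _ _ ib jb _ _) _; rewrite ?clip_norm //.
by rewrite ler_wpM2l // lerD2l clip_lip.
Qed.

Theorem low_gain_stability (ifr : R) : lo <= ifr <= hi ->
  exists eps0 kappa : R, [/\ 0 < eps0, 0 < kappa &
    forall Kt : R, kappa^-1 < Kt ->
      let F := closed_loop f Q lo hi (Q (Xi ifr)) Kt in
      let X := stateCL lo hi in
      exp_stable_equilibrium F X (mkz (Xi ifr) ifr) /\
      exists2 lambda : R, 0 < lambda &
        forall z0 : 'cV[R]_(4 + 1), X z0 ->
          `|x_ z0 - Xi (if_ z0)| <= eps0 ->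
          (exists z, is_solution F X z /\ z 0 = z0) /\
          (forall z, is_solution F X z -> z 0 = z0 ->
             [/\ exp_converges lambda (fun t => x_ (z t)) (Xi ifr),
                 exp_converges lambda (fun t => if_ (z t)) ifr &
                 exp_converges lambda (fun t => Q (x_ (z t))) (Q (Xi ifr))])].
Proof.
move=> ifrab; have L := pl_lyap pl; have c21 := lyap_upper_ge0 L.
have [gam [kap [r [gam0 kap0 r0 r1 decay]]]] := slow_fast_decay lohi pl.
have LX0 := pl_LX pl; have CQ0 := pl_CQ pl; have LG0 := pl_LG pl.
pose Y := hi - lo; have Y0 : 0 < Y by rewrite subr_gt0.
have gc0 : 0 < gam * c2 by rewrite mulr_gt0 //; lra.
(* With the upper bound [c2] of the norms, this is the initial condition required by the decay
   lemma. *)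
pose eps0 := Y / (gam * c2); have eps00 : 0 < eps0 by rewrite divr_gt0.
exists eps0, kap; split=> // Kt Ktk F X.
have Kt0 : 0 < Kt by apply: lt_trans Ktk; rewrite invr_gt0.
have [lam lam0 dec] := decay f Q pl ifr Kt ifrab Ktk.
have [lam' lam'0 dec'] := decay _ _ clipped_plant ifr Kt ifrab Ktk.
have init (z : R -> 'cV[R]_(4 + 1)) : `|x_ (z 0) - Xi (if_ (z 0))| <= eps0 ->
    gam * N (if_ (z 0)) (x_ (z 0) - Xi (if_ (z 0))) <= hi - lo.
  move=> He; apply: (@le_trans _ _ (gam * (c2 * eps0))).
    rewrite ler_wpM2l ?(ltW gam0) //; apply: le_trans (lyap_upper L _ _) _.
    by rewrite ler_wpM2l //; lra.
  by rewrite mulrA /eps0 mulrC divfK // gt_eqF.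
(* The decay estimate holds for the truncated loop as well and keeps its solution in the region
   where truncation is invisible. *)
have exist z0 : X z0 -> `|x_ z0 - Xi (if_ z0)| <= eps0 ->
    exists z, is_solution F X z /\ z 0 = z0.
  move=> Xz0 Hz0.
  have [z [sz z0E]] := clipped_solution_exists (Q (Xi ifr)) (x_ z0) lohi Kt0 M0 Xz0 Lf LQ.
  rewrite mkz_eta in z0E; exists z; split=> //.
  have tr : trajectory (fun i x => f i (clip M x)) (fun x => Q (clip M x)) Xi
      lo hi ifr Kt r (fun t => x_ (z t)) (fun t => if_ (z t)).
    apply: solution_trajectory => //; last by rewrite clip_Xi.
      exact/lipschitz_continuous_field/lipschitz_clip_field.
    exact/lipschitz_continuous_field/(lipschitz_clip_field LQ).
  have D := dec' _ _ tr (init z ltac:(by rewrite z0E)).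
  apply: (solution_eq_on _ sz) => t t0.
  have [et _] := D t t0; have iab := tr_itv tr t0.
  have E : clip M (x_ (z t)) = x_ (z t).
    rewrite -[x_ (z t)](subrKC (Xi (if_ (z t)))); apply: clip_near => //.
    exact: le_trans et r1.
  by rewrite /F /closed_loop E.
pose W (z : 'cV[R]_(4 + 1)) := slow_fast_norm N Xi gam ifr (x_ z) (if_ z).
have bound z : is_solution F X z -> `|x_ (z 0) - Xi (if_ (z 0))| <= eps0 ->
    forall t, 0 <= t -> `|x_ (z t) - Xi (if_ (z t))| <= 1 /\
      W (z t) <= expR (- lam * t) * W (z 0).
  move=> sz Hz t t0.
  have tr : trajectory f Q Xi lo hi ifr Kt r (fun t => x_ (z t)) (fun t => if_ (z t)).
    by apply: solution_trajectory => //; apply: lipschitz_continuous_field.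
  have [H1 H2] := dec _ _ tr (init z Hz) t t0; split=> //.
  exact: le_trans H1 r1.
have We z : `|x_ z - Xi (if_ z)| <= gam^-1 * W z.
  rewrite ler_pdivlMl //.
  apply: (@le_trans _ _ (gam * N (if_ z) (x_ z - Xi (if_ z)))).
    by rewrite ler_pM2l //; apply: (lyap_lower L).
  by rewrite /W /slow_fast_norm le_max lexx.
have Wy z : `|if_ z - ifr| <= W z by rewrite /W /slow_fast_norm le_max lexx orbT.
have W0 z : 0 <= W z := le_trans (normr_ge0 _) (Wy z).
have gi0 : 0 < gam^-1 by rewrite invr_gt0.
have Wx z : X z -> `|x_ z - Xi ifr| <= (gam^-1 + LX) * W z.
  move=> Xz; rewrite -[x_ z](subrK (Xi (if_ z))) -addrA.
  apply: le_trans (ler_normD _ _) _; rewrite mulrDl lerD //.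
  by apply: le_trans (pl_Xi pl Xz ifrab) _; rewrite ler_wpM2l.
have Xt z : is_solution F X z -> forall t, 0 <= t -> X (z t).
  by move=> sz t /sz[].
split.
  split.
    split; first by rewrite /X /stateCL /= if_mkz.
    rewrite /F /closed_loop if_mkz x_mkz subrr mul0r.
    have -> : f ifr (Xi ifr) = 0.
      have := pl_lin pl ifrab (e := 0); rewrite normr0 addr0 mulmx0 subr0 expr2 !mulr0.
      by move=> /(_ ler01); rewrite normr_le0 => /eqP.
    have -> : saturate lo hi ifr 0 = 0.
      by rewrite /saturate maxxx minxx; case: ifP => // _; case: ifP.
    by rewrite -[RHS](subrr (mkz (0 : vec) (0 : R))) mkzB !subrr.
  pose c := eps0 / (1 + LX).
  pose K := (gam^-1 + LX + 1) * (gam * (c2 * (1 + LX)) + 1).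
  have l1 : 0 < 1 + LX by lra.
  have g1 : 0 <= gam * (c2 * (1 + LX)).
    by apply: mulr_ge0; rewrite ?(ltW gam0) // mulr_ge0 // ?(ltW l1) //; lra.
  exists c, K, lam; split=> //; first by rewrite divr_gt0.
    by apply: mulr_gt0; lra.
  move=> z0 Xz0 z0c.
  set dz := `|z0 - _| in z0c *.
  have xz0 : `|x_ z0 - Xi ifr| <= dz.
    by have := x_norm (z0 - mkz (Xi ifr) ifr); rewrite -x_B x_mkz.
  have iz0 : `|if_ z0 - ifr| <= dz.
    by have := if_norm (z0 - mkz (Xi ifr) ifr); rewrite -if_B if_mkz.
  have ez0 : `|x_ z0 - Xi (if_ z0)| <= (1 + LX) * dz.
    have -> : x_ z0 - Xi (if_ z0) = (x_ z0 - Xi ifr) - (Xi (if_ z0) - Xi ifr).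
      by rewrite opprB addrA subrK.
    apply: le_trans (ler_normB _ _) _; rewrite mulrDl mul1r lerD //.
    by apply: le_trans (pl_Xi pl Xz0 ifrab) _; rewrite ler_wpM2l.
  have ez0' : `|x_ z0 - Xi (if_ z0)| <= eps0.
    apply: le_trans ez0 _; apply: (@le_trans _ _ ((1 + LX) * c)).
      by rewrite ler_wpM2l // ltW.
    by rewrite /c mulrC divfK // gt_eqF.
  split; first exact: exist.
  move=> z sz z00 t t0.
  have [_ Wt] := bound z sz ltac:(by rewrite z00) t t0.
  have Wz0 : W (z 0) <= (gam * (c2 * (1 + LX)) + 1) * dz.
    have p1 : 0 <= gam * (c2 * (1 + LX)) * dz by rewrite mulr_ge0 // normr_ge0.
    rewrite z00 /W /slow_fast_norm mulrDl mul1r ge_max; apply/andP; split.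
      apply: (@le_trans _ _ (gam * (c2 * (1 + LX)) * dz)); last first.
        by rewrite lerDl normr_ge0.
      rewrite -!mulrA ler_wpM2l ?(ltW gam0) //; apply: le_trans (lyap_upper L _ _) _.
      by rewrite ler_wpM2l //; lra.
    by apply: le_trans iz0 _; rewrite lerDr.
  have P1 : `|z t - mkz (Xi ifr) ifr| <= (gam^-1 + LX + 1) * W (z t).
    rewrite -[z t]mkz_eta mkzB mkz_eta; apply: mkz_norm.
      apply: le_trans (Wx _ (Xt z sz t t0)) _.
      by rewrite ler_wpM2r // lerDl.
    apply: le_trans (Wy _) _; rewrite -[leLHS]mul1r ler_wpM2r //; lra.
  have P2 := le_trans Wt (ler_wpM2l (expR_ge0 _) Wz0).
  have gL : 0 <= gam^-1 + LX + 1 by rewrite !addr_ge0 // ltW.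
  apply: le_trans P1 _; apply: le_trans (ler_wpM2l gL P2) _.
  by rewrite /K le_eqVlt; apply/orP; left; apply/eqP; ring.
exists lam => // z0 Xz0 Hz0; split; first exact: exist.
move=> z sz z00.
have B := bound z sz ltac:(by rewrite z00).
have BW t : 0 <= t -> W (z t) <= W (z 0) * expR (- lam * t).
  by move=> t0; rewrite mulrC; have [] := B t t0.
split.
- apply: (@exp_bound_converges _ lam ((gam^-1 + LX) * W (z 0))) => // t t0.
  apply: le_trans (Wx _ (Xt z sz t t0)) _; rewrite -mulrA.
  by rewrite ler_wpM2l ?BW // addr_ge0 // ltW.
- apply: (@exp_bound_converges _ lam (W (z 0))) => // t t0.
  exact: le_trans (Wy _) (BW t t0).
apply: (@exp_bound_converges _ lam ((CQ * gam^-1 + LG) * W (z 0))) => // t t0.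
have [e1 _] := B t t0; have iab := Xt z sz t t0.
apply: (@le_trans _ _ ((CQ * gam^-1 + LG) * W (z t))); last first.
  by rewrite -mulrA ler_wpM2l ?BW // addr_ge0 // mulr_ge0 // ltW.
have -> : Q (x_ (z t)) - Q (Xi ifr) = (Q (x_ (z t)) - Q (Xi (if_ (z t)))) +
   (Q (Xi (if_ (z t))) - Q (Xi ifr)) by ring.
apply: le_trans (ler_normD _ _) _; rewrite mulrDl lerD //.
  have := pl_out pl iab e1; rewrite subrKC => /le_trans; apply.
  by rewrite -mulrA ler_wpM2l.
by apply: le_trans (pl_G pl iab ifrab) _; rewrite ler_wpM2l.
Qed.

End LowGain.

(** * Lipschitz and Taylor estimates for trigonometric functions *)

Section Trigonometry.
Variable R : realType.
Implicit Types x y l : R.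

Lemma mvt_bound (g dg : R -> R) (a b c : R) : a <= b ->
  (forall x, a <= x <= b -> is_derive x 1 g (dg x)) ->
  (forall x, a <= x <= b -> `|dg x| <= c) -> `|g b - g a| <= c * (b - a).
Proof.
move=> ab Hd Hc.
have cg : {within `[a, b], continuous g}.
  apply: derivable_within_continuous => x; rewrite in_itv /= => /Hd H.
  exact: ex_derive.
have Hd' x : x \in `]a, b[ -> is_derive x 1 g (dg x).
  by rewrite in_itv /= => /andP[ax xb]; apply: Hd; rewrite !ltW.
have [d dab ->] := MVT_segment ab Hd' cg.
by rewrite normrM [ `|b - a|]ger0_norm ?subr_ge0 // ler_wpM2r ?subr_ge0 ?Hc.
Qed.

Lemma mvt_lip (g dg : R -> R) (a b c : R) :
  (forall x, a <= x <= b -> is_derive x 1 g (dg x)) ->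
  (forall x, a <= x <= b -> `|dg x| <= c) ->
  forall x y, a <= x <= b -> a <= y <= b -> `|g x - g y| <= c * `|x - y|.
Proof.
move=> Hd Hc x y /andP[ax xb] /andP[ay yb]; wlog xy : x y ax xb ay yb / x <= y.
  move=> H; have [xy|yx] := leP x y; first exact: H.
  by rewrite distrC (distrC x); apply: H => //; exact: ltW.
rewrite distrC (distrC x) [ `|y - x|]ger0_norm ?subr_ge0 //.
by apply: mvt_bound => // u /andP[xu uy]; [apply: Hd|apply: Hc];
   rewrite (le_trans ax) // (le_trans uy).
Qed.

Lemma sin_lip x y : `|sin x - sin y| <= `|x - y|.
Proof.
rewrite -[leRHS]mul1r.
apply: (@mvt_lip sin cos (Num.min x y) (Num.max x y) 1).
- by move=> u _; exact: cos_max.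
- by rewrite ge_min le_max lexx.
- by rewrite ge_min le_max lexx !orbT.
Qed.

Lemma cos_lip x y : `|cos x - cos y| <= `|x - y|.
Proof.
rewrite -[leRHS]mul1r.
apply: (@mvt_lip cos (fun u => - sin u) (Num.min x y) (Num.max x y) 1).
- by move=> u _; rewrite normrN; exact: sin_max.
- by rewrite ge_min le_max lexx.
- by rewrite ge_min le_max lexx !orbT.
Qed.

Lemma cos_quadratic x : `|cos x - 1| <= x ^+ 2.
Proof.
have -> : x = (x / 2) *+ 2 by rewrite -mulr_natr divfK.
set y := x / 2; rewrite cos_mulr2n cos2sin2.
have -> : (1 - sin y ^+ 2) *+ 2 - 1 - 1 = - (2 * sin y ^+ 2) by ring.
rewrite normrN ger0_norm; last by apply: mulr_ge0 => //; exact: sqr_ge0.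
have H : `|sin y| <= `|y| by have := sin_lip y 0; rewrite sin0 !subr0.
have H2 : sin y ^+ 2 <= y ^+ 2.
  rewrite -[leLHS]real_normK ?num_real // -[leRHS]real_normK ?num_real //.
  by rewrite ler_pXn2r ?nnegrE.
have -> : (y *+ 2) ^+ 2 = 4 * y ^+ 2 by ring.
by have := sqr_ge0 y; lra.
Qed.

Lemma sin_quadratic x : `|x| <= 1 -> `|sin x - x| <= x ^+ 2.
Proof.
move=> x1; have H : `|(fun u => sin u - u) x - (fun u => sin u - u) 0| <= x ^+ 2 * `|x - 0|.
  apply: (@mvt_lip (fun u => sin u - u) (fun u => cos u - 1)
    (Num.min x 0) (Num.max x 0) (x ^+ 2)).
  - move=> u /andP[u1 u2]; apply: le_trans (cos_quadratic u) _.
    rewrite -[leLHS]real_normK ?num_real // -[leRHS]real_normK ?num_real //.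
    rewrite ler_pXn2r ?nnegrE //; move: u1 u2; rewrite /Num.min /Num.max /Order.min /Order.max.
    case: ltP => x0 u1 u2.
      by rewrite (ltr0_norm x0); apply/ler_normlP; split; lra.
    by rewrite (ger0_norm x0); apply/ler_normlP; split; lra.
  - by rewrite ge_min le_max lexx.
  - by rewrite ge_min le_max lexx !orbT.
move: H; rewrite /= sin0 !subr0 => /le_trans; apply.
by rewrite ler_piMr // sqr_ge0.
Qed.

Lemma sin_taylor (d e : R) : `|e| <= 1 ->
  `|sin (d + e) - sin d - cos d * e| <= 2 * e ^+ 2.
Proof.
move=> e1; rewrite sinD.
have -> : sin d * cos e + cos d * sin e - sin d - cos d * e =
  sin d * (cos e - 1) + cos d * (sin e - e) by ring.
apply: le_trans (ler_normD _ _) _; rewrite !normrM.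
have -> : 2 * e ^+ 2 = 1 * e ^+ 2 + 1 * e ^+ 2 by ring.
by apply: lerD; apply: ler_pM => //; [exact: sin_max|exact: cos_quadratic|
  exact: cos_max|exact: sin_quadratic].
Qed.

Lemma cos_taylor (d e : R) : `|e| <= 1 ->
  `|cos (d + e) - cos d + sin d * e| <= 2 * e ^+ 2.
Proof.
move=> e1; rewrite cosD.
have -> : cos d * cos e - sin d * sin e - cos d + sin d * e =
  cos d * (cos e - 1) - sin d * (sin e - e) by ring.
apply: le_trans (ler_normB _ _) _; rewrite !normrM.
have -> : 2 * e ^+ 2 = 1 * e ^+ 2 + 1 * e ^+ 2 by ring.
by apply: lerD; apply: ler_pM => //; [exact: cos_max|exact: cos_quadratic|
  exact: sin_max|exact: sin_quadratic].
Qed.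

(** The derivative of [acos] is unbounded near 1 and -1, hence the margin [l < 1]. *)
Lemma acos_lip l x y : l < 1 -> `|x| <= l -> `|y| <= l ->
  `|acos x - acos y| <= (Num.sqrt (1 - l ^+ 2))^-1 * `|x - y|.
Proof.
move=> l1 /ler_normlP[x1 x2] /ler_normlP[y1 y2].
have l0 : 0 <= l by lra.
apply: (@mvt_lip acos (fun u => - (Num.sqrt (1 - u ^+ 2))^-1) (- l) l).
- by move=> u /andP[u1 u2]; apply: is_derive1_acos; apply/andP; split; lra.
- move=> u /andP[u1 u2].
  have ul : u ^+ 2 <= l ^+ 2.
    rewrite -[leLHS]real_normK ?num_real // ler_pXn2r ?nnegrE //.
    by apply/ler_normlP; split; lra.
  have l2 : l ^+ 2 < 1 by rewrite expr_lt1.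
  rewrite normrN ger0_norm ?invr_ge0 ?sqrtr_ge0 // lef_pV2 ?posrE ?sqrtr_gt0; try lra.
  by rewrite ler_sqrt; lra.
- by apply/andP; split; lra.
- by apply/andP; split; lra.
Qed.

End Trigonometry.

(** * The algebra of bounded Lipschitz functions *)

Section BoundedLipschitz.
Variables (R : realType) (T : Type) (dist : T -> T -> R) (D : T -> Prop).
Hypothesis dist_ge0 : forall p q, 0 <= dist p q.
Implicit Types g : T -> R.

(** Bounded Lipschitz functions are closed under products, so estimates for explicit formulas follow
    term by term. [dist] is the distance of inputs for the equilibrium curve, and a sum of input and
    state distances for the vector field. *)
Definition blip g : Prop := exists2 K : R, 0 <= K &
  (forall p, D p -> `|g p| <= K) /\
  (forall p q, D p -> D q -> `|g p - g q| <= K * dist p q).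

Lemma blip_intro g (B K : R) : 0 <= K -> (forall p, D p -> `|g p| <= B) ->
  (forall p q, D p -> D q -> `|g p - g q| <= K * dist p q) -> blip g.
Proof.
move=> K0 HB HK; exists (`|B| + K); first by rewrite addr_ge0.
split=> [p Dp|p q Dp Dq].
  by apply: le_trans (HB p Dp) _; have := ler_norm B; lra.
by apply: le_trans (HK p q Dp Dq) _; rewrite ler_wpM2r // lerDr.
Qed.

Lemma blip_cst (c : R) : blip (fun=> c).
Proof.
apply: (@blip_intro _ `|c| 0) => // p q _ _.
by rewrite subrr normr0 mul0r.
Qed.

Lemma blipD g g' : blip g -> blip g' -> blip (fun p => g p + g' p).
Proof.
move=> [K K0 [B L]] [K' K'0 [B' L']]; apply: (@blip_intro _ (K + K') (K + K')).
- exact: addr_ge0.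
- by move=> p Dp; apply: le_trans (ler_normD _ _) _; rewrite lerD ?B ?B'.
- move=> p q Dp Dq; rewrite opprD addrACA mulrDl.
  by apply: le_trans (ler_normD _ _) _; rewrite lerD ?L ?L'.
Qed.

Lemma blipM g g' : blip g -> blip g' -> blip (fun p => g p * g' p).
Proof.
move=> [K K0 [B L]] [K' K'0 [B' L']]; apply: (@blip_intro _ (K * K') (K * K' *+ 2)).
- by rewrite mulrn_wge0 // mulr_ge0.
- by move=> p Dp; rewrite normrM ler_pM ?B ?B'.
- move=> p q Dp Dq.
  have -> : g p * g' p - g q * g' q = (g p - g q) * g' p + g q * (g' p - g' q) by ring.
  have -> : K * K' *+ 2 * dist p q = K * dist p q * K' + K * (K' * dist p q) by ring.
  apply: le_trans (ler_normD _ _) _; rewrite !normrM.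
  by apply: lerD; apply: ler_pM => //; rewrite ?L ?B' ?B ?L'.
Qed.

Lemma blipN g : blip g -> blip (fun p => - g p).
Proof.
move=> [K K0 [B L]]; exists K => //; split=> [p Dp|p q Dp Dq].
  by rewrite normrN B.
by rewrite -opprD normrN L.
Qed.

Lemma blip_comp (h : R -> R) (B l : R) g : blip g -> 0 <= l ->
  (forall p, D p -> `|h (g p)| <= B) ->
  (forall p q, D p -> D q -> `|h (g p) - h (g q)| <= l * `|g p - g q|) ->
  blip (fun p => h (g p)).
Proof.
move=> [K K0 [_ L]] l0 HB Hl; apply: (@blip_intro _ B (l * K)) => //.
  exact: mulr_ge0.
move=> p q Dp Dq; apply: le_trans (Hl p q Dp Dq) _.
by rewrite -mulrA ler_wpM2l // L.
Qed.

Lemma blip_sin g : blip g -> blip (fun p => sin (g p)).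
Proof.
move=> Hg; apply: (blip_comp (B := 1) (l := 1) Hg) => // [p _|p q _ _].
  exact: sin_max.
by rewrite mul1r; exact: sin_lip.
Qed.

Lemma blip_cos g : blip g -> blip (fun p => cos (g p)).
Proof.
move=> Hg; apply: (blip_comp (B := 1) (l := 1) Hg) => // [p _|p q _ _].
  exact: cos_max.
by rewrite mul1r; exact: cos_lip.
Qed.

Lemma blip_acos g (l : R) : l < 1 -> (forall p, D p -> `|g p| <= l) ->
  blip g -> blip (fun p => acos (g p)).
Proof.
move=> l1 Hl Hg.
apply: (blip_comp (B := pi) (l := (Num.sqrt (1 - l ^+ 2))^-1) Hg).
- by rewrite invr_ge0 sqrtr_ge0.
- move=> p Dp; have /ler_normlP[A1 A2] := Hl p Dp.
  have gi : -1 <= g p <= 1 by apply/andP; split; lra.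
  by rewrite ger0_norm ?acos_ge0 // acos_lepi.
- by move=> p q Dp Dq; apply: acos_lip => //; apply: Hl.
Qed.

Lemma blip_inv g (c : R) : 0 < c -> (forall p, D p -> c <= g p) -> blip g ->
  blip (fun p => (g p)^-1).
Proof.
move=> c0 Hc Hg; apply: (blip_comp (B := c^-1) (l := c^-1 ^+ 2) Hg).
- exact: sqr_ge0.
- move=> p Dp; have gc := Hc p Dp; have g0 := lt_le_trans c0 gc.
  by rewrite gtr0_norm ?invr_gt0 // lef_pV2.
- move=> p q Dp Dq; have gc := Hc p Dp; have g0 := lt_le_trans c0 gc.
  have gc' := Hc q Dq; have g0' := lt_le_trans c0 gc'.
  have -> : (g p)^-1 - (g q)^-1 = (g p)^-1 * (g q)^-1 * (g q - g p).
    by field; rewrite !gt_eqF.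
  rewrite normrM (distrC (g q)) ler_wpM2r // normrM !gtr0_norm ?invr_gt0 //.
  by rewrite expr2 ler_pM ?invr_ge0 ?(ltW g0) ?(ltW g0') // lef_pV2.
Qed.

End BoundedLipschitz.

Lemma lipschitz_within_continuous (R : realType) (lo hi K : R) (g : R -> R) :
  0 <= K -> (forall i j, lo <= i <= hi -> lo <= j <= hi ->
    `|g i - g j| <= K * `|i - j|) ->
  {within `[lo, hi], continuous g}.
Proof.
move=> K0 L; apply/subspace_continuousP => s /=; rewrite in_itv /= => sab.
apply/cvgrPdist_le => e e0; have K1 : 0 < K + 1 by lra.
apply/nbhs_ballP; exists (e / (K + 1)); first by rewrite /= divr_gt0.
move=> u /=; rewrite /ball /= => us; rewrite in_itv /= => uab.
apply: le_trans (L s u sab uab) _.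
apply: (@le_trans _ _ (K * (e / (K + 1)))); first by rewrite ler_wpM2l // ltW.
by rewrite mulrCA ler_piMr ?(ltW e0) // ler_pdivrMr // mul1r; lra.
Qed.

Lemma blip_pos_min (R : realType) (lo hi : R) (g : R -> R) : lo <= hi ->
  blip (fun i j => `|i - j|) (fun i => lo <= i <= hi) g ->
  (forall i, lo <= i <= hi -> 0 < g i) ->
  exists2 c, 0 < c & forall i, lo <= i <= hi -> c <= g i.
Proof.
move=> lohi [K K0 [_ L]] g0.
have cg := lipschitz_within_continuous K0 L.
have [c cab Hc] := EVT_min lohi cg.
exists (g c); first by apply: g0; rewrite in_itv in cab.
by move=> i iab; apply: Hc; rewrite in_itv.
Qed.

(** * Algebra behind the equilibria, the powers and the characteristic quartic *)

Section ScalarIdentities.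
Variable R : realType.
Implicit Types (z c s v w x y : R).

(* [c, s] are the cosine and sine of [phi]; the impedance is [z (c + i s)]. *)
Lemma load_angle_identity z c s v e iq id sd cd : z != 0 -> c != 0 ->
  c ^+ 2 + s ^+ 2 = 1 -> v != 0 ->
  - (z * c) * id + z * s * iq + v * sd = 0 ->
  - (z * s) * id - z * c * iq - e + v * cd = 0 ->
  cd * c - sd * s = (z * iq + c * e) / v.
Proof.
move=> z0 c0 cs v0 H1 H2.
have H : z * (v * (cd * c - sd * s)) = z * (z * iq + c * e).
  have -> : z * (z * iq + c * e) =
     z * (z * iq * (c ^+ 2 + s ^+ 2) + c * e) by rewrite cs; ring.
  have A : z * c * (- (z * s) * id - z * c * iq - e + v * cd)
     - z * s * (- (z * c) * id + z * s * iq + v * sd) = 0 by rewrite H1 H2; ring.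
  by lra.
move/(mulfI z0): H => H; rewrite -H; field; exact: v0.
Qed.

Lemma equilibrium_identity z c s v e iq sd cd : z != 0 -> c != 0 ->
  c ^+ 2 + s ^+ 2 = 1 -> v != 0 ->
  cd * c - sd * s = (z * iq + c * e) / v ->
  - (z * s) * ((z * s * iq + v * sd) / (z * c)) - z * c * iq - e + v * cd = 0.
Proof.
move=> z0 c0 cs v0 H.
have {}H : v * (cd * c - sd * s) = z * iq + c * e by rewrite H; field; exact: v0.
apply: (mulfI c0); rewrite mulr0.
have -> : c * (- (z * s) * ((z * s * iq + v * sd) / (z * c)) - z * c * iq - e + v * cd)
  = v * (cd * c - sd * s) - z * iq * (c ^+ 2 + s ^+ 2) - c * e.
  by field; rewrite c0 z0.
by rewrite H cs; ring.
Qed.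

(** [la] and [sa] are the cosine and sine of the load angle [delta + phi], and [e] is the induced
    voltage. The factors [2 * c * s] and [c ^+ 2 - s ^+ 2] are the sine and cosine of [2 phi]: the
    powers are coordinates in rotated axes. *)
Lemma reactive_power_identity z c s v e la sa : z != 0 -> c != 0 ->
  la ^+ 2 + sa ^+ 2 = 1 ->
  let iq := (v * la - c * e) / z in
  let sd := sa * c - la * s in let cd := la * c + sa * s in
  let id := (z * s * iq + v * sd) / (z * c) in
  v * (iq * sd - id * cd) =
  - (v ^+ 2 / (2 * (z * c)) - e * v / z * la) * (2 * c * s)
  - e * v / z * sa * (c ^+ 2 - s ^+ 2).
Proof.
move=> z0 c0 las iq sd cd id.
have -> : v * (iq * sd - id * cd) = - (v ^+ 2 * s / z) * (la ^+ 2 + sa ^+ 2)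
   - e * v / z * (sa * (c ^+ 2 - s ^+ 2) - la * (2 * c * s)).
  by rewrite /id /iq /sd /cd; field; rewrite c0 z0.
by rewrite las; field; rewrite c0 z0.
Qed.

Lemma active_power_identity z c s v e la sa : z != 0 -> c != 0 ->
  c ^+ 2 + s ^+ 2 = 1 -> la ^+ 2 + sa ^+ 2 = 1 ->
  let iq := (v * la - c * e) / z in
  let sd := sa * c - la * s in let cd := la * c + sa * s in
  let id := (z * s * iq + v * sd) / (z * c) in
  - v * (id * sd + iq * cd) + v ^+ 2 / (2 * (z * c)) =
  - (v ^+ 2 / (2 * (z * c)) - e * v / z * la) * (c ^+ 2 - s ^+ 2)
  + e * v / z * sa * (2 * c * s).
Proof.
move=> z0 c0 cs las iq sd cd id.
have -> : - v * (id * sd + iq * cd) + v ^+ 2 / (2 * (z * c)) =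
   - (v ^+ 2 * c / z) * (la ^+ 2 + sa ^+ 2)
   + e * v / z * (la * (c ^+ 2 - s ^+ 2) + sa * (2 * c * s)) + v ^+ 2 / (2 * (z * c)).
  by rewrite /id /iq /sd /cd; field; rewrite c0 z0.
rewrite las.
have -> : v ^+ 2 / (2 * (z * c)) =
  v ^+ 2 / (2 * (z * c)) * (c ^+ 2 + s ^+ 2) by rewrite cs mulr1.
have -> : - (v ^+ 2 * c / z) * 1 = - (v ^+ 2 / (2 * (z * c))) *
   ((c ^+ 2 - s ^+ 2) + (c ^+ 2 + s ^+ 2)) by field; rewrite c0 z0.
have -> : v ^+ 2 / (2 * (z * c)) * (c ^+ 2 + s ^+ 2) =
  v ^+ 2 / (2 * (z * c)) by rewrite cs mulr1.
by rewrite cs; ring.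
Qed.

(** On the upper half circle with polar angle [th] in ]0, pi[ the conclusion says
    [cos (th + 2 phi) < 0]. Only one end of this arc can be active, according to the sign of [c2];
    it is the one excluded by the hypothesis on [C]. Comparing squares avoids angles. *)
Lemma circle_sign C S r c2 s2 : C ^+ 2 + S ^+ 2 = r ^+ 2 -> 0 < S -> 0 < r ->
  c2 ^+ 2 + s2 ^+ 2 = 1 -> 0 < s2 ->
  (c2 < 0 /\ - (r * s2) < C) \/ (0 <= c2 /\ C < r * s2) ->
  0 < - C * c2 + S * s2.
Proof.
move=> CS S0 r0 cs s20 H; have Ss : 0 < S * s2 by rewrite mulr_gt0.
have [Cc|Cc] := leP (C * c2) 0; first lra.
have key : C ^+ 2 < (r * s2) ^+ 2.
  case: H => [[c20 HC]|[c20 HC]].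
    have C0 : C < 0 by rewrite -(nmulr_lgt0 _ c20).
    by rewrite -sqrrN ltr_pXn2r ?nnegrE //; lra.
  have c2p : 0 < c2 by rewrite lt_neqAle c20 andbT; apply: contraTneq Cc => <-; rewrite mulr0 ltxx.
  have C0 : 0 < C by rewrite -(pmulr_lgt0 _ c2p).
  by rewrite ltr_pXn2r ?nnegrE //; lra.
suff : (C * c2) ^+ 2 < (S * s2) ^+ 2.
  by rewrite ltr_pXn2r ?nnegrE ?(ltW Cc) ?(ltW Ss) //; lra.
have E : (S * s2) ^+ 2 - (C * c2) ^+ 2 = (r * s2) ^+ 2 - C ^+ 2.
  have -> : (S * s2) ^+ 2 = (r ^+ 2 - C ^+ 2) * s2 ^+ 2 by rewrite -CS; ring.
  have -> : (C * c2) ^+ 2 = C ^+ 2 * (1 - s2 ^+ 2) by rewrite -cs; ring.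
  by ring.
lra.
Qed.

(** An exact mean value formula on the circle: it bounds increments of the reactive power below
    without differentiating. *)
Lemma secant_identity Ci Cj Si Sj r c2 s2 :
  Ci ^+ 2 + Si ^+ 2 = r ^+ 2 -> Cj ^+ 2 + Sj ^+ 2 = r ^+ 2 ->
  ((- Cj * s2 - Sj * c2) - (- Ci * s2 - Si * c2)) * (Si + Sj) =
  (Ci - Cj) * ((- Ci * c2 + Si * s2) + (- Cj * c2 + Sj * s2)).
Proof.
move=> Hi Hj; have E : Si ^+ 2 - Sj ^+ 2 = Cj ^+ 2 - Ci ^+ 2 by lra.
have -> : ((- Cj * s2 - Sj * c2) - (- Ci * s2 - Si * c2)) * (Si + Sj) =
  (Ci - Cj) * s2 * (Si + Sj) + c2 * (Si ^+ 2 - Sj ^+ 2) by ring.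
by rewrite E; ring.
Qed.

(* Evaluates to the characteristic polynomial of the linearization at a
   nonnegative point; its value at 0 has the sign of [sin (delta + phi)]. *)
Lemma quartic_nonneg_root (d p w k a b c e : R) : 0 <= d -> 0 <= p -> 0 <= w ->
  0 <= k -> k * (p * b + w * e) <= 0 ->
  exists2 t, 0 <= t & (t + d) * t * ((t + p) ^+ 2 + w ^+ 2)
     + k * ((t + p) * (a * t + b) + w * (c * t + e)) = 0.
Proof.
move=> d0 p0 w0 k0 H.
pose P : {poly R} := ('X + d%:P) * 'X * (('X + p%:P) ^+ 2 + (w ^+ 2)%:P)
     + k *: (('X + p%:P) * (a *: 'X + b%:P) + w *: (c *: 'X + e%:P)).
have PE t : P.[t] = (t + d) * t * ((t + p) ^+ 2 + w ^+ 2)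
     + k * ((t + p) * (a * t + b) + w * (c * t + e)).
  by rewrite /P !hornerE.
(* At [T >= 1] the terms with factor [k] are at least [- (B * T ^+ 2)] and the rest is at least
   [T ^+ 4], so [T = 1 + B] is beyond a sign change. *)
pose B := k * ((1 + p) * (`|a| + `|b|) + w * (`|c| + `|e|)).
have B0 : 0 <= B by rewrite mulr_ge0 // addr_ge0 // mulr_ge0 // addr_ge0.
pose T := 1 + B; have T1 : 1 <= T by rewrite lerDl.
have T0 : 0 <= T := le_trans ler01 T1.
have PT : 0 <= P.[T].
  rewrite PE.
  have A1 : B * T ^+ 2 <= (T + d) * T * ((T + p) ^+ 2 + w ^+ 2).
    apply: (@le_trans _ _ (T * T * T ^+ 2)).
      rewrite ler_wpM2r ?sqr_ge0 //.
      apply: (@le_trans _ _ (B * T)); first by rewrite ler_peMr.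
      by rewrite ler_wpM2r // lerDr.
    apply: ler_pM; rewrite ?mulr_ge0 ?sqr_ge0 //.
      by rewrite ler_wpM2r // lerDl.
    apply: (@le_trans _ _ ((T + p) ^+ 2)); last by rewrite lerDl sqr_ge0.
    by rewrite ler_pXn2r ?nnegrE ?addr_ge0 // lerDl.
  have lin u v : - ((`|u| + `|v|) * T) <= u * T + v.
    have := ler_norm (- u); have := ler_norm (- v); rewrite !normrN => h1 h2.
    have : - u * T <= `|u| * T by rewrite ler_wpM2r.
    have : `|v| <= `|v| * T by rewrite ler_peMr.
    by lra.
  have A2 : - (B * T ^+ 2) <= k * ((T + p) * (a * T + b) + w * (c * T + e)).
    have -> : - (B * T ^+ 2) = k * - (((1 + p) * T) * ((`|a| + `|b|) * T)
      + w * ((`|c| + `|e|) * T) * T) by rewrite /B; ring.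
    rewrite ler_wpM2l // opprD lerD //.
      apply: (@le_trans _ _ ((T + p) * - ((`|a| + `|b|) * T))).
        rewrite mulrN lerN2 ler_wpM2r ?mulr_ge0 ?addr_ge0 //.
        by rewrite mulrDl mul1r lerD2l ler_peMr.
      by rewrite ler_wpM2l ?lin // addr_ge0.
    apply: (@le_trans _ _ (w * - ((`|c| + `|e|) * T))).
      by rewrite mulrN lerN2 ler_peMr // !mulr_ge0 // addr_ge0.
    by rewrite ler_wpM2l // lin.
  by lra.
have P0 : P.[0] <= 0.
  by rewrite PE; have -> : (0 + d) * 0 * ((0 + p) ^+ 2 + w ^+ 2) +
     k * ((0 + p) * (a * 0 + b) + w * (c * 0 + e)) = k * (p * b + w * e) by ring.
have := poly_ivt T0 (p := P); rewrite P0 PT => /(_ isT) [t /andP[t0 _] /rootP rt].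
by exists t => //; rewrite -PE.
Qed.

End ScalarIdentities.

(** * Coordinates of the machine state *)

Section State.
Variable R : realType.
Notation vec := 'cV[R]_4.
Implicit Types x v : vec.

Lemma id_mkstate (a b c d : R) : id_ (mkstate a b c d) = a.
Proof. by rewrite /id_ mxE. Qed.
Lemma iq_mkstate (a b c d : R) : iq_ (mkstate a b c d) = b.
Proof. by rewrite /iq_ mxE. Qed.
Lemma omega_mkstate (a b c d : R) : omega_ (mkstate a b c d) = c.
Proof. by rewrite /omega_ mxE. Qed.
Lemma delta_mkstate (a b c d : R) : delta_ (mkstate a b c d) = d.
Proof. by rewrite /delta_ mxE. Qed.

Definition mkstateE :=
  (id_mkstate, iq_mkstate, omega_mkstate, delta_mkstate).

Lemma state_forall (P : 'I_4 -> Prop) : P 0 -> P 1 -> P 2 -> P 3 -> forall j, P j.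
Proof.
move=> P0 P1 P2 P3 [[|[|[|[|//]]]] Hj].
- by have -> : Ordinal Hj = 0 by apply: val_inj.
- by have -> : Ordinal Hj = 1 by apply: val_inj.
- by have -> : Ordinal Hj = 2 by apply: val_inj.
- by have -> : Ordinal Hj = 3 by apply: val_inj.
Qed.

Lemma state_eq x y : id_ x = id_ y -> iq_ x = iq_ y -> omega_ x = omega_ y ->
  delta_ x = delta_ y -> x = y.
Proof.
move=> H0 H1 H2 H3; apply/matrixP => j k; rewrite (ord1 k).
by apply: (state_forall (P := fun j => x j 0 = y j 0)).
Qed.

Lemma state_norm_le x (c : R) : `|id_ x| <= c -> `|iq_ x| <= c ->
  `|omega_ x| <= c -> `|delta_ x| <= c -> `|x| <= c.
Proof.
move=> H0 H1 H2 H3; apply: norm_le_coord; first exact: le_trans (normr_ge0 _) H0.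
exact: (state_forall (P := fun j => `|x j 0| <= c)).
Qed.

Lemma idD x v : id_ (x + v) = id_ x + id_ v. Proof. by rewrite /id_ mxE. Qed.
Lemma iqD x v : iq_ (x + v) = iq_ x + iq_ v. Proof. by rewrite /iq_ mxE. Qed.
Lemma omegaD x v : omega_ (x + v) = omega_ x + omega_ v.
Proof. by rewrite /omega_ mxE. Qed.
Lemma deltaD x v : delta_ (x + v) = delta_ x + delta_ v.
Proof. by rewrite /delta_ mxE. Qed.
Lemma idN x : id_ (- x) = - id_ x. Proof. by rewrite /id_ mxE. Qed.
Lemma iqN x : iq_ (- x) = - iq_ x. Proof. by rewrite /iq_ mxE. Qed.
Lemma omegaN x : omega_ (- x) = - omega_ x. Proof. by rewrite /omega_ mxE. Qed.
Lemma deltaN x : delta_ (- x) = - delta_ x. Proof. by rewrite /delta_ mxE. Qed.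

Definition coordE := (idD, iqD, omegaD, deltaD, idN, iqN, omegaN, deltaN).

Lemma mkstateB (a b c d a' b' c' d' : R) :
  mkstate a b c d - mkstate a' b' c' d' = mkstate (a - a') (b - b') (c - c') (d - d').
Proof. by apply: state_eq; rewrite !coordE !mkstateE. Qed.

End State.

(** * Jacobian of the machine and its quadratic remainder *)

Section Linearization.
Variables (R : realType) (M : machine R).
Notation vec := 'cV[R]_4.

Definition jac_rows (i : R) (x : vec) : seq (seq R) :=
  [:: [:: - Rs M / Ls M; omega_ x; iq_ x; V M * cos (delta_ x) / Ls M];
      [:: - omega_ x; - Rs M / Ls M; - id_ x - mf M * i / Ls M;
          - (V M * sin (delta_ x) / Ls M)];
      [:: 0; mf M * i / J M; - Dp M / J M; 0];
      [:: 0; 0; 1; 0]].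

Definition jac (i : R) (x : vec) : 'M[R]_4 :=
  \matrix_(r, c) nth 0 (nth [::] (jac_rows i x) r) c.

Lemma jac_mul i x (v : vec) : jac i x *m v = mkstate
  (- Rs M / Ls M * id_ v + omega_ x * iq_ v + iq_ x * omega_ v
     + V M * cos (delta_ x) / Ls M * delta_ v)
  (- omega_ x * id_ v - Rs M / Ls M * iq_ v
     + (- id_ x - mf M * i / Ls M) * omega_ v
     - V M * sin (delta_ x) / Ls M * delta_ v)
  (mf M * i / J M * iq_ v - Dp M / J M * omega_ v)
  (omega_ v).
Proof.
have E r : (jac i x *m v) r 0 =
    nth 0 (nth [::] (jac_rows i x) r) 0 * id_ v +
    nth 0 (nth [::] (jac_rows i x) r) 1 * iq_ v +
    nth 0 (nth [::] (jac_rows i x) r) 2 * omega_ v +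
    nth 0 (nth [::] (jac_rows i x) r) 3 * delta_ v.
  rewrite mxE !big_ord_recl big_ord0 addr0 !mxE /= !addrA.
  have -> : lift ord0 ord0 = 1 :> 'I_4 by apply: val_inj.
  have -> : lift ord0 (lift ord0 ord0) = 2 :> 'I_4 by apply: val_inj.
  by have -> : lift ord0 (lift ord0 (lift ord0 ord0)) = 3 :> 'I_4 by apply: val_inj.
by apply: state_eq; rewrite mkstateE [LHS]E /=; ring.
Qed.

Hypothesis Ls0 : 0 < Ls M.
Hypothesis V0 : 0 < V M.

(** The nonlinear terms are the products of [omega] with a current, which contribute 1, and the sine
    and cosine of [delta], which contribute [2 * V M / Ls M]. *)
Lemma vfieldP_taylor i x (e : vec) : `|e| <= 1 ->
  `|vfieldP M i (x + e) - vfieldP M i x - jac i x *m e| <=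
  (1 + 2 * V M / Ls M) * `|e| ^+ 2.
Proof.
move=> e1.
have ed := coord_le_norm e 0; have eq := coord_le_norm e 1.
have eo := coord_le_norm e 2; have et := coord_le_norm e 3.
rewrite -/(id_ e) in ed; rewrite -/(iq_ e) in eq.
rewrite -/(omega_ e) in eo; rewrite -/(delta_ e) in et.
have t1 := le_trans et e1.
have S := sin_taylor (delta_ x) t1; have C := cos_taylor (delta_ x) t1.
have VL : 0 < V M / Ls M by rewrite divr_gt0.
have et2 : delta_ e ^+ 2 <= `|e| ^+ 2.
  by rewrite -[leLHS]real_normK ?num_real // ler_pXn2r ?nnegrE.
have n0 : 0 <= `|e| ^+ 2 by apply: sqr_ge0.
have K0 : 0 <= (1 + 2 * V M / Ls M) * `|e| ^+ 2.
  by rewrite mulr_ge0 //; rewrite -mulrA; lra.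
rewrite /vfieldP jac_mul !mkstateB.
have bnd (p q y : R) : `|p| <= `|e| -> `|q| <= `|e| -> `|y| <= 2 * delta_ e ^+ 2 ->
    `|p * q + V M / Ls M * y| <= (1 + 2 * V M / Ls M) * `|e| ^+ 2.
  move=> pe qe ye; apply: le_trans (ler_normD _ _) _; rewrite mulrDl mul1r lerD //.
    by rewrite normrM expr2 ler_pM.
  rewrite normrM gtr0_norm //.
  have -> : 2 * V M / Ls M * `|e| ^+ 2 = V M / Ls M * (2 * `|e| ^+ 2) by ring.
  by rewrite ler_pM2l //; apply: le_trans ye _; rewrite ler_pM2l.
apply: state_norm_le; rewrite mkstateE !coordE.
- have -> : (- Rs M * (id_ x + id_ e) + (omega_ x + omega_ e) * Ls M * (iq_ x + iq_ e) +
     V M * sin (delta_ x + delta_ e)) / Ls M -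
     (- Rs M * id_ x + omega_ x * Ls M * iq_ x + V M * sin (delta_ x)) / Ls M -
     (- Rs M / Ls M * id_ e + omega_ x * iq_ e + iq_ x * omega_ e +
      V M * cos (delta_ x) / Ls M * delta_ e) =
     omega_ e * iq_ e + V M / Ls M * (sin (delta_ x + delta_ e) - sin (delta_ x)
        - cos (delta_ x) * delta_ e) by field; rewrite gt_eqF.
  exact: bnd.
- have -> : (- (omega_ x + omega_ e) * Ls M * (id_ x + id_ e) - Rs M * (iq_ x + iq_ e) -
     mf M * i * (omega_ x + omega_ e) + V M * cos (delta_ x + delta_ e)) / Ls M -
     (- omega_ x * Ls M * id_ x - Rs M * iq_ x - mf M * i * omega_ x +
      V M * cos (delta_ x)) / Ls M -
     (- omega_ x * id_ e - Rs M / Ls M * iq_ e +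
      (- id_ x - mf M * i / Ls M) * omega_ e -
      V M * sin (delta_ x) / Ls M * delta_ e) =
     (- omega_ e) * id_ e + V M / Ls M * (cos (delta_ x + delta_ e) - cos (delta_ x)
        + sin (delta_ x) * delta_ e) by field; rewrite gt_eqF.
  by apply: bnd; rewrite ?normrN.
- by rewrite (_ : _ - _ = 0) ?normr0 //; ring.
- by rewrite (_ : _ - _ = 0) ?normr0 //; ring.
Qed.

End Linearization.

(** * Equilibria of the machine and the sign of the load angle *)

Section Equilibria.
Variables (R : realType) (M : machine R).
Notation vec := 'cV[R]_4.
Hypothesis hpos : positive_parameters M.

Let Rs0 : 0 < Rs M. Proof. by have [[]] := hpos. Qed.
Let Ls0 : 0 < Ls M. Proof. by have [[]] := hpos. Qed.
Let J0 : 0 < J M. Proof. by have [[]] := hpos. Qed.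
Let mf0 : 0 < mf M. Proof. by have [[]] := hpos. Qed.
Let Dp0 : 0 < Dp M. Proof. by have [[]] := hpos. Qed.
Let V0 : 0 < V M. Proof. by have [_ []] := hpos. Qed.
Let wg0 : 0 < wg M. Proof. by have [_ []] := hpos. Qed.

(** Modulus of the stator impedance [Rs + i wg Ls], whose argument is [phi]. *)
Definition impedance : R := Num.sqrt (Rs M ^+ 2 + (wg M * Ls M) ^+ 2).
Definition cos_phi : R := Rs M / impedance.
Definition sin_phi : R := wg M * Ls M / impedance.
Definition emf (i : R) : R := mf M * i * wg M.
Definition iq_eq (i : R) : R := - (Tmt M / (mf M * i)).

Lemma impedance_gt0 : 0 < impedance.
Proof. by rewrite sqrtr_gt0 ltr_wpDr ?sqr_ge0 // exprn_gt0. Qed.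

Let z0 := impedance_gt0.
Let zn0 : impedance != 0. Proof. by rewrite gt_eqF. Qed.

Lemma cos_phi_gt0 : 0 < cos_phi. Proof. by rewrite divr_gt0. Qed.
Lemma sin_phi_gt0 : 0 < sin_phi. Proof. by rewrite divr_gt0 // mulr_gt0. Qed.

Lemma impedance_cos : impedance * cos_phi = Rs M.
Proof. by rewrite mulrC divfK. Qed.
Lemma impedance_sin : impedance * sin_phi = wg M * Ls M.
Proof. by rewrite mulrC divfK. Qed.

Lemma impedance_sqr : impedance ^+ 2 = Rs M ^+ 2 + (wg M * Ls M) ^+ 2.
Proof. by rewrite sqr_sqrtr // addr_ge0 ?sqr_ge0. Qed.

Lemma cos2_sin2_phi : cos_phi ^+ 2 + sin_phi ^+ 2 = 1.
Proof.
have -> : cos_phi ^+ 2 + sin_phi ^+ 2 =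
    (Rs M ^+ 2 + (wg M * Ls M) ^+ 2) / impedance ^+ 2.
  by rewrite /cos_phi /sin_phi; field.
by rewrite -impedance_sqr divff // expf_neq0.
Qed.

Lemma cos_phiE : cos (phi M) = cos_phi.
Proof.
rewrite /phi cos_atan.
have -> : 1 + (wg M * Ls M / Rs M) ^+ 2 = (impedance / Rs M) ^+ 2.
  rewrite [RHS]exprMn impedance_sqr; field; rewrite gt_eqF //.
by rewrite sqrtr_sqr gtr0_norm ?divr_gt0 // invf_div.
Qed.

Lemma sin_phiE : sin (phi M) = sin_phi.
Proof.
have c0 : cos (phi M) != 0 by rewrite cos_phiE gt_eqF // cos_phi_gt0.
have : tan (phi M) = wg M * Ls M / Rs M by rewrite /phi atanK.
rewrite /tan => /(congr1 (fun y => y * cos (phi M))); rewrite divfK // => ->.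
by rewrite cos_phiE /cos_phi /sin_phi; field; rewrite zn0 gt_eqF.
Qed.

Lemma LambdaE i : 0 < i ->
  Lambda M i = (impedance * iq_eq i + cos_phi * emf i) / V M.
Proof.
move=> i0; rewrite /Lambda.
have -> : pr M ^+ 2 + wg M ^+ 2 = (impedance / Ls M) ^+ 2.
  by rewrite [RHS]exprMn impedance_sqr /pr; field; rewrite gt_eqF.
rewrite sqrtr_sqr gtr0_norm ?divr_gt0 // /pr /iq_eq /emf /cos_phi.
by field; rewrite zn0 !gt_eqF.
Qed.

(** Sine of the load angle [acos (Lambda M i)]; nonnegative since that angle lies in [0, pi]. *)
Definition sin_load (i : R) : R := Num.sqrt (1 - Lambda M i ^+ 2).

Lemma cos2_sin2_load i : `|Lambda M i| <= 1 ->
  Lambda M i ^+ 2 + sin_load i ^+ 2 = 1.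
Proof.
move=> l1; rewrite sqr_sqrtr ?subrKC // subr_ge0.
by rewrite -[leLHS]real_normK ?num_real // exprn_ile1.
Qed.

Let Lambda_itv i : `|Lambda M i| <= 1 -> -1 <= Lambda M i <= 1.
Proof. by rewrite ler_norml. Qed.

Lemma cos_delta1 i : `|Lambda M i| <= 1 ->
  cos (delta1 M i) = Lambda M i * cos_phi + sin_load i * sin_phi.
Proof.
move=> l1; rewrite /delta1 cosB cos_phiE sin_phiE sin_acos ?Lambda_itv //.
by rewrite acosK ?in_itv //= Lambda_itv.
Qed.

Lemma sin_delta1 i : `|Lambda M i| <= 1 ->
  sin (delta1 M i) = sin_load i * cos_phi - Lambda M i * sin_phi.
Proof.
move=> l1; rewrite /delta1 sinB cos_phiE sin_phiE sin_acos ?Lambda_itv //.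
by rewrite acosK ?in_itv //= Lambda_itv.
Qed.

Lemma id_Xi i : 0 < i -> id_ (Xi M i) =
  (impedance * sin_phi * iq_eq i + V M * sin (delta1 M i)) / (impedance * cos_phi).
Proof.
move=> i0; rewrite /Xi mkstateE impedance_cos impedance_sin /iq_eq /pr.
by field; rewrite !gt_eqF.
Qed.

Lemma iq_Xi i : iq_ (Xi M i) = iq_eq i. Proof. by rewrite /Xi mkstateE. Qed.
Lemma omega_Xi i : omega_ (Xi M i) = wg M. Proof. by rewrite /Xi mkstateE. Qed.
Lemma delta_Xi i : delta_ (Xi M i) = delta1 M i.
Proof. by rewrite /Xi mkstateE. Qed.

Lemma load_angle i : 0 < i -> `|Lambda M i| <= 1 ->
  cos (delta1 M i) * cos_phi - sin (delta1 M i) * sin_phi =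
  (impedance * iq_eq i + cos_phi * emf i) / V M.
Proof.
move=> i0 l1; rewrite -LambdaE // cos_delta1 // sin_delta1 //.
have -> : (Lambda M i * cos_phi + sin_load i * sin_phi) * cos_phi -
  (sin_load i * cos_phi - Lambda M i * sin_phi) * sin_phi =
  Lambda M i * (cos_phi ^+ 2 + sin_phi ^+ 2) by ring.
by rewrite cos2_sin2_phi mulr1.
Qed.

Lemma Xi_equilibrium i : 0 < i -> `|Lambda M i| <= 1 -> vfieldP M i (Xi M i) = 0.
Proof.
move=> i0 l1; have c0 : cos_phi != 0 by rewrite gt_eqF // cos_phi_gt0.
have L := load_angle i0 l1.
have E2 := equilibrium_identity zn0 c0 cos2_sin2_phi (lt0r_neq0 V0) L.
have zero (a b c d : R) : a = 0 -> b = 0 -> c = 0 -> d = 0 ->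
    mkstate a b c d = 0 :> vec.
  by move=> -> -> -> ->; apply: state_eq; rewrite mkstateE /id_ /iq_ /omega_ /delta_ mxE.
rewrite /vfieldP; apply: zero; rewrite ?omega_Xi ?subrr //.
- rewrite id_Xi // iq_Xi delta_Xi impedance_cos impedance_sin.
  by field; rewrite !gt_eqF.
- rewrite id_Xi // iq_Xi delta_Xi.
  move: E2; rewrite impedance_cos impedance_sin /emf => E2.
  apply/eqP; rewrite mulf_eq0; apply/orP; left; apply/eqP.
  by rewrite -E2; ring.
- by rewrite iq_Xi /iq_eq /Tmt; field; rewrite !gt_eqF.
Qed.

(** Once the cosine of [delta + phi] is fixed, only the sign of its sine distinguishes equilibria,
    up to multiples of 2 pi in [delta]. *)
Lemma equilibriumP i (x : vec) : 0 < i -> vfieldP M i x = 0 ->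
  [/\ omega_ x = wg M, iq_ x = iq_eq i,
    id_ x = (impedance * sin_phi * iq_eq i + V M * sin (delta_ x)) /
       (impedance * cos_phi) &
    cos (delta_ x + phi M) = Lambda M i].
Proof.
move=> i0 /matrixP E.
have := E 0 0; have := E 1 0; have := E 2 0; have := E 3 0; rewrite !mxE /=.
move=> /eqP; rewrite subr_eq0 => /eqP E3; rewrite E3.
move/eqP; rewrite mulf_eq0 invr_eq0 (gt_eqF J0) orbF => /eqP E2.
move/eqP; rewrite mulf_eq0 invr_eq0 (gt_eqF Ls0) orbF => /eqP E1.
move/eqP; rewrite mulf_eq0 invr_eq0 (gt_eqF Ls0) orbF => /eqP E0.
have iqE : iq_ x = iq_eq i.
  have mi : mf M * i != 0 by rewrite mulf_neq0 // gt_eqF.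
  apply: (mulfI mi); rewrite /iq_eq mulrN mulrCA divff // mulr1 /Tmt.
  by lra.
have c0 : cos_phi != 0 by rewrite gt_eqF // cos_phi_gt0.
split=> //.
- rewrite impedance_cos impedance_sin -iqE.
  apply: (mulIf (lt0r_neq0 Rs0)); rewrite divfK ?gt_eqF //; lra.
- rewrite cosD cos_phiE sin_phiE LambdaE // -iqE.
  apply: (@load_angle_identity _ _ _ _ _ _ _ (id_ x)) => //.
  + exact: cos2_sin2_phi.
  + by rewrite gt_eqF.
  + by rewrite impedance_cos impedance_sin.
  + by rewrite impedance_cos impedance_sin /emf -E1; ring.
Qed.

(** On such an eigenvector the Euler map acts as multiplication by [1 + h * t >= 1], so none of its
    powers can halve it. *)
Lemma contractive_no_eigenvalue (A : 'M[R]_4) (t : R) (v : vec) :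
  euler_contractive A -> 0 <= t -> A *m v = t *: v -> v = 0.
Proof.
move=> [h h0 [m [_ H]]] t0 Av.
have aux (y : R) : y <= y / 2 -> y <= 0 by move=> ?; lra.
have E k : (1 + h *: A) ^+ k *m v = (1 + h * t) ^+ k *: v.
  elim: k => [|k IH]; first by rewrite !expr0 mul1mx scale1r.
  rewrite exprS -mulmxE -mulmxA IH -scalemxAr mulmxDl mul1mx -scalemxAl Av.
  by rewrite scalerA -{1}[v]scale1r -scalerDl scalerA -exprSr.
have := H v; rewrite E norm_scale; last by rewrite exprn_ge0 // addr_ge0 // mulr_ge0 // ltW.
have : 1 <= (1 + h * t) ^+ m by rewrite exprn_ege1 // lerDl mulr_ge0 // ltW.
move=> /(ler_wpM2r (normr_ge0 v)) h1 h2.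
rewrite mul1r in h1; apply/eqP; rewrite -normr_le0.
exact: aux (le_trans h1 h2).
Qed.

Lemma contractive_load_angle i (x : vec) : 0 < i -> omega_ x = wg M ->
  euler_contractive (jac M i x) -> 0 < sin (delta_ x + phi M).
Proof.
move=> i0 xw HA; rewrite ltNge; apply/negP => sle.
pose p := Rs M / Ls M; have p0 : 0 <= p by rewrite divr_ge0 // ltW.
pose k := mf M * i / J M; have k0 : 0 <= k by rewrite divr_ge0 ?mulr_ge0 // ltW.
pose d := Dp M / J M; have d0 : 0 <= d by rewrite divr_ge0 // ltW.
pose a1 := id_ x + mf M * i / Ls M; pose b1 := V M * sin (delta_ x) / Ls M.
pose e1 := V M * cos (delta_ x) / Ls M.
(* The constant term of the quartic: a positive multiple of [sin (delta + phi)]. *)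
have H0 : k * (p * b1 + wg M * e1) <= 0.
  have -> : p * b1 + wg M * e1 =
      V M * impedance / Ls M ^+ 2 * sin (delta_ x + phi M).
    rewrite sinD cos_phiE sin_phiE /p /b1 /e1 /cos_phi /sin_phi.
    by field; rewrite zn0 gt_eqF.
  rewrite mulrA; apply: mulr_ge0_le0 => //; apply: mulr_ge0 => //.
  by rewrite divr_ge0 ?mulr_ge0 ?sqr_ge0 // ltW.
have [t t0 Ht] := quartic_nonneg_root a1 (iq_ x) d0 p0 (ltW wg0) k0 H0.
pose q := (t + p) ^+ 2 + wg M ^+ 2.
have q0 : 0 < q by rewrite ltr_wpDl ?sqr_ge0 // exprn_gt0.
pose r1 := iq_ x * t + e1; pose r2 := - a1 * t - b1.
(* Set [delta = q] and [omega = t * q]; the currents follow by Cramer's rule from the electrical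
   block, whose determinant is [q]. The remaining torque equation is the quartic at [t]. *)
pose v : vec := mkstate ((t + p) * r1 + wg M * r2) ((t + p) * r2 - wg M * r1)
   (t * q) q.
have Av : jac M i x *m v = t *: v.
  have scaleE (a b c e : R) : t *: mkstate a b c e =
      mkstate (t * a) (t * b) (t * c) (t * e) :> vec.
    by apply: state_eq; rewrite mkstateE /id_ /iq_ /omega_ /delta_ !mxE.
  rewrite jac_mul /v !mkstateE scaleE xw.
  have Ep : - Rs M / Ls M = - p by rewrite mulNr.
  have Ek : mf M * i / J M = k by [].
  have Ed : Dp M / J M = d by [].
  have Ee : V M * cos (delta_ x) / Ls M = e1 by [].
  have Eb : V M * sin (delta_ x) / Ls M = b1 by [].
  have Ea : - id_ x - mf M * i / Ls M = - a1 by rewrite /a1 opprD.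
  rewrite Ep Ek Ed Ee Eb Ea -/p; apply: state_eq; rewrite !mkstateE.
  + by rewrite /q /r1 /r2; ring.
  + by rewrite /q /r1 /r2; ring.
  + apply/eqP; rewrite -subr_eq0 -oppr_eq0; apply/eqP; rewrite -[RHS]Ht.
    by rewrite /q /r1 /r2; ring.
  + by [].
have v0 := contractive_no_eigenvalue HA t0 Av.
have : delta_ v = 0 by rewrite v0 /delta_ mxE.
by rewrite /v mkstateE => q00; rewrite q00 ltxx in q0.
Qed.

(** The Jacobian sees [delta] only through its sine and cosine, hence does not notice a shift by a
    multiple of 2 pi. *)
Lemma jac_Xi i (x : vec) : 0 < i -> vfieldP M i x = 0 ->
  0 < sin (delta_ x + phi M) -> `|Lambda M i| < 1 /\ jac M i (Xi M i) = jac M i x.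
Proof.
move=> i0 Ex s0; have [xw xq xd xL] := equilibriumP i0 Ex.
have cs := cos2Dsin2 (delta_ x + phi M); rewrite xL in cs.
have l1 : `|Lambda M i| < 1.
  rewrite -(expr_lt1 (n := 2)) // real_normK ?num_real //.
  by have := exprn_gt0 2 s0; lra.
split=> //; have sE : sin_load i = sin (delta_ x + phi M).
  rewrite /sin_load; have -> : 1 - Lambda M i ^+ 2 = sin (delta_ x + phi M) ^+ 2 by lra.
  by rewrite sqrtr_sqr gtr0_norm.
have dE : delta_ x = (delta_ x + phi M) - phi M by rewrite addrK.
have cE : cos (delta1 M i) = cos (delta_ x).
  by rewrite cos_delta1 ?ltW // [in RHS]dE cosB cos_phiE sin_phiE xL sE.
have snE : sin (delta1 M i) = sin (delta_ x).
  by rewrite sin_delta1 ?ltW // [in RHS]dE sinB cos_phiE sin_phiE xL sE.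
have idE : id_ (Xi M i) = id_ x by rewrite id_Xi // xd snE.
rewrite /jac /jac_rows omega_Xi iq_Xi delta_Xi idE cE snE.
by rewrite -xq -xw.
Qed.

Lemma stable_equilibrium_Xi i (xe : vec) : 0 < i ->
  exp_stable_equilibrium (vfieldP M i) setT xe ->
  `|Lambda M i| < 1 /\ euler_contractive (jac M i (Xi M i)).
Proof.
move=> i0 st; have Ex : vfieldP M i xe = 0 by have [[]] := st.
have C0 : 0 <= 1 + 2 * V M / Ls M by rewrite addr_ge0 // divr_ge0 ?mulr_ge0 // ltW.
have HA : euler_contractive (jac M i xe).
  apply: (exp_stable_euler ltr01 C0 _ st) => e e1.
  by have := vfieldP_taylor Ls0 V0 i xe e1; rewrite Ex subr0.
have [xw _ _ _] := equilibriumP i0 Ex.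
have [l1 jE] := jac_Xi i0 Ex (contractive_load_angle i0 xw HA).
by rewrite jE.
Qed.

End Equilibria.

(** * Lipschitz bounds for the machine field and output *)

Section StateLipschitz.
Variables (R : realType) (T : Type) (dist : T -> T -> R) (D : T -> Prop).
Hypothesis dist_ge0 : forall p q, 0 <= dist p q.

Lemma blip_state (y : T -> 'cV[R]_4) :
  blip dist D (fun p => id_ (y p)) -> blip dist D (fun p => iq_ (y p)) ->
  blip dist D (fun p => omega_ (y p)) -> blip dist D (fun p => delta_ (y p)) ->
  exists2 K : R, 0 <= K & (forall p, D p -> `|y p| <= K) /\
    (forall p q, D p -> D q -> `|y p - y q| <= K * dist p q).
Proof.
move=> [K0 K00 [B0 L0]] [K1 K10 [B1 L1]] [K2 K20 [B2 L2]] [K3 K30 [B3 L3]].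
have k0 : K0 <= K0 + K1 + K2 + K3 by lra.
have k1 : K1 <= K0 + K1 + K2 + K3 by lra.
have k2 : K2 <= K0 + K1 + K2 + K3 by lra.
have k3 : K3 <= K0 + K1 + K2 + K3 by lra.
exists (K0 + K1 + K2 + K3); first by lra.
split=> [p Dp|p q Dp Dq]; apply: state_norm_le; rewrite ?coordE.
- exact: le_trans (B0 p Dp) k0.
- exact: le_trans (B1 p Dp) k1.
- exact: le_trans (B2 p Dp) k2.
- exact: le_trans (B3 p Dp) k3.
- by apply: le_trans (L0 p q Dp Dq) _; rewrite ler_wpM2r.
- by apply: le_trans (L1 p q Dp Dq) _; rewrite ler_wpM2r.
- by apply: le_trans (L2 p q Dp Dq) _; rewrite ler_wpM2r.
- by apply: le_trans (L3 p q Dp Dq) _; rewrite ler_wpM2r.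
Qed.

End StateLipschitz.

Section FieldLipschitz.
Variables (R : realType) (M : machine R) (lo hi B : R).
Notation vec := 'cV[R]_4.

Let dist (p q : R * vec) : R := `|p.1 - q.1| + `|p.2 - q.2|.
Let D (p : R * vec) : Prop := lo <= p.1 <= hi /\ `|p.2| <= B.
Let dist_ge0 p q : 0 <= dist p q. Proof. by rewrite addr_ge0. Qed.
Let bl := blip dist D.

Let bc x : bl (fun=> x) := blip_cst D dist_ge0 x.
Let bD g h : bl g -> bl h -> bl (fun p => g p + h p) := @blipD _ _ _ _ dist_ge0 g h.
Let bM g h : bl g -> bl h -> bl (fun p => g p * h p) := @blipM _ _ _ _ dist_ge0 g h.
Let bN g : bl g -> bl (fun p => - g p) := @blipN _ _ _ _ g.

Let coord j : bl (fun p => p.2 j 0).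
Proof.
apply: (@blip_intro _ _ _ _ dist_ge0 _ B 1) => // [p [_ pB]|p q _ _].
  exact: le_trans (coord_le_norm _ _) pB.
rewrite mul1r; have := coord_le_norm (p.2 - q.2) j; rewrite !mxE => /le_trans; apply.
by rewrite lerDr.
Qed.

Let input : bl (fun p => p.1).
Proof.
apply: (@blip_intro _ _ _ _ dist_ge0 _ (`|lo| + `|hi|) 1) => // [p [/andP[p1 p2] _]|p q _ _].
  have := ler_norm hi; have := ler_norm (- lo); rewrite normrN => h1 h2.
  by have := normr_ge0 lo; have := normr_ge0 hi => *; apply/ler_normlP; split; lra.
by rewrite mul1r lerDl.
Qed.

Let bd : bl (fun p => id_ p.2) := coord 0.
Let bq : bl (fun p => iq_ p.2) := coord 1.
Let bo : bl (fun p => omega_ p.2) := coord 2.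
Let bt : bl (fun p => delta_ p.2) := coord 3.
Let bs : bl (fun p => sin (delta_ p.2)) := blip_sin dist_ge0 bt.
Let bcs : bl (fun p => cos (delta_ p.2)) := blip_cos dist_ge0 bt.

Let lipschitz_ball (f : R -> vec -> vec) : Prop :=
  exists2 K : R, 0 <= K & forall (i j : R) (x y : vec),
    lo <= i <= hi -> lo <= j <= hi -> `|x| <= B -> `|y| <= B ->
    `|f i x - f j y| <= K * (`|i - j| + `|x - y|).

Let lipschitz_ball_coord f :
  bl (fun p => id_ (f p.1 p.2)) -> bl (fun p => iq_ (f p.1 p.2)) ->
  bl (fun p => omega_ (f p.1 p.2)) -> bl (fun p => delta_ (f p.1 p.2)) ->
  lipschitz_ball f.
Proof.
move=> f0 f1 f2 f3; have [K K0 [_ HK]] := blip_state dist_ge0 f0 f1 f2 f3.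
by exists K => // i j x y iab jab xB yB; exact: (HK (i, x) (j, y)).
Qed.

Lemma vfieldP_lipschitz_ball : lipschitz_ball (vfieldP M).
Proof.
apply: lipschitz_ball_coord; under eq_fun do rewrite /vfieldP mkstateE.
- by apply: bM => //; apply: bD; [apply: bD|]; apply: bM => //; apply: bM.
- apply: bM => //; apply: bD; last exact: bM.
  apply: bD; last by apply: bN; apply: bM => //; apply: bM.
  apply: bD; last by apply: bN; apply: bM.
  by apply: bM => //; apply: bM => //; apply: bN.
- apply: bM => //; apply: bD => //; apply: bD => //; apply: bD.
    by apply: bM => //; apply: bM.
  by apply: bN; apply: bM.
- exact: bD.
Qed.

Lemma outQ_lipschitz_ball : lipschitz_ball (fun _ x => const_mx (outQ M x)).
Proof.
have bQ : bl (fun p => outQ M p.2).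
  rewrite /outQ; apply: bM => //; apply: bD; first exact: bM.
  by apply: bN; apply: bM.
apply: lipschitz_ball_coord.
- by under eq_fun do rewrite /id_ mxE.
- by under eq_fun do rewrite /iq_ mxE.
- by under eq_fun do rewrite /omega_ mxE.
- by under eq_fun do rewrite /delta_ mxE.
Qed.

End FieldLipschitz.

Lemma vfieldP_lipschitz (R : realType) (M : machine R) (lo hi : R) :
  lipschitz_on_bounded (vfieldP M) lo hi.
Proof. by move=> B _; exact: vfieldP_lipschitz_ball. Qed.

Lemma outQ_lipschitz (R : realType) (M : machine R) (lo hi : R) :
  lipschitz_on_bounded (fun _ x => const_mx (outQ M x)) lo hi.
Proof. by move=> B _; exact: outQ_lipschitz_ball. Qed.

(** * Equilibrium powers on a circle and monotonicity of [G] *)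

Section PowerCircle.
Variables (R : realType) (M : machine R).
Notation vec := 'cV[R]_4.
Hypothesis hpos : positive_parameters M.
Hypothesis hT : - V M ^+ 2 < 4 * Rs M * wg M * Tmt M.

Let Rs0 : 0 < Rs M. Proof. by have [[]] := hpos. Qed.
Let Ls0 : 0 < Ls M. Proof. by have [[]] := hpos. Qed.
Let mf0 : 0 < mf M. Proof. by have [[]] := hpos. Qed.
Let V0 : 0 < V M. Proof. by have [_ []] := hpos. Qed.
Let wg0 : 0 < wg M. Proof. by have [_ []] := hpos. Qed.
Let z := impedance M.
Let c := cos_phi M.
Let s := sin_phi M.
Let z0 : 0 < z := impedance_gt0 hpos.
Let c0 : 0 < c := cos_phi_gt0 hpos.
Let s0 : 0 < s := sin_phi_gt0 hpos.
Let zn : z != 0. Proof. by rewrite gt_eqF. Qed.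
Let cn : c != 0. Proof. by rewrite gt_eqF. Qed.
Let cs : c ^+ 2 + s ^+ 2 = 1 := cos2_sin2_phi hpos.

(* At the equilibrium [Xi i] the powers (P, Q) lie on the circle with centre
   [(- circle_shift, 0)] and radius [radS]; [(chord, perp)] are the coordinates
   of (P, Q) - centre in axes rotated by twice the impedance angle. *)
Definition circle_shift : R := V M ^+ 2 / (2 * Rs M).
Definition chord (i : R) : R := circle_shift - emf M i * V M / z * Lambda M i.
Definition perp (i : R) : R := emf M i * V M / z * sin_load M i.

Let shiftE : circle_shift = V M ^+ 2 / (2 * (z * c)).
Proof. by rewrite /circle_shift -(impedance_cos hpos). Qed.

Let iq_load i : 0 < i -> iq_eq M i = (V M * Lambda M i - c * emf M i) / z.
Proof.
by move=> i0; rewrite (LambdaE hpos i0) -/z -/c; field; rewrite zn gt_eqF.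
Qed.

Let id_load i : 0 < i -> id_ (Xi M i) =
  (z * s * iq_eq M i + V M * sin (delta1 M i)) / (z * c).
Proof. by move=> i0; rewrite (id_Xi hpos). Qed.

Lemma G_chord i : 0 < i -> `|Lambda M i| <= 1 ->
  G M i = - chord i * (2 * c * s) - perp i * (c ^+ 2 - s ^+ 2).
Proof.
move=> i0 l1; rewrite /G /outQ iq_Xi delta_Xi id_load // iq_load //.
rewrite (cos_delta1 hpos l1) (sin_delta1 hpos l1) /chord /perp shiftE.
exact: (reactive_power_identity s (V M) (emf M i) zn cn (cos2_sin2_load l1)).
Qed.

Lemma outP_chord i : 0 < i -> `|Lambda M i| <= 1 ->
  outP M (Xi M i) + circle_shift =
  - chord i * (c ^+ 2 - s ^+ 2) + perp i * (2 * c * s).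
Proof.
move=> i0 l1; rewrite /outP iq_Xi delta_Xi id_load // iq_load //.
rewrite (cos_delta1 hpos l1) (sin_delta1 hpos l1) /chord /perp shiftE.
exact: (active_power_identity (V M) (emf M i) zn cn cs (cos2_sin2_load l1)).
Qed.

(** In terms of the input, [chord] is a constant minus a multiple of [i ^+ 2], hence a monotone
    coordinate along the circle. *)
Lemma chordE i : 0 < i ->
  chord i = circle_shift + Tmt M * wg M - emf M i ^+ 2 * c / z.
Proof.
move=> i0; rewrite /chord (LambdaE hpos i0) -/z -/c /iq_eq /emf.
by field; rewrite zn !gt_eqF.
Qed.

Let rad2_gt0 : 0 < V M ^+ 4 + 4 * V M ^+ 2 * Rs M * Tmt M * wg M.
Proof.
have -> : V M ^+ 4 + 4 * V M ^+ 2 * Rs M * Tmt M * wg M =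
  V M ^+ 2 * (V M ^+ 2 + 4 * Rs M * wg M * Tmt M) by ring.
by rewrite mulr_gt0 ?exprn_gt0 //; move: hT; rewrite -subr_gt0 opprK addrC.
Qed.

Lemma radS_gt0 : 0 < radS M.
Proof. by rewrite /radS divr_gt0 ?mulr_gt0 // sqrtr_gt0. Qed.

Lemma power_circle i : 0 < i -> `|Lambda M i| <= 1 ->
  chord i ^+ 2 + perp i ^+ 2 = radS M ^+ 2.
Proof.
move=> i0 l1.
have -> : radS M ^+ 2 = circle_shift ^+ 2 + V M ^+ 2 * (Tmt M * wg M) / Rs M.
  rewrite /radS exprMn sqr_sqrtr ?(ltW rad2_gt0) // /circle_shift.
  by field; rewrite gt_eqF.
have -> : perp i ^+ 2 = (emf M i * V M / z) ^+ 2 * (1 - Lambda M i ^+ 2).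
  by rewrite /perp exprMn -(cos2_sin2_load l1); ring.
have -> : chord i ^+ 2 + (emf M i * V M / z) ^+ 2 * (1 - Lambda M i ^+ 2) =
   circle_shift ^+ 2 - 2 * circle_shift * (circle_shift - chord i)
     + (emf M i * V M / z) ^+ 2 by rewrite /chord; ring.
rewrite chordE // [X in 2 * X]shiftE -(impedance_cos hpos) -/z -/c.
by field; rewrite zn cn.
Qed.

Lemma perp_gt0 i : 0 < i -> `|Lambda M i| < 1 -> 0 < perp i.
Proof.
move=> i0 l1; rewrite !mulr_gt0 ?invr_gt0 // sqrtr_gt0 subr_gt0.
by rewrite -[ltLHS]real_normK ?num_real // exprn_ilt1.
Qed.

Lemma chord_decr i j : 0 < i -> i <= j ->
  chord i - chord j = (mf M * wg M) ^+ 2 * c / z * (j ^+ 2 - i ^+ 2).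
Proof.
move=> i0 ij; rewrite !chordE ?(lt_le_trans i0) // /emf.
by field; rewrite zn.
Qed.

Let double_angle : (c ^+ 2 - s ^+ 2) ^+ 2 + (2 * c * s) ^+ 2 = 1.
Proof.
have -> : (c ^+ 2 - s ^+ 2) ^+ 2 + (2 * c * s) ^+ 2 = (c ^+ 2 + s ^+ 2) ^+ 2 by ring.
by rewrite cs expr1n.
Qed.

(** At [i0] the point is the top or bottom of the circle, so [chord i0] is [radS] times the sine of
    [2 phi], up to sign. As [chord] decreases, the side of [i0] on which [i] lies becomes the bound
    needed by [circle_sign]. *)
Lemma active_power_gt i (i0 : R) : is_if0 M i0 -> 0 < i -> `|Lambda M i| < 1 ->
  (if Rs M < wg M * Ls M then i < i0 else i0 < i) ->
  0 < outP M (Xi M i) + circle_shift.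
Proof.
move=> [[i00 l0] SE] ip l1 side; have i0p : 0 < i0 := i00.
rewrite outP_chord ?ltW //.
have Cp : - chord i0 * (c ^+ 2 - s ^+ 2) + perp i0 * (2 * c * s) = 0.
  by rewrite -outP_chord //; case: SE => -> _; rewrite /circle_shift addNr.
have CQ := G_chord i0p l0.
have C0 : chord i0 = - G M i0 * (2 * c * s).
  rewrite CQ; apply/eqP; rewrite -subr_eq0; apply/eqP.
  have -> : chord i0 - - (- chord i0 * (2 * c * s) - perp i0 * (c ^+ 2 - s ^+ 2)) * (2 * c * s)
     = chord i0 * (1 - ((c ^+ 2 - s ^+ 2) ^+ 2 + (2 * c * s) ^+ 2)) -
       (- chord i0 * (c ^+ 2 - s ^+ 2) + perp i0 * (2 * c * s)) * (c ^+ 2 - s ^+ 2) by ring.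
  by rewrite double_angle Cp; ring.
have GE : G M i0 = if Rs M < wg M * Ls M then radS M else - radS M.
  by rewrite /G; case: SE => _ ->.
have k0 : 0 < (mf M * wg M) ^+ 2 * c / z by rewrite !mulr_gt0 ?invr_gt0 ?exprn_gt0 ?mulr_gt0.
have zc : z * c = Rs M := impedance_cos hpos.
have zs : z * s = wg M * Ls M := impedance_sin hpos.
have s2 : 0 < 2 * c * s by apply: mulr_gt0 => //; apply: mulr_gt0.
apply: (circle_sign (power_circle ip (ltW l1)) (perp_gt0 ip l1) radS_gt0 double_angle s2).
case: ifP side GE => [lt|/negbT].
  move=> side GE; left; split.
    have : c < s by rewrite -(ltr_pM2l z0) zc zs.
    by rewrite subr_lt0 => cls; rewrite ltr_pXn2r ?nnegrE ?ltW.
  rewrite -mulNr -GE -C0 -subr_gt0 chord_decr ?ltW //.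
  by rewrite mulr_gt0 // subr_gt0 ltr_pXn2r ?nnegrE ?ltW.
rewrite -leNgt => le side GE; right; split.
  have : s <= c by rewrite -(ler_pM2l z0) zc zs.
  by rewrite subr_ge0 => sc; rewrite ler_pXn2r ?nnegrE ?(ltW c0) ?(ltW s0).
rewrite -[radS M]opprK -GE -C0 -subr_gt0 chord_decr ?ltW //.
by rewrite mulr_gt0 // subr_gt0 ltr_pXn2r ?nnegrE ?ltW.
Qed.

Lemma G_secant (i j : R) : 0 < i -> 0 < j ->
  `|Lambda M i| <= 1 -> `|Lambda M j| <= 1 ->
  (G M j - G M i) * (perp i + perp j) = (chord i - chord j) *
    ((outP M (Xi M i) + circle_shift) + (outP M (Xi M j) + circle_shift)).
Proof.
move=> i0 j0 li lj; rewrite !G_chord // !outP_chord //.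
apply: secant_identity; [exact: power_circle|exact: power_circle].
Qed.

Lemma G_strongly_increasing (a b pm : R) : 0 < a -> 0 < pm ->
  (forall i, a <= i <= b -> `|Lambda M i| < 1) ->
  (forall i, a <= i <= b -> pm <= outP M (Xi M i) + circle_shift) ->
  exists2 mu, 0 < mu & forall i j, a <= i <= b -> a <= j <= b -> i <= j ->
    mu * (j - i) <= G M j - G M i.
Proof.
move=> a0 pm0 Hl Hp.
pose k := (mf M * wg M) ^+ 2 * c / z.
have k0 : 0 < k by rewrite !mulr_gt0 ?invr_gt0 ?exprn_gt0 ?mulr_gt0.
have r0 := radS_gt0.
(* In the secant identity [chord] drops by at least [2 * k * a * (j - i)], the shifted active powers
   add up to at least [2 * pm], and the two values of [perp] to at most [2 * radS M]. *)
exists (2 * k * a * pm / radS M); first by rewrite !mulr_gt0 ?invr_gt0.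
move=> i j iab jab ij.
have i0 : 0 < i by move: iab => /andP[ai _]; exact: lt_le_trans ai.
have j0 := lt_le_trans i0 ij.
have li := Hl i iab; have lj := Hl j jab.
have E := G_secant i0 j0 (ltW li) (ltW lj).
have Sle (l : R) : 0 < l -> `|Lambda M l| < 1 -> perp l <= radS M.
  move=> lp l1; rewrite -(ler_pXn2r (n := 2)) ?nnegrE ?(ltW (perp_gt0 _ _)) ?(ltW r0) //.
  by rewrite -(power_circle lp (ltW l1)) lerDr sqr_ge0.
have S0 : 0 < perp i + perp j by rewrite addr_gt0 ?perp_gt0.
have S1 : perp i + perp j <= 2 * radS M.
  by have := Sle i i0 li; have := Sle j j0 lj; lra.
have d0 : 0 <= j - i by rewrite subr_ge0.
have a2 : 0 <= 2 * a * (j - i) by apply: mulr_ge0 => //; apply: mulr_ge0 => //; exact: ltW.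
have P1 : 0 <= k * (2 * a * (j - i)) by apply: mulr_ge0 => //; exact: ltW.
have P2 : 0 <= 2 * pm by apply: mulr_ge0 => //; exact: ltW.
have X : k * (2 * a * (j - i)) * (2 * pm) <= (G M j - G M i) * (perp i + perp j).
  rewrite E chord_decr // -/k; apply: ler_pM.
  - by [].
  - by [].
  - rewrite ler_pM2l // (_ : j ^+ 2 - i ^+ 2 = (j + i) * (j - i)); last by ring.
    rewrite ler_wpM2r //; have /andP[ai _] := iab; have /andP[aj _] := jab; lra.
  - by have := Hp i iab; have := Hp j jab; lra.
have D0 : 0 <= G M j - G M i.
  rewrite -(pmulr_lge0 _ S0); apply: le_trans X.
  exact: mulr_ge0.
have X2 := le_trans X (ler_wpM2l D0 S1).
rewrite mulrAC ler_pdivrMr //; lra.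
Qed.

End PowerCircle.

(** * The machine as an instance of the slow-fast plant *)

Section MachinePlant.
Variables (R : realType) (M : machine R) (a b : R).
Notation vec := 'cV[R]_4.
Hypothesis hpos : positive_parameters M.
Hypothesis hT : - V M ^+ 2 < 4 * Rs M * wg M * Tmt M.
Hypothesis a0 : 0 < a.
Hypothesis ab : a <= b.
Hypothesis Hl : forall i, a <= i <= b -> `|Lambda M i| < 1.
Hypothesis Hc : forall i, a <= i <= b -> euler_contractive (jac M i (Xi M i)).
Hypothesis Hp : forall i, a <= i <= b -> 0 < outP M (Xi M i) + circle_shift M.

Let Rs0 : 0 < Rs M. Proof. by have [[]] := hpos. Qed.
Let Ls0 : 0 < Ls M. Proof. by have [[]] := hpos. Qed.
Let J0 : 0 < J M. Proof. by have [[]] := hpos. Qed.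
Let mf0 : 0 < mf M. Proof. by have [[]] := hpos. Qed.
Let V0 : 0 < V M. Proof. by have [_ []] := hpos. Qed.

Let dist (i j : R) : R := `|i - j|.
Let D (i : R) : Prop := a <= i <= b.
Let dist_ge0 i j : 0 <= dist i j. Proof. exact: normr_ge0. Qed.
Let bl := blip dist D.

Let bc x : bl (fun=> x) := blip_cst D dist_ge0 x.
Let bD g h : bl g -> bl h -> bl (fun i => g i + h i) := @blipD _ _ _ _ dist_ge0 g h.
Let bM g h : bl g -> bl h -> bl (fun i => g i * h i) := @blipM _ _ _ _ dist_ge0 g h.
Let bN g : bl g -> bl (fun i => - g i) := @blipN _ _ _ _ g.

Let D_gt0 i : D i -> 0 < i.
Proof. by move=> /andP[ai _]; exact: lt_le_trans ai. Qed.

Let bid : bl (fun i => i).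
Proof.
apply: (@blip_intro _ _ _ _ dist_ge0 _ b 1) => // [i Di|i j _ _].
  by rewrite gtr0_norm ?D_gt0 //; move: Di => /andP[].
by rewrite mul1r.
Qed.

Let binv_flux : bl (fun i => (mf M * i)^-1).
Proof.
apply: (@blip_inv _ _ _ _ dist_ge0 _ (mf M * a)); first exact: mulr_gt0.
  by move=> i /andP[ai _]; rewrite ler_pM2l.
exact: bM.
Qed.

Let bLambda : bl (Lambda M).
Proof.
by rewrite /Lambda; apply: bD; apply: bM => //;
  [apply: bN; apply: bM | apply: bM => //; apply: bM => //; apply: bM].
Qed.

Let bdelta1 : bl (delta1 M).
Proof.
have g0 i : D i -> 0 < 1 - Lambda M i * Lambda M i.
  move=> Di; rewrite subr_gt0 -expr2 -real_normK ?num_real //.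
  by rewrite exprn_ilt1 // Hl.
(* By compactness [Lambda] keeps a distance from 1 and -1, where [acos] is not Lipschitz. *)
have [k k0 Hk] : exists2 k, 0 < k & forall i, D i -> k <= 1 - Lambda M i * Lambda M i.
  by apply: blip_pos_min => //; apply: bD => //; apply: bN; apply: bM.
have k1 : k <= 1 - 0 * 0 + 1 by have := Hk a; rewrite /D lexx ab => /(_ isT);
  have := sqr_ge0 (Lambda M a); rewrite expr2; lra.
rewrite /delta1; apply: bD => //.
apply: (blip_acos dist_ge0 (l := Num.sqrt (1 - k))) => //.
  by rewrite -[ltRHS]sqrtr1 ltr_sqrt //; lra.
move=> i Di; rewrite -sqrtr_sqr ler_wsqrtr // expr2; have := Hk i Di; lra.
Qed.

Let bsin : bl (fun i => sin (delta1 M i)) := blip_sin dist_ge0 bdelta1.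
Let bcos : bl (fun i => cos (delta1 M i)) := blip_cos dist_ge0 bdelta1.

Let biq : bl (fun i => iq_ (Xi M i)).
Proof. by under eq_fun do rewrite iq_Xi /iq_eq; apply: bN; apply: bM. Qed.

Let bXid : bl (fun i => id_ (Xi M i)).
Proof.
have -> : (fun i => id_ (Xi M i)) = fun i =>
   - (Tmt M * wg M / pr M * (mf M * i)^-1) + V M / Rs M * sin (delta1 M i).
  apply/funext => i; rewrite /Xi mkstateE; congr (- _ + _); last by ring.
  by rewrite invfM; ring.
by apply: bD; [apply: bN|]; apply: bM.
Qed.

Let bomega : bl (fun i => omega_ (Xi M i)).
Proof. by under eq_fun do rewrite omega_Xi. Qed.

Let bdelta : bl (fun i => delta_ (Xi M i)).
Proof. by under eq_fun do rewrite delta_Xi. Qed.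

Lemma Xi_lipschitz : exists2 K : R, 0 <= K &
  (forall i, a <= i <= b -> `|Xi M i| <= K) /\
  (forall i j, a <= i <= b -> a <= j <= b -> `|Xi M i - Xi M j| <= K * `|i - j|).
Proof. exact: (blip_state dist_ge0 bXid biq bomega bdelta). Qed.

Lemma jac_lipschitz : exists2 K : R, 0 <= K &
  forall i j (v : vec), a <= i <= b -> a <= j <= b ->
  `|jac M i (Xi M i) *m v - jac M j (Xi M j) *m v| <= K * `|i - j| * `|v|.
Proof.
have [K1 K10 [_ L1]] := biq; have [K2 K20 [_ L2]] := bXid.
have [K3 K30 [_ L3]] := bsin; have [K4 K40 [_ L4]] := bcos.
pose v := V M / Ls M; have v0 : 0 <= v by rewrite divr_ge0 // ltW.
pose m1 := mf M / Ls M; have m10 : 0 <= m1 by rewrite divr_ge0 // ltW.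
pose m2 := mf M / J M; have m20 : 0 <= m2 by rewrite divr_ge0 // ltW.
have p3 : 0 <= v * K3 by rewrite mulr_ge0.
have p4 : 0 <= v * K4 by rewrite mulr_ge0.
exists (K1 + v * K4 + (K2 + m1 + v * K3) + m2); first by rewrite !addr_ge0.
move=> i j x Di Dj; set d := `|i - j|; have d0 : 0 <= d := normr_ge0 _.
have n0 : 0 <= d * `|x| by rewrite mulr_ge0.
have xd := coord_le_norm x 0; have xq := coord_le_norm x 1.
have xo := coord_le_norm x 2; have xt := coord_le_norm x 3.
rewrite -/(id_ x) in xd; rewrite -/(iq_ x) in xq.
rewrite -/(omega_ x) in xo; rewrite -/(delta_ x) in xt.
have T (p q k : R) : `|p| <= k * d -> `|q| <= `|x| -> `|p * q| <= k * (d * `|x|).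
  by move=> hp hq; rewrite normrM mulrA ler_pM.
have TZ (w p q k : R) : 0 <= w -> `|p| <= k * d -> `|q| <= `|x| ->
    `|w * p * q| <= w * k * (d * `|x|).
  by move=> w0 hp hq; rewrite -!mulrA normrM (ger0_norm w0) ler_wpM2l // T.
have B1 := L1 i j Di Dj; have B2 := L2 i j Di Dj.
have B3 := L3 i j Di Dj; have B4 := L4 i j Di Dj.
rewrite !jac_mul mkstateB; apply: state_norm_le; rewrite mkstateE.
- rewrite !omega_Xi !delta_Xi.
  have -> : - Rs M / Ls M * id_ x + wg M * iq_ x + iq_ (Xi M i) * omega_ x +
       V M * cos (delta1 M i) / Ls M * delta_ x -
     (- Rs M / Ls M * id_ x + wg M * iq_ x + iq_ (Xi M j) * omega_ x +
       V M * cos (delta1 M j) / Ls M * delta_ x) =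
     (iq_ (Xi M i) - iq_ (Xi M j)) * omega_ x +
     v * (cos (delta1 M i) - cos (delta1 M j)) * delta_ x by rewrite /v; ring.
  apply: le_trans (ler_normD _ _) _.
  apply: le_trans (lerD (T _ _ _ B1 xo) (TZ _ _ _ _ v0 B4 xt)) _.
  by rewrite -mulrDl -mulrA ler_wpM2r // -[leRHS]addrA lerDl !addr_ge0.
- rewrite !omega_Xi !delta_Xi.
  have -> : - wg M * id_ x - Rs M / Ls M * iq_ x +
       (- id_ (Xi M i) - mf M * i / Ls M) * omega_ x -
       V M * sin (delta1 M i) / Ls M * delta_ x -
     (- wg M * id_ x - Rs M / Ls M * iq_ x +
       (- id_ (Xi M j) - mf M * j / Ls M) * omega_ x -
       V M * sin (delta1 M j) / Ls M * delta_ x) =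
     - ((id_ (Xi M i) - id_ (Xi M j)) * omega_ x + m1 * (i - j) * omega_ x +
     v * (sin (delta1 M i) - sin (delta1 M j)) * delta_ x) by rewrite /v /m1; ring.
  rewrite normrN; apply: le_trans (ler_normD _ _) _.
  have B5 : `|i - j| <= 1 * d by rewrite mul1r.
  apply: le_trans (lerD (le_trans (ler_normD _ _)
    (lerD (T _ _ _ B2 xo) (TZ _ _ _ _ m10 B5 xo))) (TZ _ _ _ _ v0 B3 xt)) _.
  rewrite mulr1 -!mulrDl -[leRHS]mulrA ler_wpM2r //.
  by rewrite -[leRHS]addrA [leRHS]addrCA lerDl !addr_ge0.
- have -> : mf M * i / J M * iq_ x - Dp M / J M * omega_ x -
     (mf M * j / J M * iq_ x - Dp M / J M * omega_ x) = m2 * (i - j) * iq_ x.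
    by rewrite /m2; ring.
  have B5 : `|i - j| <= 1 * d by rewrite mul1r.
  apply: le_trans (TZ _ _ _ _ m20 B5 xq) _.
  by rewrite mulr1 -[leRHS]mulrA ler_wpM2r // lerDr !addr_ge0.
- by rewrite subrr normr0 -mulrA mulr_ge0 // !addr_ge0.
Qed.

Let boutP : bl (fun i => outP M (Xi M i) + circle_shift M).
Proof.
apply: bD => //; rewrite /outP; under eq_fun do rewrite delta_Xi.
by apply: bM => //; apply: bD; apply: bM.
Qed.

Lemma G_strongly_increasing_itv : exists2 mu, 0 < mu &
  forall i j, a <= i <= b -> a <= j <= b -> i <= j -> mu * (j - i) <= G M j - G M i.
Proof.
have [pm pm0 Hpm] := blip_pos_min ab boutP Hp.
exact: (G_strongly_increasing hpos hT a0 pm0 Hl Hpm).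
Qed.

Lemma machine_plant :
  exists (N : R -> vec -> R) (c2 c3 al h0 C2 CQ LX LG mu : R),
    plant (vfieldP M) (outQ M) (Xi M) (fun i => jac M i (Xi M i)) a b
      N c2 c3 al h0 C2 CQ LX LG mu.
Proof.
have [LX LX0 [BX LXH]] := Xi_lipschitz.
have [LA LA0 LAH] := jac_lipschitz.
have [N [c2 [c3 [al [h0 HN]]]]] := has_lyapunov_norms_itv ab LA0 LAH Hc.
have [mu mu0 Hmu] := G_strongly_increasing_itv.
have [CQ CQ0 HQ] := outQ_lipschitz M a b (addr_ge0 LX0 ler01).
have HQ' (i : R) (x y : vec) : a <= i <= b -> `|x| <= LX + 1 -> `|y| <= LX + 1 ->
    `|outQ M x - outQ M y| <= CQ * `|x - y|.
  move=> Di xb yb; have := HQ i i x y Di Di xb yb.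
  rewrite subrr normr0 add0r => /(le_trans _); apply.
  by rewrite -raddfB norm_const_mx.
have BX' i : a <= i <= b -> `|Xi M i| <= LX + 1.
  by move=> Di; apply: le_trans (BX i Di) _; rewrite lerDl.
have near i e : a <= i <= b -> `|e| <= 1 -> `|Xi M i + e| <= LX + 1.
  by move=> Di e1; apply: le_trans (ler_normD _ _) _; rewrite lerD ?BX.
exists N, c2, c3, al, h0, (1 + 2 * V M / Ls M), CQ, LX, (CQ * LX), mu.
split=> //.
- by rewrite addr_ge0 // divr_ge0 ?mulr_ge0 // ltW.
- exact: mulr_ge0.
- move=> i e Di e1; have := vfieldP_taylor Ls0 V0 i (Xi M i) e1.
  by rewrite (Xi_equilibrium hpos (D_gt0 Di) (ltW (Hl Di))) subr0.
- move=> i e Di e1; apply: le_trans (HQ' i _ _ Di (near i e Di e1) (BX' i Di)) _.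
  by rewrite [Xi M i + e]addrC addrK.
- move=> i j Di Dj; apply: le_trans (HQ' i _ _ Di (BX' i Di) (BX' j Dj)) _.
  by rewrite -mulrA ler_wpM2l // LXH.
Qed.

End MachinePlant.

Theorem theoremV2 (R : realType) (M : machine R) (umin umax eps if0 : R)
    (hpos : positive_parameters M)
    (hT : - V M ^+ 2 < 4 * Rs M * wg M * Tmt M)
    (hu : umin < umax) (heps : 0 < eps)
    (hif0 : is_if0 M if0)
    (hU : `[umin - eps, umax + eps] `<=` Ifplus M if0)
    (hstab : forall i : R, umin - eps <= i <= umax + eps ->
       exists xe : 'cV[R]_4, exp_stable_equilibrium (vfieldP M i) setT xe) :
  forall (Qset : R) (Qt := Qtilde M Qset),
    G M umin <= Qt <= G M umax ->
    let ifr := Ginv M `[umin - eps, umax + eps] Qt in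
    exists eps0 kappa : R, [/\ 0 < eps0, 0 < kappa &
      forall Kt : R, kappa^-1 < Kt ->
        let F := vfieldCL M umin umax Qt Kt in
        let X := stateCL umin umax in
        exp_stable_equilibrium F X (mkz (Xi M ifr) ifr) /\
        exists2 lambda : R, 0 < lambda &
          forall z0 : 'cV[R]_(4 + 1), X z0 ->
            `|x_ z0 - Xi M (if_ z0)| <= eps0 ->
            (exists z, is_solution F X z /\ z 0 = z0) /\
            (forall z, is_solution F X z -> z 0 = z0 ->
               [/\ exp_converges lambda (fun t => x_ (z t)) (Xi M ifr),
                   exp_converges lambda (fun t => if_ (z t)) ifr &
                   exp_converges lambda (fun t => outQ M (x_ (z t))) Qt])].
Proof.
move=> Qset Qt HQt ifr.
pose a := umin - eps; pose b := umax + eps.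
have ab : a <= b by rewrite /a /b; lra.
(* Positivity comes from [inf If >= 0] in the first case, [If] being nonempty as it contains [if0],
   and from [0 < if0] in the second. *)
have side i : a <= i <= b -> 0 < i /\
    (if Rs M < wg M * Ls M then i < if0 else if0 < i).
  move=> iab; have : Ifplus M if0 i by apply: hU; rewrite /= in_itv.
  rewrite /Ifplus; case: ifP => _ /=; rewrite in_itv /= => /andP[i1 i2].
    split=> //; apply: le_lt_trans i1; apply: lb_le_inf.
      by exists if0; case: hif0.
    by move=> y [y0 _]; exact: ltW.
  by split=> //; apply: lt_trans i1; case: hif0 => -[].
have stat i : a <= i <= b ->
    `|Lambda M i| < 1 /\ euler_contractive (jac M i (Xi M i)).
  move=> iab; have [xe st] := hstab i iab.
  exact: (stable_equilibrium_Xi hpos (side i iab).1 st).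
have Hl i : a <= i <= b -> `|Lambda M i| < 1 by move=> /stat[].
have Hc i : a <= i <= b -> euler_contractive (jac M i (Xi M i)) by move=> /stat[].
have Hp i : a <= i <= b -> 0 < outP M (Xi M i) + circle_shift M.
  move=> iab; have [i0 sd] := side i iab.
  exact: (active_power_gt hpos hT hif0 i0 (Hl i iab) sd).
have a0 : 0 < a by apply: (side a _).1; rewrite lexx.
have [mu mu0 Hmu] := G_strongly_increasing_itv hpos hT a0 ab Hl Hp.
have sub i : umin <= i <= umax -> a <= i <= b.
  by rewrite /a /b => /andP[*]; apply/andP; split; lra.
have umin0 : 0 < umin by apply: lt_trans a0 _; rewrite /a; lra.
(* The plant lives on [umin, umax], the range of the integrator, while injectivity of [G] is needed
   on the larger interval over which [Ginv] inverts it. *)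
have [N [c2 [c3 [al [h0 [C2 [CQ [LX [LG [m pl]]]]]]]]]] :=
  machine_plant hpos hT umin0 (ltW hu) (fun i H => Hl i (sub i H))
    (fun i H => Hc i (sub i H)) (fun i H => Hp i (sub i H)).
have [i1 i1ab GE] : exists2 i1, umin <= i1 <= umax & G M i1 = Qt.
  have cG := lipschitz_within_continuous (pl_LG pl) (pl_G pl).
  have Gle : G M umin <= G M umax by case/andP: HQt => h1 h2; exact: le_trans h2.
  have [|c cab Gc] := IVT (v := Qt) (ltW hu) cG.
    by rewrite min_l // max_r.
  by exists c.
have inj : {in `[a, b]%classic &, injective (G M)}.
  move=> i j; rewrite !inE /= !in_itv /= => iab jab E.
  wlog ij : i j iab jab E / i <= j.
    by move=> H; have [ij|/ltW ji] := leP i j; [exact: H|apply/esym/H].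
  have := Hmu i j iab jab ij; rewrite E subrr pmulr_rle0 // subr_le0 => ji.
  by apply/eqP; rewrite eq_le ij ji.
have ifrE : ifr = i1.
  rewrite /ifr /Ginv -GE; apply: pinvKV => //.
  by rewrite inE /= in_itv /=; apply: sub.
have [eps0 [kappa [e0 k0 main]]] := low_gain_stability hu
  (@vfieldP_lipschitz R M umin umax) (@outQ_lipschitz R M umin umax) pl i1ab.
exists eps0, kappa; split=> // Kt Ktk.
rewrite ifrE -GE; exact: main.
Qed.
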